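(* Let $(B,g)$ be a pseudo-Riemannian manifold with Levi-Civita covariant derivative $\nabla$, and let $\sigma$ be $\pm 1$. (i) Let $\pi:P\to B$ be a principal $S^1$-bundle over $B$ with connection form $A$, and let $\tilde g:=\pi^*g+\sigma A\otimes A$ be the corresponding Kaluza-Klein metric on $P$, with Levi-Civita covariant derivative $D$. Let $\Omega$ be the curvature form of $A$, $v$ the fundamental vertical field and $\phi$ the endomorphism field of $TB$ defined in the context. Suppose there is a light-like recurrent vector field $\tilde R$ on $P$ of the form $\tilde R=f\,\xi^*+h\,v$, where $\xi$ is a vector field on $B$ such that $g(\xi,\xi)=\sigma$, $\xi^*$ is its horizontal lift, and $f,h\in C^\infty(P)$. Then $\varepsilon=\operatorname{sign}(fh)$ is locally constant equal to $\pm 1$, and: $\xi$ is a Killing vector field; $D(\xi^*+\varepsilon v)=0$; $\phi\xi=0$; $\Omega(\xi,\cdot)=0$; $\phi=-\varepsilon\nabla\xi$ (i.e. $\phi X=-\varepsilon\nabla_X\xi$ for all $X$). Furthermore $\Omega=-i\sigma\varepsilon\,d\eta$ for the $1$-form $\eta:=g(\xi,\cdot)$, and the connection form $A_0:=A+i\sigma\varepsilon\,\pi^*\eta$ on the bundle $\pi:P\to B$ is flat. (ii) Conversely, suppose $(B,g)$ admits a Killing vector field $\xi$ such that $g(\xi,\xi)=\sigma$, and suppose the principal $S^1$-bundle $\pi:P\to B$ admits a flat connection form $A_0$. Let $\tilde g$ be the metric $\pi^*g+\sigma A\otimes A$ for the connection form $A:=A_0-i\sigma\varepsilon\,\pi^*\eta$,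 with $\eta:=g(\xi,\cdot)$ and $\varepsilon=\pm 1$. Then $P$ admits the light-like vector field $\xi^*+\varepsilon v$ (with $\xi^*$ the horizontal lift of $\xi$ with respect to $A$), which is parallel for the Levi-Civita connection associated to $\tilde g$.
   Context: The Lie algebra of $S^1=U(1)$ is identified with $i\mathbb{R}$. For a principal $S^1$-bundle $\pi:P\to B$ with connection form $A:TP\to i\mathbb{R}$: $v$ is the vertical vector field on $P$ ($T\pi(v)=0$) with $A(v)$ constant equal to $i$; for a vector field $X$ on $B$, the horizontal lift $X^*$ is the unique vector field on $P$ with $A(X^* )=0$ and $T\pi(X^* )=X$; the curvature form $\Omega$ is the $i\mathbb{R}$-valued $2$-form on $B$ with $\Omega(X,Y)=-A([X^*,Y^*])$; $A$ is flat if its curvature form vanishes. The endomorphism field $\phi$ of $TB$ is defined by $g(\phi X,Y)=\sigma\frac{i}{2}\Omega(X,Y)$. A vector field $\tilde R$ on $P$ is recurrent if it is non-vanishing and $D\tilde R=\omega\otimes\tilde R$ for some scalar-valued $1$-form $\omega$ on $P$; it is light-like if $\tilde g(\tilde R,\tilde R)=0$. The convention for the exterior derivative is $d\eta(X,Y)=X(\eta(Y))-Y(\eta(X))-\eta([X,Y])$.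
   Formalization: With the stated conventions the printed sign is wrong; proved instead: Ω = +iσε dη and A_0 := A − iσε π*η flat in (i), and A := A_0 + iσε π*η in (ii); all other claims are as stated. *)

(* Defs.v *)
From HB Require Import structures.
From mathcomp Require Import all_boot all_order all_algebra.
From mathcomp Require Import all_classical all_reals all_analysis.
From mathcomp Require Import complex ring.

Set Implicit Arguments.
Unset Strict Implicit.
Unset Printing Implicit Defensive.
Import Order.TTheory GRing.Theory Num.Theory.
Import numFieldNormedType.Exports.
Local Open Scope classical_set_scope.
Local Open Scope ring_scope.

Section smooth_rn.
Context {R : realType} {n : nat}.
Implicit Types (U : set 'rV[R]_n) (f g : 'rV[R]_n -> R).

Fixpoint Ck (k : nat) U f : Prop :=
  (forall x, U x -> {for x, continuous f}) /\
  if k is k'.+1 then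
    forall i : 'I_n, (forall x, U x -> derivable f x (delta_mx 0 i)) /\
                     Ck k' U ('D_(delta_mx 0 i) f)
  else True.

Definition smooth_on U f := forall k, Ck k U f.

Lemma Ck_S k U f : Ck k.+1 U f -> Ck k U f.
Proof.
elim: k f => [|k IH] f [fc fd]; first by split.
by split=> // i; have [? ?] := fd i; split=> //; apply: IH.
Qed.

Lemma Ck_eq k U f g : open U -> (forall x, U x -> f x = g x) ->
  Ck k U f -> Ck k U g.
Proof.
move=> oU.
have near_fg f' g' x : (forall y, U y -> f' y = g' y) -> U x ->
    \near x, f' x = g' x.
  by move=> fg Ux; apply: filterS (open_nbhs_nbhs (conj oU Ux)).
have gc f' g' x : (forall y, U y -> f' y = g' y) -> U x ->
    {for x, continuous f'} -> {for x, continuous g'}.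
  move=> fg Ux fc; rewrite /prop_for /continuous_at -(fg x Ux).
  apply: cvg_trans fc; apply: (@near_eq_cvg _ _ (nbhs x)).
  exact: (near_fg _ _ _ fg Ux).
elim: k f g => [|k IH] f g fg [fc fd].
  by split=> // x Ux; apply: gc (fc x Ux).
split=> [x Ux|i]; first by apply: gc (fc x Ux).
have [df Dk] := fd i; have fgx x Ux := near_fg f g x fg Ux.
split=> [x Ux|].
  by apply: (near_eq_derivable (fgx x Ux)); exact: df.
by apply: IH Dk => x Ux; apply: near_eq_derive => //; exact: fgx.
Qed.

Lemma Ck_cst k U (a : R) : Ck k U (fun=> a).
Proof.
elim: k a => [|k IH] a; (split; first by move=> x _; exact: cst_continuous).
  by [].
move=> i; split=> [x _|]; first exact: derivable_cst.
rewrite (_ : 'D__ _ = fun=> 0); first exact: IH.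
by apply/funext => x; rewrite derive_cst.
Qed.

Lemma Ck_D k U f g : open U -> Ck k U f -> Ck k U g -> Ck k U (f \+ g).
Proof.
move=> oU; elim: k f g => [|k IH] f g [fc fd] [gc gd].
  by split=> // x Ux; apply: continuousD; [exact: fc|exact: gc].
split=> [x Ux|i]; first by apply: continuousD; [exact: fc|exact: gc].
have [df Df] := fd i; have [dg Dg] := gd i; split=> [x Ux|].
  by apply: derivableD; [exact: df|exact: dg].
apply: Ck_eq (IH _ _ Df Dg) => // x Ux /=.
by rewrite deriveD //; [exact: df|exact: dg].
Qed.

Lemma Ck_M k U f g : open U -> Ck k U f -> Ck k U g -> Ck k U (f \* g).
Proof.
move=> oU; elim: k f g => [|k IH] f g Cf Cg.
  by split=> // x Ux; apply: continuousM; [case: Cf => /(_ x Ux)|case: Cg => /(_ x Ux)].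
split=> [x Ux|i].
  by apply: continuousM; [case: Cf => /(_ x Ux)|case: Cg => /(_ x Ux)].
have [df Df] := (proj2 Cf) i; have [dg Dg] := (proj2 Cg) i; split=> [x Ux|].
  by apply: derivableM; [exact: df|exact: dg].
have H := Ck_D oU (IH _ _ (Ck_S Cf) Dg) (IH _ _ (Ck_S Cg) Df).
apply: Ck_eq H => // x Ux /=.
by rewrite deriveM //; [exact: df|exact: dg].
Qed.

End smooth_rn.

(* An R^n-valued chart of a topological space T; [cinv] is only meaningful on *)
(* the open set [cmap @` cdom]. *)
Record chart (R : realType) (n : nat) (T : topologicalType) := Chart {
  cdom : set T ;
  cmap : T -> 'rV[R]_n ;
  cinv : 'rV[R]_n -> T ;
  cdom_open : open cdom ;
  cimg_open : open (cmap @` cdom) ;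
  cmap_continuous : forall x, cdom x -> {for x, continuous cmap} ;
  cinv_continuous : forall y, (cmap @` cdom) y -> {for y, continuous cinv} ;
  cmapK : forall x, cdom x -> cinv (cmap x) = x }.

Record manifold (R : realType) (n : nat) := Manifold {
  mcarrier :> topologicalType ;
  atlas : set (chart R n mcarrier) ;
  _ : hausdorff_space mcarrier ;
  _ : @second_countable mcarrier ;
  _ : forall x : mcarrier, exists2 c, atlas c & cdom c x ;
  _ : forall c c', atlas c -> atlas c' -> forall i,
        smooth_on (cmap c @` (cdom c `&` cdom c'))
                  (fun y => cmap c' (cinv c y) 0 i) }.

Section smooth_functions.
Context {R : realType} {n : nat} (M : manifold R n).

(* smoothness on an open subset V of M *)
Definition smooth_fun_on (V : set M) (f : M -> R) := forall c, @atlas R n M c ->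
  smooth_on (cmap c @` (cdom c `&` V)) (f \o cinv c).

Definition smooth_fun (f : M -> R) := smooth_fun_on setT f.

Definition smooth_pred : {pred M -> R} := [pred f | `[< smooth_fun f >]].

Lemma smooth_predP f : reflect (smooth_fun f) (f \in smooth_pred).
Proof. by rewrite inE; exact: asboolP. Qed.

Let img_open c : open (@cmap R n M c @` (cdom c `&` setT)).
Proof. by rewrite setIT; exact: cimg_open. Qed.

Lemma smooth_pred_cst (a : R) : (fun=> a) \in smooth_pred.
Proof. by apply/smooth_predP => c _ k; exact: Ck_cst. Qed.

Lemma smooth_predD f g : f \in smooth_pred -> g \in smooth_pred ->
  f + g \in smooth_pred.
Proof.
move=> /smooth_predP sf /smooth_predP sg; apply/smooth_predP => c ac k.
by apply: (Ck_eq (@img_open c) _ (Ck_D (@img_open c) (sf c ac k) (sg c ac k))).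
Qed.

Lemma smooth_predM f g : f \in smooth_pred -> g \in smooth_pred ->
  f * g \in smooth_pred.
Proof.
move=> /smooth_predP sf /smooth_predP sg; apply/smooth_predP => c ac k.
by apply: (Ck_eq (@img_open c) _ (Ck_M (@img_open c) (sf c ac k) (sg c ac k))).
Qed.

Lemma smooth_pred_subring : subring_closed smooth_pred.
Proof.
split=> [|f g sf sg|]; [exact: smooth_pred_cst| |exact: smooth_predM].
rewrite (_ : f - g = f + (fun=> -1) * g).
  by apply: smooth_predD => //; apply: smooth_predM => //; exact: smooth_pred_cst.
by apply/funext => x; rewrite !fctE mulN1r.
Qed.

Record cinf := CInf { cinf_val :> M -> R ; cinfP : cinf_val \in smooth_pred }.

HB.instance Definition _ := [isSub for cinf_val].
HB.instance Definition _ := [Choice of cinf by <:].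
HB.instance Definition _ := GRing.SubChoice_isSubComPzRing.Build
  (M -> R) smooth_pred cinf smooth_pred_subring.

Lemma cinf_ext (f g : cinf) : (forall p, f p = g p) -> f = g.
Proof. by move=> fg; apply/val_inj/funext. Qed.

Lemma cinf_scale_subproof (a : R) (f : cinf) :
  (fun p => a * f p) \in smooth_pred.
Proof. exact: (smooth_predM (smooth_pred_cst a) (cinfP f)). Qed.

Definition cinf_scale a f := CInf (cinf_scale_subproof a f).


Fact cinf_scaleA a b f : cinf_scale a (cinf_scale b f) = cinf_scale (a * b) f.
Proof. by apply: cinf_ext => p /=; rewrite mulrA. Qed.

Fact cinf_scale1 : left_id 1 cinf_scale.
Proof. by move=> f; apply: cinf_ext => p /=; rewrite mul1r. Qed.

Fact cinf_scaleDr : right_distributive cinf_scale +%R.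
Proof. by move=> a f g; apply: cinf_ext => p; exact: mulrDr. Qed.

Fact cinf_scaleDl f : {morph cinf_scale^~ f : a b / a + b}.
Proof. by move=> a b; apply: cinf_ext => p; exact: mulrDl. Qed.

HB.instance Definition _ := GRing.Zmodule_isLmodule.Build R cinf
  cinf_scaleA cinf_scale1 cinf_scaleDr cinf_scaleDl.

(* equal to f when f is smooth, the only case in which it is meant to be used *)
Definition to_cinf (f : M -> R) : cinf := insubd 0 f.

End smooth_functions.

Arguments smooth_pred {R n} M.

Section tangent_spaces.
Context {R : realType} {n : nat} (M : manifold R n).
Implicit Types (p : M) (f g : cinf M).

Definition is_derivation p (v : cinf M -> R) : Prop :=
  (forall (a : R) f g, v (a *: f + g) = a * v f + v g) /\
  (forall f g, v (f * g) = f p * v g + g p * v f).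

Definition derivation_pred p : {pred cinf M -> R^o} :=
  [pred v | `[< is_derivation p v >]].

Record tangent p := Tangent {
  tangent_val :> cinf M -> R^o ;
  tangent_in : tangent_val \in derivation_pred p }.

Lemma tangentP p (v : tangent p) : is_derivation p v.
Proof. by have := tangent_in v => /asboolP. Qed.

HB.instance Definition _ p := [isSub for @tangent_val p].
HB.instance Definition _ p := [Choice of tangent p by <:].

Lemma derivation_submod p : submod_closed (derivation_pred p).
Proof.
split=> [|a u v].
  apply/asboolP; split=> [a f g|f g].
    by change (0 = a * 0 + 0 :> R); rewrite mulr0 addr0.
  by change (0 = f p * 0 + g p * 0 :> R); rewrite !mulr0 addr0.
move=> /asboolP [uL uM] /asboolP [vL vM]; apply/asboolP; split=> [b f g|f g].
  change (a * u (b *: f + g) + v (b *: f + g) =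
          b * (a * u f + v f) + (a * u g + v g)); rewrite uL vL; ring.
change (a * u (f * g) + v (f * g) =
        f p * (a * u g + v g) + g p * (a * u f + v f)); rewrite uM vM; ring.
Qed.

HB.instance Definition _ p := GRing.SubChoice_isSubLmodule.Build R
  (cinf M -> R^o) (derivation_pred p) (tangent p) (derivation_submod p).

Definition mk_tangent p (v : cinf M -> R) (hv : is_derivation p v) : tangent p :=
  @Tangent p v (introT (asboolP _) hv).

Lemma tangent_ext p (u v : tangent p) : (forall f, u f = v f) -> u = v.
Proof. by move=> uv; apply/val_inj/funext. Qed.

Record vfield := VField {
  vfield_val :> forall p, tangent p ;
  vfield_smooth : forall f, (fun p => vfield_val p f) \in smooth_pred M }.

Lemma vfield_ext (X Y : vfield) : (forall p, X p = Y p) -> X = Y.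
Proof.
case: X Y => [X sX] [Y sY] /= XY.
have E : X = Y by apply: functional_extensionality_dep.
by subst Y; congr VField; exact: Prop_irrelevance.
Qed.

(* the smooth function X(f) *)
Definition vapp (X : vfield) f : cinf M := CInf (vfield_smooth X f).

Lemma vfield0_subproof f : (fun p => (0 : tangent p) f) \in smooth_pred M.
Proof. exact: cinfP (0 : cinf M). Qed.
Definition vfield0 := VField vfield0_subproof.

Lemma vfieldN_subproof (X : vfield) f :
  (fun p => (- X p) f) \in smooth_pred M.
Proof. exact: cinfP (- vapp X f). Qed.
Definition vfieldN X := VField (vfieldN_subproof X).

Lemma vfieldD_subproof (X Y : vfield) f :
  (fun p => (X p + Y p) f) \in smooth_pred M.
Proof. exact: cinfP (vapp X f + vapp Y f). Qed.
Definition vfieldD X Y := VField (vfieldD_subproof X Y).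

Lemma vfieldZ_subproof g (X : vfield) f :
  (fun p => (g p *: X p) f) \in smooth_pred M.
Proof. exact: cinfP (g * vapp X f). Qed.
Definition vfieldZ g X := VField (vfieldZ_subproof g X).

HB.instance Definition _ := gen_eqMixin vfield.
HB.instance Definition _ := gen_choiceMixin vfield.

Fact vfieldDA : associative vfieldD.
Proof. by move=> X Y Z; apply: vfield_ext => p; exact: addrA. Qed.
Fact vfieldDC : commutative vfieldD.
Proof. by move=> X Y; apply: vfield_ext => p; exact: addrC. Qed.
Fact vfieldD0 : left_id vfield0 vfieldD.
Proof. by move=> X; apply: vfield_ext => p; exact: add0r. Qed.
Fact vfieldDN : left_inverse vfield0 vfieldN vfieldD.
Proof. by move=> X; apply: vfield_ext => p; exact: addNr. Qed.

HB.instance Definition _ :=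
  GRing.isZmodule.Build vfield vfieldDA vfieldDC vfieldD0 vfieldDN.

Fact vfieldZA f g X : vfieldZ f (vfieldZ g X) = vfieldZ (f * g) X.
Proof. by apply: vfield_ext => p; exact: scalerA. Qed.
Fact vfieldZ1 : left_id 1 vfieldZ.
Proof. by move=> X; apply: vfield_ext => p; exact: scale1r. Qed.
Fact vfieldZDr : right_distributive vfieldZ +%R.
Proof. by move=> f X Y; apply: vfield_ext => p; exact: scalerDr. Qed.
Fact vfieldZDl X : {morph vfieldZ^~ X : f g / f + g}.
Proof. by move=> f g; apply: vfield_ext => p; exact: scalerDl. Qed.

HB.instance Definition _ := GRing.Zmodule_isLmodule.Build (cinf M) vfield
  vfieldZA vfieldZ1 vfieldZDr vfieldZDl.

Lemma vappL (X : vfield) (a : R) f g :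
  vapp X (a *: f + g) = a *: vapp X f + vapp X g.
Proof. by apply: cinf_ext => p; exact: (proj1 (tangentP (X p))). Qed.

Lemma vappM (X : vfield) f g : vapp X (f * g) = f * vapp X g + g * vapp X f.
Proof. by apply: cinf_ext => p; exact: (proj2 (tangentP (X p))). Qed.

Lemma lie_subproof (X Y : vfield) p :
  is_derivation p (fun f => X p (vapp Y f) - Y p (vapp X f)).
Proof.
have [XL XM] := tangentP (X p); have [YL YM] := tangentP (Y p).
have XD f g : X p (f + g) = X p f + X p g by have := XL 1 f g; rewrite scale1r mul1r.
have YD f g : Y p (f + g) = Y p f + Y p g by have := YL 1 f g; rewrite scale1r mul1r.
split=> [a f g|f g].
  by rewrite !vappL XL YL; ring.
by rewrite !vappM XD YD !XM !YM /=; ring.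
Qed.

Definition lie_at X Y p := mk_tangent (lie_subproof X Y p).

Lemma lie_smooth X Y f : (fun p => lie_at X Y p f) \in smooth_pred M.
Proof. exact: cinfP (vapp X (vapp Y f) - vapp Y (vapp X f)). Qed.

Definition lie (X Y : vfield) : vfield := VField (lie_smooth X Y).

End tangent_spaces.

(* A map is smooth iff it pulls smooth functions back to smooth functions;    *)
(* since manifolds are Hausdorff, hence have bump functions, this is the same *)
(* as being smooth in charts.                                                 *)
Record smooth_map (R : realType) (m n : nat) (M : manifold R m)
    (N : manifold R n) := SmoothMap {
  smap :> M -> N ;
  smapP : forall f : cinf N, f \o smap \in smooth_pred M }.

Section differential.
Context {R : realType} {m n : nat} {M : manifold R m} {N : manifold R n}.
Variable F : smooth_map M N.

Definition pullback (f : cinf N) : cinf M := CInf (smapP F f).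

Lemma differential_subproof p (v : tangent p) :
  is_derivation (F p) (fun f => v (pullback f)).
Proof.
have [vL vM] := tangentP v; split=> [a f g|f g].
  rewrite (_ : pullback _ = a *: pullback f + pullback g) ?vL//.
  exact: cinf_ext.
rewrite (_ : pullback _ = pullback f * pullback g) ?vM//.
exact: cinf_ext.
Qed.

Definition differential p (v : tangent p) : tangent (F p) :=
  mk_tangent (differential_subproof v).

End differential.

Section tensor_fields.
Context {R : realType} {n : nat} {M : manifold R n}.

Definition is_form1 (a : forall p : M, tangent p -> R) : Prop :=
  (forall p (c : R) (u w : tangent p), a p (c *: u + w) = c * a p u + a p w) /\
  (forall X : vfield M, smooth_fun (fun p => a p (X p))).

Definition is_iform1 (A : forall p : M, tangent p -> R[i]) : Prop :=
  (forall p (u : tangent p), complex.Re (A p u) = 0) /\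
  is_form1 (fun p u => complex.Im (A p u)).

Definition is_iform2 (Om : forall p : M, tangent p -> tangent p -> R[i]) : Prop :=
  [/\ forall p (u w : tangent p), complex.Re (Om p u w) = 0,
      forall p (u : tangent p), Om p u u = 0,
      forall p (c : R) (u u' w : tangent p),
        Om p (c *: u + u') w = c%:C%C * Om p u w + Om p u' w,
      forall p (c : R) (u w w' : tangent p),
        Om p u (c *: w + w') = c%:C%C * Om p u w + Om p u w' &
      forall X Y : vfield M, smooth_fun (fun p => complex.Im (Om p (X p) (Y p)))].

Definition is_endomorphism_field (phi : forall p : M, tangent p -> tangent p) :
    Prop :=
  (forall p (c : R) (u w : tangent p),
     phi p (c *: u + w) = c *: phi p u + phi p w) /\
  (forall (X : vfield M) (f : cinf M), smooth_fun (fun p => phi p (X p) f)).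

Definition is_pseudo_riemannian
    (g : forall p : M, tangent p -> tangent p -> R) : Prop :=
  [/\ forall p (c : R) (u u' w : tangent p),
        g p (c *: u + u') w = c * g p u w + g p u' w,
      forall p (u w : tangent p), g p u w = g p w u,
      forall p (u : tangent p), (forall w : tangent p, g p u w = 0) -> u = 0 &
      forall X Y : vfield M, smooth_fun (fun p => g p (X p) (Y p))].

Definition ext_deriv (eta : forall p : M, tangent p -> R) (X Y : vfield M)
    (p : M) : R :=
  X p (to_cinf (fun q => eta q (Y q))) - Y p (to_cinf (fun q => eta q (X q)))
  - eta p (lie X Y p).

Definition is_covariant_derivative (D : vfield M -> vfield M -> vfield M) :
    Prop :=
  [/\ forall (f : cinf M) X X' Y, D (f *: X + X') Y = f *: D X Y + D X' Y,
      forall X Y Y', D X (Y + Y') = D X Y + D X Y' &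
      forall (f : cinf M) X Y, D X (f *: Y) = vapp X f *: Y + f *: D X Y].

Definition is_levi_civita (g : forall p : M, tangent p -> tangent p -> R)
    (D : vfield M -> vfield M -> vfield M) : Prop :=
  [/\ is_covariant_derivative D,
      forall X Y, D X Y - D Y X = lie X Y &
      forall (X Y Z : vfield M) (p : M),
        X p (to_cinf (fun q => g q (Y q) (Z q))) =
        g p (D X Y p) (Z p) + g p (Y p) (D X Z p)].

(* vanishing Lie derivative of g *)
Definition is_killing (g : forall p : M, tangent p -> tangent p -> R)
    (xi : vfield M) : Prop :=
  forall (X Y : vfield M) (p : M),
    xi p (to_cinf (fun q => g q (X q) (Y q))) =
    g p (lie xi X p) (Y p) + g p (X p) (lie xi Y p).

Definition is_parallel (D : vfield M -> vfield M -> vfield M) (V : vfield M) :=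
  forall X, D X V = 0.

Definition is_recurrent (D : vfield M -> vfield M -> vfield M) (V : vfield M) :
    Prop :=
  (forall p, V p <> 0) /\
  exists2 omega : forall p : M, tangent p -> R, is_form1 omega &
    forall (X : vfield M) (p : M), D X V p = omega p (X p) *: V p.

Definition is_lightlike (g : forall p : M, tangent p -> tangent p -> R)
    (V : vfield M) : Prop := forall p, g p (V p) (V p) = 0.

End tensor_fields.

Section circle_bundles.
Context {R : realType}.

Definition imag_unit : R[i] := (0 +i* 1)%C.

Definition on_circle (z : R[i]) : Prop := `|z| = 1.

Definition cis (t : R) : R[i] := (cos t +i* sin t)%C.

(* Smoothness on V x S^1 of a function on M x S^1, read in charts of M and    *)
(* through the local diffeomorphism t |-> cis t from R to S^1.                *)
Definition smooth_fun_on_circle n (M : manifold R n) (V : set M)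
    (h : M -> R[i] -> R) : Prop := forall c, @atlas R n M c ->
  smooth_on [set y : 'rV[R]_(n + 1) | (cmap c @` (cdom c `&` V)) (lsubmx y)]
    (fun y => h (cinv c (lsubmx y)) (cis (rsubmx y 0 0))).

(* Principal S^1-bundle with right action p.z = pb_act p z; pb_act matters    *)
(* only for z on the unit circle. pb_act_smooth1 follows from pb_act_smooth   *)
(* and is recorded so that the right translations are smooth_maps.            *)
Record principal_circle_bundle n (P : manifold R n.+1) (B : manifold R n) :=
  PrincipalCircleBundle {
  pb_proj : smooth_map P B ;
  pb_act : P -> R[i] -> P ;
  pb_act1 : forall p, pb_act p 1 = p ;
  pb_actM : forall p z w, on_circle z -> on_circle w ->
    pb_act p (z * w) = pb_act (pb_act p z) w ;
  pb_act_smooth : forall f : cinf P,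
    smooth_fun_on_circle setT (fun p z => f (pb_act p z)) ;
  pb_act_smooth1 : forall z, on_circle z ->
    forall f : cinf P, f \o pb_act^~ z \in smooth_pred P ;
  (* (pb_proj, psi) is an equivariant diffeomorphism from the preimage of U   *)
  (* to U x S^1, with inverse Phi                                             *)
  pb_trivial : forall b : B, exists U : set B, [/\ open U, U b &
    exists (Phi : B -> R[i] -> P) (psi : P -> R[i]),
    [/\ forall x z, U x -> on_circle z ->
          pb_proj (Phi x z) = x /\ psi (Phi x z) = z,
        forall p, U (pb_proj p) ->
          on_circle (psi p) /\ Phi (pb_proj p) (psi p) = p,
        forall x z w, U x -> on_circle z -> on_circle w ->
          Phi x (z * w) = pb_act (Phi x z) w,
        forall f : cinf P, smooth_fun_on_circle U (fun x z => f (Phi x z)) &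
        smooth_fun_on (pb_proj @^-1` U) (fun p => complex.Re (psi p)) /\
        smooth_fun_on (pb_proj @^-1` U) (fun p => complex.Im (psi p))]] }.

Context {n : nat} {P : manifold R n.+1} {B : manifold R n}.
Variable pb : principal_circle_bundle P B.
Implicit Types (A : forall p : P, tangent p -> R[i]).

Definition dproj (p : P) (u : tangent p) : tangent (pb_proj pb p) :=
  differential (pb_proj pb) u.

Definition right_translation (z : R[i]) (hz : on_circle z) : smooth_map P P :=
  SmoothMap (pb_act_smooth1 pb hz).

(* u is the value at p of the fundamental vector field of the element i of    *)
(* the Lie algebra iR                                                         *)
Definition is_fundamental_vector (p : P) (u : tangent p) : Prop :=
  forall f : cinf P,
    is_derive (0 : R) (1 : R) (fun t : R => f (pb_act pb p (cis t))) (u f).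

Definition is_connection_form A : Prop :=
  [/\ is_iform1 A,
      forall p (u : tangent p), is_fundamental_vector u -> A p u = imag_unit &
      forall z (hz : on_circle z) p (u : tangent p),
        A (right_translation hz p) (differential (right_translation hz) u)
        = A p u].

Definition is_unit_vertical A (v : vfield P) : Prop :=
  forall p, dproj (v p) = 0 /\ A p (v p) = imag_unit.

Definition is_horizontal_lift A (X : vfield B) (Xs : vfield P) : Prop :=
  forall p, A p (Xs p) = 0 /\ dproj (Xs p) = X (pb_proj pb p).

Definition is_curvature_form A
    (Om : forall b : B, tangent b -> tangent b -> R[i]) : Prop :=
  is_iform2 Om /\
  forall (X Y : vfield B) (Xs Ys : vfield P),
    is_horizontal_lift A X Xs -> is_horizontal_lift A Y Ys ->
    forall p, Om (pb_proj pb p) (X (pb_proj pb p)) (Y (pb_proj pb p)) =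
              - A p (lie Xs Ys p).

Definition is_flat A : Prop := is_curvature_form A (fun _ _ _ => 0).

(* the product of two values of A is real *)
Definition kaluza_klein (sigma : R)
    (g : forall b : B, tangent b -> tangent b -> R) A
    (p : P) (u w : tangent p) : R :=
  g (pb_proj pb p) (dproj u) (dproj w) + sigma * complex.Re (A p u * A p w).

End circle_bundles.

(* Main.v *)
(** Write [A = i a], let [v] be the fundamental field and put
    [W = xi* + eps v] with [eps] locally constant of square 1. Since horizontal
    lifts commute with [v], Koszul's formula for the Kaluza-Klein metric [G]
    gives, with [eta = g(xi, .)] and [L] the Lie derivative,
      2 G(D_(Y* ) W, Z* ) = d eta(Y, Z) + (L_xi g)(Y, Z) + sigma eps a([Y*, Z*]),
      2 G(D_(Y* ) W, v) = - sigma a([Y*, xi*]),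
      2 G(D_v W, Z* ) = sigma a([xi*, Z*]),   2 G(D_v W, v) = 0.
    In (i), light-likeness forces [h = eps f], so recurrence makes every
    [D_X W] a multiple of [W]. As [G(W, v) = - sigma eps] does not vanish, the
    last identity gives [D_v W = 0], the third then [a([xi*, Z*]) = 0], and the
    second [D W = 0]; the symmetric part of the first is the Killing equation and
    its antisymmetric part the curvature formula. Adding [i e pi^* eta] to a
    connection form changes [a([X*, Y*])] by [- e d eta(X, Y)]: this yields the
    flatness of [A_0] in (i) and the curvature of [A] in (ii), where the four
    right-hand sides vanish.

    Tangent vectors are derivations of the global smooth functions, so the chain
    rule has to come from Hadamard's lemma. With it, the total space is locally a
    smooth retract of R^n x R^2 (base coordinates, cosine and sine of the fibre
    angle), which describes its tangent vectors and provides horizontal lifts. *)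

Require Import Defs.
From HB Require Import structures.
From mathcomp Require Import all_boot all_order all_algebra.
From mathcomp Require Import all_classical all_reals all_analysis.
From mathcomp Require Import complex ring lra.

Set Implicit Arguments.
Unset Strict Implicit.
Unset Printing Implicit Defensive.
Import Order.TTheory GRing.Theory Num.Theory.
Import numFieldNormedType.Exports.
Local Open Scope classical_set_scope.
Local Open Scope ring_scope.

(** * Functions of class C^k on R^n *)

(** The fibre angle is only a local function, whereas tangent vectors act on global ones. Its sine
    and cosine, multiplied by a cutoff pulled back from the base, are global, and the circle action
    rotates them linearly on all of [P]. This is why two coordinates are spent on one dimension:
    where the cosine is positive, the angle is recovered from them as an arctangent. The
    coefficients in Hadamard's lemma are integrals over a segment. Their smoothness requires
    differentiation under the integral sign with an integrable bound, so the function is first cut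
    off: bounded support makes all its derivatives bounded on the whole space. The sign [eps] is a
    function on [P], constant only locally since [P] may be disconnected. The twisting and Koszul
    computations are therefore carried out for functions annihilated by all tangent vectors, which
    also covers the constant sign of the converse. *)

Lemma near_forall_ord (T : topologicalType) (x : T) m (P : 'I_m -> T -> Prop) :
  (forall j, \forall y \near x, P j y) -> \forall y \near x, forall j, P j y.
Proof. exact: (@filter_forall _ _ P (nbhs x)). Qed.

Section Ck_theory.
Context {R : realType} {n : nat}.
Implicit Types (U V : set 'rV[R]_n) (f g : 'rV[R]_n -> R).

Lemma Ck_sub k U V f : V `<=` U -> Ck k U f -> Ck k V f.
Proof.
move=> VU; elim: k f => [|k IH] f [fc fd]; first by split=> // x /VU; exact: fc.
split=> [x /VU|i]; first exact: fc.
by have [df Df] := fd i; split=> [x /VU|]; [exact: df|exact: IH].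
Qed.

(** [Ck] asks for continuity and partial derivatives of the ambient function at each point of the
    set. It is thus a pointwise condition, and [V] may be any set containing the point. *)
Lemma Ck_local k U f :
  (forall x, U x -> exists2 V, V x & Ck k V f) -> Ck k U f.
Proof.
elim: k f => [|k IH] f UV.
  by split=> // x /UV[V Vx [fc _]]; exact: fc.
split=> [x /UV[V Vx [fc _]]|i]; first exact: fc.
split=> [x /UV[V Vx [_ /(_ i)[df _]]]|]; first exact: df.
by apply: IH => x /UV[V Vx [_ /(_ i)[_ ?]]]; exists V.
Qed.

Lemma Ck_sum k U (I : Type) (r : seq I) (F : I -> 'rV[R]_n -> R) : open U ->
  (forall i, Ck k U (F i)) -> Ck k U (fun x => \sum_(i <- r) F i x).
Proof.
move=> oU CF; elim: r => [|i r IH].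
  by apply: (Ck_eq oU _ (Ck_cst k U (0 : R))) => x _; rewrite big_nil.
apply: (Ck_eq oU _ (Ck_D oU (CF i) IH)) => x _ /=.
by rewrite big_cons.
Qed.

Lemma Ck_coord k U (j : 'I_n) : Ck k U (fun x : 'rV[R]_n => x 0 j).
Proof.
have cj (x : 'rV[R]_n) : {for x, continuous (fun x : 'rV[R]_n => x 0 j)}.
  exact: coord_continuous.
have dj v (x : 'rV[R]_n) : is_derive x v (fun x : 'rV[R]_n => x 0 j) (v 0 j).
  split; first exact: diff_derivable (differentiable_coord x 0 j).
  apply/cvg_lim => //; apply: (@cvg_near_cst _ _ (v 0 j : R)).
  near=> h; rewrite /= !mxE addrK /GRing.scale /= mulKf //.
  by near: h; exact: nbhs_dnbhs_neq.
case: k => [|k]; split=> // i; split.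
  by move=> x _; exact: ex_derive.
have -> : 'D_(delta_mx 0 i) (fun x : 'rV[R]_n => x 0 j) =
   fun=> (delta_mx 0 i : 'rV[R]_n) 0 j.
  by apply/funext => x; exact: derive_val.
exact: Ck_cst.
Unshelve. all: by end_near.
Qed.

Lemma Ck_V k U f : open U -> (forall x, U x -> f x != 0) -> Ck k U f ->
  Ck k U (fun x => (f x)^-1).
Proof.
move=> oU f0; elim: k => [|k IH] Cf.
  by split=> // x Ux; apply: continuousV; [exact: f0|case: Cf => /(_ x Ux)].
have IH' := IH (Ck_S Cf).
split=> [x Ux|i].
  by apply: continuousV; [exact: f0|case: Cf => /(_ x Ux)].
have [df Df] := (proj2 Cf) i; split=> [x Ux|].
  by apply: derivableV; [exact: f0|exact: df].
apply: (Ck_eq oU _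
  (Ck_M oU (Ck_cst k U (-1)) (Ck_M oU (Ck_M oU IH' IH') Df))) => x Ux /=.
rewrite deriveV; [|exact: f0|exact: df].
by rewrite /GRing.scale /= -exprVn expr2 mulN1r mulNr.
Qed.

End Ck_theory.

(** * Directional derivatives along lines and the mean value inequality *)

Section lines.
Context {R : realType} {n : nat}.
Implicit Types (f : 'rV[R]_n -> R) (x v : 'rV[R]_n).

(** Both difference quotients are the same function of the increment. This transports one-variable
    results (mean value theorem, composition, differentiation under the integral) to directional
    derivatives. *)
Lemma is_derive_line (W : normedModType R) (f : 'rV[R]_n -> W) x v (s : R) (d : W) :
  is_derive (x + s *: v) v f d <-> is_derive s 1 (fun r => f (x + r *: v)) d.
Proof.
have E : (fun h : R => h^-1 *: ((f \o shift (x + s *: v)) (h *: v) - f (x + s *: v)))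
  = (fun h : R => h^-1 *: (((fun r => f (x + r *: v)) \o shift s) (h *: 1)
     - (fun r => f (x + r *: v)) s)).
  apply/funext => h /=; congr (_ *: (f _ - _)).
  rewrite (_ : h *: 1 = h :> R); last exact: mulr1.
  by rewrite [LHS]addrC scalerDl addrA addrAC.
by split=> -[d1 d2]; split; move: d1 d2; rewrite /derivable /derive E.
Qed.

Lemma is_derive_line_scale f x v (s t : R) :
  derivable f (x + (s * t) *: v) v ->
  is_derive s 1 (fun s => f (x + (s * t) *: v)) (t * 'D_v f (x + (s * t) *: v)).
Proof.
move=> /derivableP/is_derive_line H.
have Ht : is_derive s 1 (fun s : R => s * t) t.
  rewrite (_ : (fun s : R => s * t) = t \*: id); last first.
    by apply/funext => r /=; rewrite mulrC.
  by apply: is_derive_eq; rewrite [LHS]mulr1.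
rewrite mulrC.
exact: (@is_derive1_comp _ (fun r => f (x + r *: v)) (fun s => s * t)).
Qed.

Lemma mean_value_line f x v (t d e : R) :
  (forall s : R, `|s| <= `|t| -> derivable f (x + s *: v) v) ->
  (forall s : R, `|s| <= `|t| -> `|'D_v f (x + s *: v) - d| <= e) ->
  `|f (x + t *: v) - f x - t * d| <= `|t| * e.
Proof.
move=> df De.
(* Reparametrised over [0, 1], so that the mean value theorem applies whatever the sign of [t]. *)
pose phi (s : R) := f (x + (s * t) *: v).
have le_st (s : R) : 0 <= s <= 1 -> `|s * t| <= `|t|.
  by move=> /andP[s0 s1]; rewrite normrM ger0_norm // ler_piMl.
have dphi (s : R) : 0 <= s <= 1 ->
    is_derive s 1 phi (t * 'D_v f (x + (s * t) *: v)).
  by move=> s01; apply: is_derive_line_scale; exact: df (le_st s s01).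
have cphi : {within `[0, 1], continuous phi}.
  apply: derivable_within_continuous => s /[!in_itv] /= /dphi[].
  by [].
have [|s] := @MVT R phi (fun s => t * 'D_v f (x + (s * t) *: v)) 0 1 ltr01 _ cphi.
  by move=> s /[!in_itv] /andP[s0 s1]; apply: dphi; rewrite !ltW.
rewrite in_itv /= => /andP[s0 s1].
rewrite /phi mul0r scale0r addr0 mul1r subr0 mulr1 => ->.
rewrite -mulrBr normrM ler_wpM2l //; apply: De; apply: le_st.
by rewrite !ltW.
Qed.

End lines.

Section telescope.
Context {R : realType} {n : nat}.
Implicit Types (f : 'rV[R]_n -> R) (x h : 'rV[R]_n).

Lemma norm_coord_le x (j : 'I_n) : `|x 0 j| <= `|x|.
Proof.
rewrite [leRHS]/Num.Def.normr /= mx_normrE.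
exact: (le_bigmax _ (fun i : 'I_1 * 'I_n => `|x i.1 i.2|) (0, j)).
Qed.

Lemma norm_row_le x (e : R) : 0 <= e -> (forall j, `|x 0 j| <= e) -> `|x| <= e.
Proof.
move=> e0 xe; rewrite [leLHS]/Num.Def.normr /= mx_normrE.
by apply: bigmax_le => // -[i j] _; rewrite ord1; exact: xe.
Qed.

(* Walk from x to x + h along the coordinate axes, one coordinate at a time.  *)
Lemma telescope_partials f x h (d : 'I_n -> R) (e : R) : 0 <= e ->
  (forall y, `|y| <= `|h| -> forall j, derivable f (x + y) (delta_mx 0 j)) ->
  (forall y, `|y| <= `|h| -> forall j,
     `|'D_(delta_mx 0 j) f (x + y) - d j| <= e) ->
  `|f (x + h) - f x - \sum_j h 0 j * d j| <= n%:R * e * `|h|.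
Proof.
move=> e0 df De.
pose part k : 'rV[R]_n := \row_j if (j < k)%N then h 0 j else 0.
have part0 : part 0%N = 0 by apply/rowP => j; rewrite !mxE.
have partn : part n = h by apply/rowP => j; rewrite !mxE ltn_ord.
have partS (k : 'I_n) : part k.+1 = part k + h 0 k *: delta_mx 0 k.
  apply/rowP => j; rewrite !mxE eqxx /= ltnS leq_eqVlt -val_eqE /=.
  by case: ltngtP => [jk|kj|/ord_inj ->]; rewrite ?mulr0 ?addr0 ?mulr1 ?add0r.
(* In the sup norm the whole walk stays in the ball of radius [|h|], where the bounds are
   available. *)
have le_part (k : 'I_n) (s : R) : `|s| <= `|h 0 k| ->
    `|part k + s *: delta_mx 0 k| <= `|h|.
  move=> sh; apply: norm_row_le => // j; rewrite !mxE eqxx /= -val_eqE /=.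
  case: ltngtP => [jk|kj|_].
  - by rewrite mulr0 addr0; exact: norm_coord_le.
  - by rewrite mulr0 addr0 normr0.
  - by rewrite add0r mulr1; apply: le_trans sh (norm_coord_le _ _).
have step (k : 'I_n) :
    `|f (x + part k.+1) - f (x + part k) - h 0 k * d k| <= `|h| * e.
  rewrite partS addrA.
  apply: (@le_trans _ _ (`|h 0 k| * e)); last first.
    by rewrite ler_wpM2r // norm_coord_le.
  apply: mean_value_line => s sh; rewrite -addrA; [apply: df|apply: De];
  exact: le_part.
have -> : f (x + h) - f x = \sum_(k < n) (f (x + part k.+1) - f (x + part k)).
  rewrite -(big_mkord xpredT (fun k => f (x + part k.+1) - f (x + part k))).
  by rewrite (telescope_sumr (fun k => f (x + part k))) // partn part0 addr0.
rewrite -sumrB; apply: le_trans (ler_norm_sum _ _ _) _.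
apply: le_trans (ler_sum _ (fun k _ => step k)) _.
by rewrite sumr_const card_ord -[leLHS]mulr_natl mulrA [leRHS]mulrAC.
Qed.

Lemma C1_differentiable f (U : set 'rV[R]_n) x :
  open U -> U x -> Ck 1 U f -> differentiable f x.
Proof.
move=> oU Ux [_ fd].
pose L (h : 'rV[R]_n) : R := \sum_j h 0 j * 'D_(delta_mx 0 j) f x.
have Llin : linear L.
  move=> a u w; rewrite /L scaler_sumr -big_split; apply: eq_bigr => j _ /=.
  by rewrite !mxE mulrDl [_ *: _]mulrA.
pose LL : {linear 'rV[R]_n -> R^o} := HB.pack L (GRing.isLinear.Build _ _ _ _ _ Llin).
have Lc : continuous LL.
  have : Ck 0 setT L.
    apply: Ck_sum => [|j]; first exact: openT.
    exact: (Ck_M openT (Ck_coord _ _ j) (Ck_cst _ _ _)).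
  by case=> H _ y; exact: H.
have Lo : (f : 'rV[R]_n -> R^o) \o shift x = cst (f x : R^o) + LL +o_ (nbhs (0 : 'rV[R]_n)) id.
  apply/eqaddoP => _/posnumP[e].
  (* The telescoping error is n e' |h|; dividing by [n.+1] instead of [n] includes dimension 0. *)
  pose e' := e%:num / n.+1%:R.
  have e'0 : 0 < e' by rewrite divr_gt0 // ltr0Sn.
  have : \forall y \near x, U y /\ forall j,
      `|'D_(delta_mx 0 j) f y - 'D_(delta_mx 0 j) f x| <= e'.
    have Dx : \forall y \near x, forall j,
        `|'D_(delta_mx 0 j) f y - 'D_(delta_mx 0 j) f x| <= e'.
      apply: near_forall_ord => j.
      have [_ [Dc _]] := fd j; have /cvgrPdist_le/(_ _ e'0) := Dc x Ux.
      by apply: filterS => y; rewrite distrC.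
    have Ux' : \forall y \near x, U y by exact: open_nbhs_nbhs.
    by near=> y; split; near: y.
  move=> /nbhs_normP[r /= r0 rP].
  have xr y : `|y| < r -> ball_ Num.Def.normr x r (x + y).
    by rewrite /ball_ /= opprD addrA subrr add0r normrN.
  have h0r : \forall h \near (0 : 'rV[R]_n), `|h| < r by exact: nbhs0_lt.
  apply: filterS h0r => h hr.
  apply: (@le_trans _ _ `|f (x + h) - f x - L h|).
    by rewrite -addrA -opprD [x + h]addrC.
  have := @telescope_partials f x h (fun j => 'D_(delta_mx 0 j) f x) e' (ltW e'0).
  move=> /(_ _ _)/le_trans; apply.
  - by move=> y yh j; have [+ _] := fd j; apply; exact: (proj1 (rP _ (xr _ (le_lt_trans yh hr)))).
  - by move=> y yh j; exact: (proj2 (rP _ (xr _ (le_lt_trans yh hr)))).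
  rewrite ler_wpM2r // /e' mulrCA ler_piMr // ler_pdivrMr ?ltr0Sn // mul1r.
  by rewrite ler_nat.
have dE := diff_unique Lc Lo.
by apply/diff_locallyP; rewrite dE.
Unshelve. all: by end_near.
Qed.

End telescope.

(** * The chain rule in several variables and composition of C^k maps *)

Section chain_rule.
Context {R : realType} {n m : nat}.

Lemma derive_partials (f : 'rV[R]_m -> R) x v : differentiable f x ->
  'D_v f x = \sum_j v 0 j * 'D_(delta_mx 0 j) f x.
Proof.
move=> df; rewrite deriveE // [in LHS](row_sum_delta v) linear_sum.
by apply: eq_bigr => j _; rewrite linearZ /= -[in LHS]deriveE.
Qed.

Lemma is_derive_comp_rV (f : 'rV[R]_m -> R) (F : 'rV[R]_n -> 'rV[R]_m) x v :
  differentiable f (F x) -> (forall j, derivable (fun y => F y 0 j) x v) ->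
  is_derive x v (f \o F)
    (\sum_j 'D_v (fun y => F y 0 j) x * 'D_(delta_mx 0 j) f (F x)).
Proof.
move=> df dF.
have dFx : derivable F x v by apply/derivable_mxP => i j; rewrite ord1.
pose g (s : R) := F (x + s *: v).
have g0 : g 0 = F x by rewrite /g scale0r addr0.
have dg : is_derive (0 : R) (1 : R) g ('D_v F x).
  by apply/is_derive_line; rewrite scale0r addr0; exact: derivableP.
have dg' : differentiable g 0 by apply/derivable1_diffP; case: dg.
have dfg : differentiable f (g 0) by rewrite g0.
suff : is_derive (0 : R) (1 : R) (fun s : R => (f \o F) (x + s *: v))
    (\sum_j 'D_v (fun y => F y 0 j) x * 'D_(delta_mx 0 j) f (F x)).
  by move=> /is_derive_line; rewrite scale0r addr0.
have dfgc : differentiable (f \o g) 0 by exact: differentiable_comp.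
split; first exact/derivable1_diffP.
rewrite -[(fun s : R => _)]/(f \o g) deriveE // diff_comp //=.
rewrite -(deriveE _ dg') (@derive_val _ _ _ _ _ _ _ dg).
rewrite g0 -deriveE // derive_partials //; apply: eq_bigr => j _.
by rewrite derive_mx // mxE.
Qed.

(** Induction on [k]: a partial derivative of f o F is a sum of products of a partial derivative of
    a coordinate of [F] with some (D_j f) o F, to which the induction hypothesis applies. The chain
    rule used at each stage needs [f] differentiable, which C^1 provides. *)
Lemma Ck_comp k (U : set 'rV[R]_n) (V : set 'rV[R]_m) (f : 'rV[R]_m -> R)
    (F : 'rV[R]_n -> 'rV[R]_m) : open U -> open V ->
  (forall x, U x -> V (F x)) -> (forall j, Ck k U (fun x => F x 0 j)) ->
  Ck k V f -> Ck k U (f \o F).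
Proof.
move=> oU oV UV.
have cF k' : (forall j, Ck k' U (fun x => F x 0 j)) -> forall x, U x -> {for x, continuous F}.
  move=> CF x Ux; apply/(@cvgrPdist_le R 'rV[R]_m _ (nbhs x) _ F (F x)) => e e0.
  have H : \forall y \near x, forall j : 'I_m, `|F x 0 j - F y 0 j| <= e.
    apply: near_forall_ord => j.
    have Fj : F y 0 j @[y --> x] --> F x 0 j by case: k' CF => [|k'] /(_ j)[H _]; exact: H.
    by have /cvgrPdist_le/(_ _ e0) := Fj.
  apply: filterS H => y Hy; apply: norm_row_le; first exact: ltW.
  by move=> j; rewrite !mxE.
elim: k f => [|k IH] f CF Cf.
  split=> // x Ux; apply: continuous_comp; first exact: (cF 0%N).
  by case: Cf => H _; apply/H/UV.
have CF' j := Ck_S (CF j).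
split=> [x Ux|i].
  by apply: continuous_comp; [exact: (cF k)|case: Cf => H _; apply/H/UV].
have dfF x : U x -> is_derive x (delta_mx 0 i) (f \o F)
    (\sum_j 'D_(delta_mx 0 i) (fun y => F y 0 j) x * 'D_(delta_mx 0 j) f (F x)).
  move=> Ux; apply: is_derive_comp_rV; last first.
    by move=> j; have [_ /(_ i)[H _]] := CF j; exact: H.
  apply: (C1_differentiable oV); first exact: UV.
  by case: Cf => Hc Hd; split=> // j; have [? Hk] := Hd j; split=> //; case: (k) Hk => [|?] [].
split=> [x Ux|]; first by have [] := dfF x Ux.
apply: (@Ck_eq _ _ k U (fun x => \sum_j 'D_(delta_mx 0 i) (fun y => F y 0 j) x *
   'D_(delta_mx 0 j) f (F x))) => //.
  by move=> x /dfF[_ ->].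
apply: Ck_sum => // j; apply: Ck_M => //.
  by have [_ /(_ i)[]] := CF j.
by apply: (IH ('D_(delta_mx 0 j) f)) => //; have [_ /(_ j)[]] := Cf.
Qed.

End chain_rule.

(** * Hadamard's lemma *)

Section hadamard.
Context {R : realType} {n : nat}.
Implicit Types (f : 'rV[R]_n -> R) (x : 'rV[R]_n).

(** Smooth with support in a ball: a class stable under partial derivatives, in which every function
    is bounded and Lipschitz on the whole space. *)
Definition csmooth (r : R) f := smooth_on setT f /\ forall x, r < `|x| -> f x = 0.

Lemma csmooth_derive r f i : csmooth r f -> csmooth r ('D_(delta_mx 0 i) f).
Proof.
move=> [sf f0]; split=> [k|x rx]; first by have [_ /(_ i)[]] := sf k.+1.
have nx : \forall y \near x, f y = cst 0 y.
  have : open_nbhs x [set y : 'rV[R]_n | r < `|y|].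
    split=> //; apply: (@open_comp _ _ (fun y : 'rV[R]_n => `|y|) [set z | r < z]).
      by move=> y _; exact: norm_continuous.
    exact: open_gt.
  by move=> /open_nbhs_nbhs; apply: filterS => y; exact: f0.
rewrite (near_eq_derive _ nx); exact: derive_cst.
Qed.

Lemma csmooth_bounded r f : csmooth r f ->
  exists2 C, 0 <= C & forall x, `|f x| <= C.
Proof.
(* [r] may be negative; the maximum keeps the compact set nonempty. *)
move=> [sf f0]; pose A := [set x : 'rV[R]_n | `|x| <= Num.max r 0].
have A0 : A 0 by rewrite /A /= normr0 le_max lexx orbT.
have cA : compact A.
  apply: bounded_closed_compact.
    exists (Num.max r 0); split; first exact: num_real.
    by move=> z rz x /le_trans; apply; exact: ltW.
  apply: (@closed_comp _ _ (fun y : 'rV[R]_n => `|y|) [set z | z <= Num.max r 0]).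
    by move=> y _; exact: norm_continuous.
  exact: closed_le.
have cf : continuous f by move=> x; have [H _] := sf 0%N; exact: H.
have cnf : {within A, continuous (fun x => `|f x|)}.
  apply: continuous_subspaceT => x.
  by apply: continuous_comp; [exact: cf|exact: norm_continuous].
have [c _ fc] := EVT_max_rV (ex_intro _ 0 A0) cA cnf.
exists `|f c| => // x; have [xr|rx] := leP `|x| (Num.max r 0).
  by apply: fc; rewrite inE.
rewrite f0 ?normr0 //; apply: le_lt_trans rx; by rewrite le_max lexx.
Qed.

Lemma csmooth_lipschitz r f : csmooth r f ->
  exists2 C, 0 <= C & forall x y, `|f y - f x| <= C * `|y - x|.
Proof.
move=> sf.
have /choice[C HC] : forall i : 'I_n, exists C,
    0 <= C /\ forall x, `|'D_(delta_mx 0 i) f x| <= C.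
  by move=> i; have [C ? ?] := csmooth_bounded (csmooth_derive i sf); exists C.
pose M := \sum_i C i.
have M0 : 0 <= M by apply: sumr_ge0 => i _; case: (HC i).
have CM i : C i <= M.
  by rewrite /M (bigD1 i) //= lerDl; apply: sumr_ge0 => j _; case: (HC j).
exists (n%:R * M) => [|x y]; first by rewrite mulr_ge0.
have := @telescope_partials R n f x (y - x) (fun=> 0) M M0.
rewrite [x + _]addrC subrK.
rewrite big1 => [|j _]; last by rewrite mulr0.
rewrite subr0; apply.
- by move=> z _ j; have [/(_ 1%N) [_ /(_ j)[H _]] _] := sf; exact: H.
- move=> z _ j; rewrite subr0; apply: le_trans (CM j); by case: (HC j).
Qed.

(* The weights s^k make this family stable under differentiation: the i-th      *)
(* partial derivative of radial_int k f is radial_int k.+1 ('D_i f).           *)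
Definition radial_int (k : nat) f x : R :=
  (\int[lebesgue_measure]_(s in `[0, 1]) (s ^+ k * f (s *: x)))%R.

Lemma measurable01 : measurable (`[0, 1] : set (measurableTypeR R)).
Proof. exact: measurable_itv. Qed.

Lemma integrable01 (h : R -> R) : continuous h ->
  (@lebesgue_measure R).-integrable `[0, 1] (EFin \o h).
Proof.
move=> ch; apply: continuous_compact_integrable; first exact: segment_compact.
exact: continuous_subspaceT.
Qed.

Lemma continuous_radial k f x : continuous f ->
  continuous (fun s : R => s ^+ k * f (s *: x)).
Proof.
move=> cf s; apply: cvgM; first exact: exprn_continuous.
apply: (@continuous_comp _ _ _ (fun s : R => s *: x) f); last exact: cf.
exact: scalel_continuous.
Qed.

(** The Lipschitz constant of [f] serves again, because the weight and the contraction by [s] are at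
    most 1 on [0, 1]. This is the source of continuity for the integrals. *)
Lemma radial_int_lipschitz r k f : csmooth r f ->
  exists2 C, 0 <= C & forall x y, `|radial_int k f y - radial_int k f x| <= C * `|y - x|.
Proof.
move=> sf; have [C C0 fC] := csmooth_lipschitz sf; exists C => // x y.
have cf : continuous f by move=> z; have [/(_ 0%N)[H _] _] := sf; exact: H.
rewrite /radial_int -RintegralB; [|exact: measurable01|
  exact/integrable01/continuous_radial|exact/integrable01/continuous_radial].
have cB : continuous (fun s : R => s ^+ k * f (s *: y) - s ^+ k * f (s *: x)).
  by move=> s; apply: cvgB; exact: continuous_radial.
apply: le_trans (le_normr_Rintegral measurable01 (integrable01 cB)) _.
have -> : C * `|y - x| =
    (\int[lebesgue_measure]_(s in `[(0 : R), 1]) (C * `|y - x|))%R.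
  rewrite (Rintegral_cst _ measurable01).
  rewrite (_ : fine _ = 1) ?mulr1 //.
  have := @lebesgue_measure_itv R `[0, 1]. 
  by rewrite /= lte_fin ltr01 /= sube0 => ->.
apply: le_Rintegral; first exact: measurable01.
- apply: integrable01 => s.
  by apply: cvg_norm; exact: cB.
- by apply: integrable01 => s; exact: cvg_cst.
- move=> s; rewrite /= in_itv /= => /andP[s0 s1].
  rewrite -mulrBr normrM ger0_norm ?exprn_ge0 //.
  apply: (@le_trans _ _ `|f (s *: y) - f (s *: x)|).
    by rewrite ler_piMl // exprn_ile1.
  apply: le_trans (fC _ _) _; rewrite ler_wpM2l // -scalerBr normrZ ger0_norm //.
  by rewrite ler_piMl.
Qed.

Lemma is_derive_radial_int r k f x i : csmooth r f ->
  is_derive x (delta_mx 0 i) (radial_int k f)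
    (radial_int k.+1 ('D_(delta_mx 0 i) f) x).
Proof.
move=> sf; set v := delta_mx 0 i.
have [C C0 fC] := csmooth_bounded (csmooth_derive i sf).
have cf : continuous f by move=> z; have [/(_ 0%N)[H _] _] := sf; exact: H.
have df y w : derivable f y w.
  apply/diff_derivable/(C1_differentiable openT) => //.
  by have [H _] := sf; exact: (H 1%N).
pose phi (a s : R) := s ^+ k * f (s *: (x + a *: v)).
have dphi (a s : R) : is_derive a (1 : R) (phi ^~ s) (s ^+ k.+1 * 'D_v f (s *: (x + a *: v))).
  have E : phi ^~ s = s ^+ k \*: (fun a => f (s *: x + (a * s) *: v)).
    by apply/funext => b; rewrite /phi scalerDr scalerA [s * b]mulrC.
  have := @is_derive_line_scale R n f (s *: x) v a s (df _ _) => H.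
  rewrite E; apply: is_derive_eq.
  by rewrite scalerDr scalerA [s * a]mulrC exprSr -mulrA.
(* Any interval around 0 would do for the parameter: the constant [C] dominates the derivative
   everywhere. *)
have I0 : `]-1, 1[%classic (0 : R) by rewrite /= in_itv /= ltrN10 ltr01.
have iphi (a : R) : `]-1, 1[%classic a ->
    (@lebesgue_measure R).-integrable `[0, 1] (EFin \o phi a).
  by move=> _; exact/integrable01/continuous_radial.
have d1phi (a s : R) : `]-1, 1[%classic a -> `[0, 1]%classic s ->
    derivable (phi ^~ s) a 1 by move=> _ _; have [] := dphi a s.
have C0' (s : R) : 0 <= cst C s by [].
have iC : (@lebesgue_measure R).-integrable `[0, 1] (EFin \o cst C).
  by apply: integrable01 => s; exact: cvg_cst.
have phiC (a s : R) : `]-1, 1[%classic a -> `[0, 1]%classic s ->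
    `|partial1of2 phi a s| <= cst C s.
  move=> _; rewrite /= in_itv /= => /andP[s0 s1].
  rewrite partial1of2E (@derive_val _ _ _ _ _ _ _ (dphi a s)) normrM.
  rewrite ger0_norm ?exprn_ge0 //; apply: le_trans (fC (s *: (x + a *: v))).
  by rewrite ler_piMl // exprn_ile1.
have dF := derivable_under_integral measurable01 I0 iphi d1phi C0' iC phiC.
have := differentiation_under_integral measurable01 I0 iphi d1phi C0' iC phiC.
rewrite derive1E => eF.
have : is_derive (0 : R) (1 : R) (fun a : R => radial_int k f (x + a *: v))
    (radial_int k.+1 ('D_v f) x).
  split; first exact: dF.
  rewrite [LHS]eF; apply: eq_Rintegral => s _.
  by rewrite partial1of2E (@derive_val _ _ _ _ _ _ _ (dphi 0 s)) scale0r addr0.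
by move=> /is_derive_line; rewrite scale0r addr0.
Qed.

Lemma Ck_radial_int m r k f : csmooth r f -> Ck m setT (radial_int k f).
Proof.
move=> sf; have cI k' f' x : csmooth r f' -> {for x, continuous (radial_int k' f')}.
  move=> {}sf; have [C C0 fC] := radial_int_lipschitz k' sf.
  apply/(@cvgrPdist_le R R^o _ (nbhs x) _ (radial_int k' f')) => e e0.
  have C1 : 0 < C + 1 by rewrite ltr_wpDl.
  near=> y; rewrite distrC; apply: le_trans (fC x y) _.
  apply: (@le_trans _ _ ((C + 1) * `|y - x|)).
    by rewrite ler_wpM2r // lerDl.
  rewrite -ler_pdivlMl // distrC mulrC.
  near: y; apply: cvgr_dist_le; first exact: cvg_id.
  by rewrite divr_gt0.
elim: m k f sf => [|m IH] k f sf; first by split=> // x _; exact: cI sf.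
split=> [x _|i]; first exact: cI sf.
 split=> [x _|]; first by have [] := is_derive_radial_int k x i sf.
have -> : 'D_(delta_mx 0 i) (radial_int k f) = radial_int k.+1 ('D_(delta_mx 0 i) f).
  by apply/funext => x; have [_] := is_derive_radial_int k x i sf.
exact/IH/csmooth_derive.
Unshelve. all: by end_near.
Qed.

(** The fundamental theorem of calculus on the segment from 0 to x gives f x - f 0 = sum_i x_i
    int_0^1 (D_i f)(s x) ds. The coefficients are these integrals, smooth as members of the family
    [radial_int]. *)
Lemma hadamard r f : csmooth r f -> exists G : 'I_n -> 'rV[R]_n -> R,
  [/\ forall i, smooth_on setT (G i),
      forall i, G i 0 = 'D_(delta_mx 0 i) f 0 &
      forall x, f x = f 0 + \sum_i x 0 i * G i x].
Proof.
move=> sf; exists (fun i => radial_int 0 ('D_(delta_mx 0 i) f)); split.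
- by move=> i k; apply: Ck_radial_int; exact: csmooth_derive sf.
- move=> i; rewrite /radial_int.
  under eq_Rintegral do rewrite scaler0 expr0 mul1r.
  rewrite (Rintegral_cst _ measurable01).
  rewrite (_ : fine _ = 1) ?mulr1 //.
  have := @lebesgue_measure_itv R `[0, 1].
  by rewrite /= lte_fin ltr01 /= sube0 => ->.
move=> x; apply/eqP; rewrite addrC -subr_eq; apply/eqP.
have df y : differentiable f y.
  by apply: (C1_differentiable openT) => //; have [H _] := sf; exact: (H 1%N).
have dfx y w : derivable f y w by exact: diff_derivable.
have cDf i : continuous ('D_(delta_mx 0 i) f).
  by move=> z; have [/(_ 0%N)[H _] _] := csmooth_derive i sf; exact: H.
pose F (s : R) := f (0 + (s * 1) *: x).
pose F' (s : R) := \sum_i x 0 i * 'D_(delta_mx 0 i) f (s *: x).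
have dF (s : R) : is_derive s 1 F (F' s).
  rewrite /F' -derive_partials //.
  have := @is_derive_line_scale R n f 0 x s 1 (dfx _ _).
  by rewrite mul1r add0r mulr1.
have cDx i : continuous (fun s : R => 'D_(delta_mx 0 i) f (s *: x)).
  move=> s; apply: (@continuous_comp _ _ _ (fun s : R => s *: x) ('D_(delta_mx 0 i) f)); last exact: cDf.
  exact: scalel_continuous.
have cF' : continuous F'.
  apply: continuous_big => [|i _ s]; first exact: add_continuous.
  by apply: cvgM; [exact: cvg_cst|exact: cDx].
have cF : continuous F.
  by move=> s; apply/differentiable_continuous/derivable1_diffP; have [] := dF s.
have FTC := @continuous_FTC2 R F' F 0 1 ltr01 (continuous_subspaceT cF').
have -> : f x - f 0 = (\int[lebesgue_measure]_(s in `[(0 : R), 1]) F' s)%R.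
  rewrite /Rintegral FTC.
  - by rewrite -EFinB /= /F !mul1r scale1r mul0r scale0r addr0 add0r.
  - split; [by move=> s _; have [] := dF s| |].
    + by apply: cvg_at_right_filter; exact: cF.
    + by apply: cvg_at_left_filter; exact: cF.
  - by move=> s _; rewrite derive1E; have [] := dF s.
rewrite /F' /radial_int.
under [RHS]eq_bigr => i _.
  under eq_Rintegral do rewrite expr0 mul1r.
  over.
have cxD i : continuous (fun s : R => x 0 i * 'D_(delta_mx 0 i) f (s *: x)).
  by move=> s; apply: cvgM; [exact: cvg_cst|exact: cDx].
(* The integral is exchanged with the finite sum by induction on the index list. *)
elim: (index_enum _) => [|i l IH].
  rewrite big_nil; under eq_Rintegral do rewrite big_nil.
  by rewrite (Rintegral_cst _ measurable01) mul0r.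
rewrite big_cons -IH -RintegralZl; [|exact: measurable01|exact/integrable01/cDx].
rewrite -RintegralD; [|exact: measurable01|exact/integrable01/cxD|].
  by under eq_Rintegral do rewrite big_cons.
apply: integrable01; apply: continuous_big => [|j _]; first exact: add_continuous.
exact: cxD.
Qed.

End hadamard.

(** * Cutoff functions *)

Section flat_function.
Context {R : realType}.

(* The powers of 1 / x make the family stable under differentiation.          *)
Definition flat (k : nat) (x : R) : R :=
  if 0 < x then x^-1 ^+ k * expR (- x^-1) else 0.

Lemma flat_gt0 k x : 0 < x -> 0 < flat k x.
Proof. by move=> x0; rewrite /flat x0 mulr_gt0 ?expR_gt0 // exprn_gt0 // invr_gt0. Qed.

Lemma flat_le0 k x : x <= 0 -> flat k x = 0.
Proof. by rewrite /flat leNgt => /negbTE ->. Qed.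

Lemma flat_ge0 k x : 0 <= flat k x.
Proof. by have [/flat_le0 -> //|/(flat_gt0 k)/ltW] := leP x 0. Qed.

(** With u = 1/x, the exponential series gives u^(k+2) <= (k+2)! e^u. The two spare powers of u
    become x^2, and this quadratic bound yields the zero derivative at the origin. *)
Lemma flat_bound k x : flat k x <= (k.+2)`!%:R * x ^+ 2.
Proof.
have [/flat_le0 ->|x0] := leP x 0; first by rewrite mulr_ge0 // sqr_ge0.
rewrite /flat x0 expRN.
have u0 : 0 <= x^-1 by rewrite invr_ge0 ltW.
have H : x^-1 ^+ k.+2 <= (k.+2)`!%:R * expR x^-1.
  rewrite -ler_pdivrMl ?ltr0n ?fact_gt0 // mulrC.
  by apply: le_trans (expR_ge1Dxn k.+1 u0); rewrite lerDr.
rewrite ler_pdivrMr ?expR_gt0 // mulrAC -ler_pdivrMr ?exprn_gt0 //.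
by rewrite -exprVn -exprD addn2.
Qed.

(** The derivative is a combination of later members of the family, so smoothness follows by
    induction. At 0 the difference quotient is at most (k+2)! |h| by the quadratic bound. *)
Lemma is_derive_flat k (x : R) :
  is_derive x (1 : R) (flat k) (flat k.+2 x - k%:R * flat k.+1 x).
Proof.
have [x0|x0|->] := ltgtP x 0.
- rewrite !flat_le0 ?ltW // mulr0 subr0.
  apply: (@near_eq_is_derive _ _ _ (cst 0)).
  near=> y; rewrite flat_le0 //; apply: ltW; near: y; exact: lt_nbhsl.
- pose g (y : R) := (y^-1 ^+ k) * expR (- y^-1).
  apply: (@near_eq_is_derive _ _ _ g).
    near=> y; rewrite /flat /g ifT //; near: y; exact: lt_nbhsr.
  have xn0 : x != 0 by rewrite gt_eqF.
  have dV : is_derive x (1 : R) (fun y : R => y^-1) (- x^-1 ^+ 2).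
    have d1 : derivable (id : R -> R) x 1 by exact: derivable_id.
    split; first exact: (@derivableV R R^o id x 1 xn0 d1).
    by rewrite (@deriveV R R^o id x 1 xn0 d1) derive_id exprVn [LHS]mulr1.
  have dE : is_derive x (1 : R) (fun y : R => expR (- y^-1)) (expR (- x^-1) * x^-1 ^+ 2).
    have dN : is_derive x (1 : R) (fun y : R => - y^-1) (x^-1 ^+ 2).
      by have := is_deriveN dV; rewrite opprK.
    exact: (@is_derive1_comp R expR (fun y => - y^-1) x _ _ (is_derive_expR _) dN).
  have dX : is_derive x (1 : R) (fun y : R => y^-1 ^+ k) (- (k%:R * x^-1 ^+ k.+1)).
    have := is_deriveX k dV; rewrite exprfctE => H; apply: is_derive_eq H _.
    case: k {g dE} => [|k]; first by rewrite !mul0r oppr0 scale0r.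
    by rewrite [LHS]mulrN -mulrA -exprD addn2.
  have := is_deriveM dX dE; rewrite /GRing.scale /= => H.
  apply: is_derive_eq H _; rewrite /flat x0 !exprS; ring.
- rewrite !(flat_le0 _ (lexx 0)) mulr0 subr0.
  pose C : R := (k.+2)`!%:R; have C0 : 0 < C by rewrite ltr0n fact_gt0.
  have H : h^-1 *: ((flat k \o shift 0) (h *: 1) - flat k 0) @[h --> (0 : R)^'] --> (0 : R).
    apply/cvgrPdist_le => e e0; near=> h.
    have h0 : h != 0 by near: h; exact: nbhs_dnbhs_neq.
    have he : `|h| <= e / C by near: h; apply: dnbhs0_le; rewrite divr_gt0.
    rewrite sub0r normrN /= addr0 [h *: 1]mulr1 (flat_le0 _ (lexx 0)) subr0.
    rewrite normrM normfV ger0_norm ?flat_ge0 // ler_pdivrMl ?normr_gt0 //.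
    apply: le_trans (flat_bound k h) _; rewrite -real_normK ?num_real // expr2.
    rewrite mulrCA ler_wpM2l // -ler_pdivlMl // mulrC //.
  by split; [apply/cvg_ex; exists 0; exact: H|exact/cvg_lim].
Unshelve. all: by end_near.
Qed.

End flat_function.

Section smooth_composition.
Context {R : realType} {n : nat}.
Implicit Types (f : 'rV[R]_n -> R) (U : set 'rV[R]_n).

Lemma is_derive_comp1 (phi : R -> R) (d : R) f x v : derivable f x v ->
  is_derive (f x) (1 : R) phi d -> is_derive x v (phi \o f) (d * 'D_v f x).
Proof.
move=> df dphi.
have : is_derive (0 : R) (1 : R) (fun s : R => f (x + s *: v)) ('D_v f x).
  by apply/is_derive_line; rewrite scale0r addr0; exact: derivableP.
have : is_derive (f (x + 0 *: v)) (1 : R) phi d by rewrite scale0r addr0.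
move=> H1 H2.
have := @is_derive1_comp R phi (fun s : R => f (x + s *: v)) 0 _ _ H1 H2.
move/(iffRL (is_derive_line (phi \o f) _ _ _ _)).
by rewrite scale0r addr0.
Qed.

(** The hypothesis on [dphi] covers two ways of closing the induction: for [flat] the derivative is
    a combination of other members of the family, for the arctangent it is a rational function of
    the argument. *)
Lemma Ck_comp1 (phi : nat -> R -> R) (dphi : nat -> R -> R) U : open U ->
  (forall k x, is_derive x (1 : R) (phi k) (dphi k x)) ->
  (forall k m f, (forall j, Ck m U (phi j \o f)) -> Ck m U f -> Ck m U (dphi k \o f)) ->
  forall m k f, Ck m U f -> Ck m U (phi k \o f).
Proof.
move=> oU dphiE dphiC m; have cphi k f x : {for x, continuous f} -> {for x, continuous (phi k \o f)}.
  move=> cf; apply: continuous_comp => //.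
  by apply/differentiable_continuous/derivable1_diffP; have [] := dphiE k (f x).
elim: m => [|m IH] k f Cf.
  by split=> // x Ux; apply: cphi; have [H _] := Cf; exact: H.
have Cf' := Ck_S Cf; have [cf df] := Cf.
split=> [x Ux|i]; first exact/cphi/cf.
have [dfi Df] := df i; split=> [x Ux|].
  by have [] := is_derive_comp1 (dfi x Ux) (dphiE k (f x)).
apply: (Ck_eq oU _ (Ck_M oU (dphiC k m f (fun j => IH j f Cf') Cf') Df)) => x Ux.
by have [_ ->] := is_derive_comp1 (dfi x Ux) (dphiE k (f x)).
Qed.

Lemma Ck_flat m k U f : open U -> Ck m U f -> Ck m U (flat k \o f).
Proof.
move=> oU; apply: (Ck_comp1 oU (@is_derive_flat R)) => {}k {}m {}f Cflat Cf.
apply: (Ck_eq oU _ (Ck_D oU (Cflat k.+2)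
  (Ck_M oU (Ck_cst _ _ (- k%:R)) (Cflat k.+1)))) => x _ /=.
by rewrite mulNr.
Qed.

Lemma Ck_atan m U f : open U -> Ck m U f -> Ck m U (@atan R \o f).
Proof.
move=> oU Cf.
apply: (@Ck_comp1 (fun=> atan) (fun=> fun x => (1 + x ^+ 2)^-1) U oU _ _ m 0%N f Cf).
move=> _ {Cf}m {}f _ Cf; apply: Ck_V => // [x _|].
  by rewrite gt_eqF // ltr_wpDr // sqr_ge0.
exact: (Ck_D oU (Ck_cst _ _ 1) (Ck_M oU Cf Cf)).
Qed.

(** The sup norm is not smooth, so [q] is the squared Euclidean distance to [x0]. The function [a]
    vanishes where q >= r^2 and [b] where q <= r^2/2; they never vanish together, and a/(a + b) is
    the cutoff. It vanishes off the sup-norm ball because the sup norm is bounded by the Euclidean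
    one. *)
Lemma exists_cutoff (x0 : 'rV[R]_n) (r : R) : 0 < r -> exists chi : 'rV[R]_n -> R,
  [/\ smooth_on setT chi, \forall y \near x0, chi y = 1 &
      forall y, r < `|y - x0| -> chi y = 0].
Proof.
move=> r0; pose q (y : 'rV[R]_n) := \sum_j (y 0 j - x0 0 j) ^+ 2.
have Cq m : Ck m setT q.
  apply: (Ck_sum _ openT) => j.
  have H : Ck m setT (fun y : 'rV[R]_n => y 0 j + (- x0 0 j)).
    exact: (Ck_D openT (Ck_coord m _ j) (Ck_cst m _ _)).
  exact: (Ck_M openT H H).
pose a y := flat 0 (r ^+ 2 - q y); pose b y := flat 0 (q y - r ^+ 2 / 2).
have r20 : 0 < r ^+ 2 by rewrite exprn_gt0.
have ab0 y : 0 < a y + b y.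
  have [ry|ry] := ltP (q y) (r ^+ 2).
    by rewrite ltr_pwDl ?flat_ge0 // flat_gt0 // subr_gt0.
  rewrite ltr_wpDl ?flat_ge0 // flat_gt0 // subr_gt0; apply: lt_le_trans ry.
  by rewrite ltr_pdivrMr // ltr_pMr // ltr1n.
exists (fun y => a y * (a y + b y)^-1); split.
- move=> m; apply: Ck_M; first exact: openT.
    apply: (@Ck_flat m 0 setT (fun y => r ^+ 2 - q y) openT).
    apply: (Ck_eq openT _ (Ck_D openT (Ck_cst m _ (r ^+ 2)) (Ck_M openT (Ck_cst m _ (-1)) (Cq m)))).
    by move=> y _ /=; rewrite mulN1r.
  apply: Ck_V; [exact: openT|by move=> y _; rewrite gt_eqF|].
  apply: Ck_D; first exact: openT.
    apply: (@Ck_flat m 0 setT (fun y => r ^+ 2 - q y) openT).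
    apply: (Ck_eq openT _ (Ck_D openT (Ck_cst m _ (r ^+ 2)) (Ck_M openT (Ck_cst m _ (-1)) (Cq m)))).
    by move=> y _ /=; rewrite mulN1r.
  apply: (@Ck_flat m 0 setT (fun y => q y - r ^+ 2 / 2) openT).
  exact: (Ck_D openT (Cq m) (Ck_cst m _ _)).
- have cq : {for x0, continuous q} by have [H _] := Cq 0%N; exact: H.
  have q0 : q x0 = 0 by rewrite /q big1 // => j _; rewrite subrr expr0n.
  have : \forall y \near x0, q y < r ^+ 2 / 2.
    by apply: (cvgr_lt _ cq); rewrite q0 divr_gt0.
  apply: filterS => y qy.
  have b0 : b y = 0 by rewrite /b flat_le0 // subr_le0 ltW.
  by have := ab0 y; rewrite b0 addr0 => a0; rewrite divff // gt_eqF.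
move=> y ry; rewrite /a flat_le0 ?mul0r // subr_le0 leNgt.
apply/negP => qy; move: ry; rewrite ltNge => /negP; apply.
apply: norm_row_le => [|j]; first exact: ltW.
rewrite !mxE -(@ler_pXn2r _ 2) ?nnegrE // ?(ltW r0) // real_normK ?num_real //.
apply: le_trans (ltW qy); rewrite /q (bigD1 j) //= lerDl.
by apply: sumr_ge0 => i _; rewrite sqr_ge0.
Qed.

End smooth_composition.

(** * Hadamard's lemma for functions on an open set *)

Section hadamard_local.
Context {R : realType} {n : nat}.
Implicit Types (f : 'rV[R]_n -> R) (U V : set 'rV[R]_n).

Lemma Ck_supp m U V f : open U -> open V ->
  (forall x, U x -> ~ V x -> \forall y \near x, f y = 0) -> Ck m (U `&` V) f -> Ck m U f.
Proof.
move=> oU oV f0 Cf; apply: Ck_local => x Ux.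
have [Vx|nVx] := pselect (V x); first by exists (U `&` V).
have := f0 x Ux nVx; rewrite -nbhs_nearE nbhsE => -[W [oW Wx] W0]; exists W => //.
by apply: (Ck_eq oW _ (Ck_cst m W 0)) => y /W0.
Qed.

Lemma derive_translate f (a x v : 'rV[R]_n) :
  'D_v (fun y => f (y + a)) x = 'D_v f (x + a).
Proof.
have E : (fun h : R => h^-1 *: (((fun y => f (y + a)) \o shift x) (h *: v) - f (x + a))) =
         (fun h : R => h^-1 *: ((f \o shift (x + a)) (h *: v) - f (x + a))).
  by apply/funext => h /=; rewrite addrA.
by rewrite /derive E.
Qed.

Lemma Ck_translate m (a : 'rV[R]_n) f : Ck m setT f -> Ck m setT (fun x => f (x + a)).
Proof.
move=> Cf; apply: (@Ck_comp _ _ _ m setT setT f (fun x => x + a)) => //; try exact: openT.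
move=> j; apply: (Ck_eq openT _ (Ck_D openT (Ck_coord m setT j) (Ck_cst m setT (a 0 j)))).
by move=> x _ /=; rewrite mxE.
Qed.

(** A cutoff supported in a ball inside [V] makes [f] global without changing its germ at [x0]. The
    coefficients come out smooth on the whole space, so that composed with global coordinate
    functions they are again arguments for a derivation. *)
Lemma hadamard_local f V (x0 : 'rV[R]_n) : open V -> V x0 -> smooth_on V f ->
  exists G : 'I_n -> 'rV[R]_n -> R,
  [/\ forall i, smooth_on setT (G i),
      forall i, G i x0 = 'D_(delta_mx 0 i) f x0 &
      \forall x \near x0, f x = f x0 + \sum_i (x - x0) 0 i * G i x].
Proof.
move=> oV Vx0 sf.
have [r /= r0 rV] : exists2 r : R, 0 < r & forall y, `|y - x0| <= r -> V y.
  have /nbhs_normP[r /= r0 rV] : \forall y \near x0, V y by exact: open_nbhs_nbhs.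
  exists (r / 2) => [|y yr]; first by rewrite divr_gt0.
  apply: rV; rewrite /ball_ /= distrC; apply: le_lt_trans yr _.
  by rewrite ltr_pdivrMr // ltr_pMr // ltr1n.
have [chi [schi chi1 chi0]] := exists_cutoff x0 r0.
pose F y := chi y * f y.
have sF : smooth_on setT F.
  move=> k; apply: (@Ck_supp k setT V) => //; first exact: openT.
    move=> x _ nVx.
    have : \forall y \near x, r < `|y - x0|.
      have rx : r < `|x - x0| by rewrite ltNge; apply/negP => /rV; exact: nVx.
      apply/nbhs_normP; exists (`|x - x0| - r); first by rewrite /= subr_gt0.
      by move=> y; rewrite /ball_ /=; have := ler_distD y x x0; lra.
    by apply: filterS => y /chi0; rewrite /F => ->; rewrite mul0r.
  rewrite setTI; apply: Ck_M => //; exact: Ck_sub (schi k).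
have csF : csmooth r (fun y => F (y + x0)).
  split=> [k|y ry]; first exact: Ck_translate.
  by rewrite /F chi0 ?mul0r // addrK.
have [G [sG G0 FG]] := hadamard csF.
have nF : \forall y \near x0, F y = f y.
  by apply: filterS chi1 => y; rewrite /F => ->; rewrite mul1r.
exists (fun i y => G i (y - x0)); split.
- by move=> i k; exact/Ck_translate/sG.
- move=> i; rewrite subrr G0 -(near_eq_derive _ nF).
  by rewrite derive_translate add0r.
rewrite -(nbhs_singleton nF); apply: filterS nF => y <-.
by have := FG (y - x0); rewrite subrK add0r.
Qed.

End hadamard_local.

(** * Smooth functions on manifolds *)

Section smooth_functions_on.
Context {R : realType} {n : nat} (M : manifold R n).
Implicit Types (V W : set M) (f g : M -> R).

Lemma manifold_hausdorff : hausdorff_space M.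
Proof. by case: M. Qed.

Lemma atlas_cover (p : M) : exists2 c, @atlas R n M c & cdom c p.
Proof. by case: M p => T at_ ? ? H ? p; exact: H. Qed.

Lemma atlas_smooth c c' : @atlas R n M c -> @atlas R n M c' -> forall i,
  smooth_on (cmap c @` (cdom c `&` cdom c')) (fun y => cmap c' (cinv c y) 0 i).
Proof. by case: M c c' => T at_ ? ? ? H c c'; exact: H. Qed.

Lemma open_preimage_on (S T : topologicalType) (U : set S) (h : S -> T) (V : set T) :
  open U -> (forall x, U x -> {for x, continuous h}) -> open V ->
  open (U `&` h @^-1` V).
Proof.
move=> oU ch oV; rewrite openE => x [Ux Vhx].
apply: filterI; first exact: open_nbhs_nbhs.
by apply: (ch x Ux); exact: open_nbhs_nbhs.
Qed.

Lemma open_chart_img (c : chart R n M) V : open V -> open (cmap c @` (cdom c `&` V)).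
Proof.
move=> oV; rewrite (_ : cmap c @` _ = (cmap c @` cdom c) `&` (cinv c @^-1` V)).
  by apply: open_preimage_on => //; [exact: cimg_open|exact: cinv_continuous].
apply/seteqP; split=> [_ [p [cp Vp] <-]|y [[p cp <-]]].
  by split; [exists p|rewrite /= cmapK].
by rewrite /= cmapK // => Vp; exists p.
Qed.

Lemma smooth_fun_on_sub V W f : V `<=` W -> smooth_fun_on W f -> smooth_fun_on V f.
Proof.
move=> VW sf c ac k; apply: Ck_sub (sf c ac k) => _ [p [cp Vp] <-].
by exists p => //; split=> //; exact: VW.
Qed.

Lemma smooth_fun_on_local W f :
  (forall p, W p -> exists2 V, V p & smooth_fun_on V f) -> smooth_fun_on W f.
Proof.
move=> WV c ac k; apply: Ck_local => _ [p [cp Wp] <-].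
have [V Vp sV] := WV p Wp.
by exists (cmap c @` (cdom c `&` V)); [exists p|exact: sV].
Qed.

Lemma smooth_fun_on_ext V f g : open V -> (forall p, V p -> f p = g p) ->
  smooth_fun_on V f -> smooth_fun_on V g.
Proof.
move=> oV fg sf c ac k; apply: (Ck_eq (open_chart_img oV) _ (sf c ac k)).
by move=> _ [p [cp Vp] <-] /=; rewrite cmapK // fg.
Qed.

Lemma smooth_fun_on_cst V (a : R) : smooth_fun_on V (fun=> a).
Proof. by move=> c ac k; exact: Ck_cst. Qed.

Lemma smooth_fun_onD V f g : open V -> smooth_fun_on V f -> smooth_fun_on V g ->
  smooth_fun_on V (fun p => f p + g p).
Proof.
by move=> oV sf sg c ac k; exact: (Ck_D (open_chart_img oV) (sf c ac k) (sg c ac k)).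
Qed.

Lemma smooth_fun_onM V f g : open V -> smooth_fun_on V f -> smooth_fun_on V g ->
  smooth_fun_on V (fun p => f p * g p).
Proof.
by move=> oV sf sg c ac k; exact: (Ck_M (open_chart_img oV) (sf c ac k) (sg c ac k)).
Qed.

Lemma cinf_smooth_fun (f : cinf M) : smooth_fun f.
Proof. exact/smooth_predP/cinfP. Qed.

Lemma cinf_smooth_fun_on V (f : cinf M) : smooth_fun_on V f.
Proof. exact: smooth_fun_on_sub (@cinf_smooth_fun f). Qed.

Lemma smooth_fun_on_continuous V f p : open V -> V p -> smooth_fun_on V f ->
  {for p, continuous f}.
Proof.
move=> oV Vp sf; have [c ac cp] := atlas_cover p.
have oU := open_chart_img (c := c) oV.
have cf : {for cmap c p, continuous (f \o cinv c)}.
  by have [H _] := sf c ac 0%N; apply: H; exists p.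
have cg : {for p, continuous ((f \o cinv c) \o cmap c)}.
  by apply: continuous_comp => //; exact: cmap_continuous.
have np : \forall q \near p, ((f \o cinv c) \o cmap c) q = f q.
  have : \forall q \near p, cdom c q.
    by apply: open_nbhs_nbhs; split=> //; exact: cdom_open.
  by apply: filterS => q cq /=; rewrite cmapK.
rewrite /prop_for /continuous_at -(nbhs_singleton np).
by apply: cvg_trans cg; apply: (@near_eq_cvg _ _ (nbhs p)).
Qed.

Lemma cinf_continuous (f : cinf M) : continuous f.
Proof.
move=> p; apply: (@smooth_fun_on_continuous setT) => //; first exact: openT.
exact: cinf_smooth_fun.
Qed.

Lemma smooth_fun_on_comp m (W : set M) (y : M -> 'rV[R]_m) (V : set 'rV[R]_m) F :
  open W -> open V -> (forall p, W p -> V (y p)) ->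
  (forall j, smooth_fun_on W (fun p => y p 0 j)) -> smooth_on V F ->
  smooth_fun_on W (F \o y).
Proof.
move=> oW oV WV sy sF c ac k.
apply: (@Ck_comp _ _ _ k (cmap c @` (cdom c `&` W)) V F (y \o cinv c)) => //.
- exact: open_chart_img.
- by move=> _ [p [cp Wp] <-] /=; rewrite cmapK //; exact: WV.
- by move=> j; exact: (sy j c ac k).
Qed.

Lemma smooth_coord c i : @atlas R n M c ->
  smooth_fun_on (cdom c) (fun p => cmap c p 0 i).
Proof. by move=> ac c' ac'; exact: atlas_smooth. Qed.

(** [K] is the image of a compact ball of the chart, hence compact, hence closed because the
    manifold is Hausdorff. Closedness is what permits extension by zero outside [N]. *)
Lemma exists_bump (p : M) (N : set M) : open N -> N p ->
  exists (chi : cinf M) (K : set M),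
    [/\ closed K, K `<=` N, forall q, ~ K q -> chi q = 0 &
        \forall q \near p, chi q = 1].
Proof.
move=> oN Np; have [c ac cp] := atlas_cover p.
have oU := open_chart_img (c := c) oN.
have Uy0 : (cmap c @` (cdom c `&` N)) (cmap c p) by exists p.
have [r r0 rU] : exists2 r : R, 0 < r &
    forall y, `|y - cmap c p| <= r -> (cmap c @` (cdom c `&` N)) y.
  have /nbhs_normP[r /= r0 rV] : \forall y \near cmap c p, (cmap c @` (cdom c `&` N)) y.
    exact: open_nbhs_nbhs.
  exists (r / 2) => [|y yr]; first by rewrite divr_gt0.
  apply: rV; rewrite /ball_ /= distrC; apply: le_lt_trans yr _.
  by rewrite ltr_pdivrMr // ltr_pMr // ltr1n.
have [b [sb b1 b0]] := exists_cutoff (cmap c p) r0.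
pose A := [set y : 'rV[R]_n | `|y - cmap c p| <= r].
pose K := cinv c @` A.
have cA : compact A.
  apply: bounded_closed_compact.
    exists (r + `|cmap c p|); split; first exact: num_real.
    move=> z rz y yr; apply: le_trans (ltW rz).
    by rewrite -lerBlDr; apply: le_trans yr; exact: lerB_dist.
  rewrite (_ : A = closed_ball (cmap c p) r); first exact: closed_ball_closed.
  by rewrite closed_ballE //; apply/seteqP; split=> y; rewrite /A /closed_ball_ /= distrC.
have cK : closed K.
  apply: compact_closed; first exact: manifold_hausdorff.
  apply: continuous_compact => //; apply: continuous_in_subspaceT => y /set_mem Ay.
  apply: cinv_continuous; have [q [cq _] <-] := rU y Ay; by exists q.
have KN : K `<=` N.
  by move=> _ [y /rU[q [cq Nq] <-] <-]; rewrite cmapK.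
have Kc : K `<=` cdom c.
  by move=> _ [y /rU[q [cq Nq] <-] <-]; rewrite cmapK.
(* Outside [cdom c] the value of [cmap c] is arbitrary, hence the explicit 0. *)
pose chi q := if `[< cdom c q >] then b (cmap c q) else 0.
have chi0 q : ~ K q -> chi q = 0.
  move=> nK; rewrite /chi; case: asboolP => // cq; apply: b0.
  rewrite ltNge; apply/negP => Aq; apply: nK.
  by exists (cmap c q) => //; exact: cmapK.
have schi : smooth_fun chi.
  apply: smooth_fun_on_local => q _.
  have [cq|ncq] := pselect (cdom c q).
    exists (cdom c) => //.
    apply: (@smooth_fun_on_ext _ (b \o cmap c)); first exact: cdom_open.
      by move=> q' cq'; rewrite /chi; case: asboolP.
    apply: (@smooth_fun_on_comp _ _ _ setT) => //.
    - exact: cdom_open.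
    - exact: openT.
    - by move=> j; exact: smooth_coord.
  exists (~` K); first by move=> /Kc.
  apply: (@smooth_fun_on_ext _ (fun=> 0)); first exact: closed_openC.
    by move=> q' /chi0.
  exact: smooth_fun_on_cst.
exists (CInf (introT (smooth_predP _) schi)), K; split=> //.
have cc : {for p, continuous (cmap c)} by exact: cmap_continuous.
have np : \forall q \near p, cdom c q by apply: open_nbhs_nbhs; split=> //; exact: cdom_open.
have nb := cc _ b1.
near=> q; rewrite /= /chi.
have cq : cdom c q by near: q.
case: asboolP => // _; near: q; exact: nb.
Unshelve. all: by end_near.
Qed.

Lemma smooth_zero_ext (chi : cinf M) (K N : set M) phi : closed K -> open N ->
  K `<=` N -> (forall q, ~ K q -> chi q = 0) -> smooth_fun_on N phi ->
  smooth_fun (fun q => chi q * phi q).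
Proof.
move=> cK oN KN chi0 sphi; apply: smooth_fun_on_local => q _.
have [Nq|nNq] := pselect (N q).
  by exists N => //; apply: smooth_fun_onM => //; exact: cinf_smooth_fun_on.
exists (~` K); first by move=> /KN.
apply: (@smooth_fun_on_ext _ (fun=> 0)); first exact: closed_openC.
  by move=> q' /chi0 ->; rewrite mul0r.
exact: smooth_fun_on_cst.
Qed.

(** Every germ of a smooth function is the germ of a global one; this gives chart coordinates as
    elements of [cinf M], on which tangent vectors act. *)
Lemma smooth_extend (p : M) (N : set M) phi : open N -> N p ->
  smooth_fun_on N phi -> exists phi' : cinf M, \forall q \near p, phi' q = phi q.
Proof.
move=> oN Np sphi; have [chi [K [cK KN chi0 chi1]]] := exists_bump oN Np.
exists (CInf (introT (smooth_predP _) (smooth_zero_ext cK oN KN chi0 sphi))).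
by apply: filterS chi1 => q /= ->; rewrite mul1r.
Qed.

Lemma smooth_locally_cinf f :
  (forall p : M, exists f' : cinf M, \forall q \near p, f q = f' q) -> smooth_fun f.
Proof.
move=> H; apply: smooth_fun_on_local => p _; have [f' ff'] := H p.
move: ff'; rewrite -nbhs_nearE nbhsE => -[V [oV Vp] VE]; exists V => //.
apply: (@smooth_fun_on_ext _ f') => // [q /VE //|].
exact: cinf_smooth_fun_on.
Qed.

(** [smooth_map] does not record continuity. It is recovered here: a bump function at h t supported
    in [N] stays positive along [h] near t, which confines [h] to [N]. *)
Lemma continuous_into_manifold (T : topologicalType) (h : T -> M) (t : T) :
  (forall f : cinf M, {for t, continuous (f \o h)}) -> {for t, continuous h}.
Proof.
move=> ch A; rewrite nbhsE => -[N [oN Nht] NA].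
have [chi [K [_ KN chi0 /nbhs_singleton chi1]]] := exists_bump oN Nht.
have : \forall s \near t, 0 < (chi \o h) s.
  by apply: (cvgr_gt _ (ch chi)); rewrite /= chi1.
apply: filterS => s chis; apply: NA; apply: KN; apply: contrapT => /chi0.
by move=> E; move: chis; rewrite /= E ltxx.
Qed.

End smooth_functions_on.

(** * Tangent vectors as derivations *)

Section derivations.
Context {R : realType} {n : nat} (M : manifold R n).
Implicit Types (p : M) (f g : cinf M).

Lemma tangentD p (u : tangent p) f g : u (f + g) = u f + u g.
Proof. by have [uL _] := tangentP u; have := uL 1 f g; rewrite scale1r mul1r. Qed.

Lemma tangentM p (u : tangent p) f g : u (f * g) = f p * u g + g p * u f.
Proof. by have [_ ->] := tangentP u. Qed.

Lemma tangent0 p (u : tangent p) : u 0 = 0.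
Proof. by apply: (addrI (u 0)); rewrite -tangentD !addr0. Qed.

Lemma tangentZ p (u : tangent p) (a : R) f : u (a *: f) = a * u f.
Proof. by have [uL _] := tangentP u; have := uL a f 0; rewrite tangent0 !addr0. Qed.

Lemma tangentN p (u : tangent p) f : u (- f) = - u f.
Proof. by apply/eqP; rewrite -addr_eq0 -tangentD addNr tangent0. Qed.

Lemma tangentB p (u : tangent p) f g : u (f - g) = u f - u g.
Proof. by rewrite tangentD tangentN. Qed.

Lemma tangent_sum p (u : tangent p) (I : Type) (r : seq I) (F : I -> cinf M) :
  u (\sum_(i <- r) F i) = \sum_(i <- r) u (F i).
Proof.
elim: r => [|i r IH]; first by rewrite !big_nil tangent0.
by rewrite !big_cons tangentD IH.
Qed.

(** For a bump function chi with chi p = 1, supported where f = g, the product (f - g) chi is zero;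
    as (f - g) p = 0, the product rule leaves u (f - g) = 0. *)
Lemma tangent_local p (u : tangent p) f g : (\forall q \near p, f q = g q) -> u f = u g.
Proof.
rewrite -nbhs_nearE nbhsE => -[N [oN Np] fg].
have [chi [K [_ KN chi0 /nbhs_singleton chi1]]] := exists_bump oN Np.
have E : (f - g) * chi = 0.
  apply: cinf_ext => q; have [Kq|/chi0 cq] := pselect (K q).
    by change ((f q - g q) * chi q = 0); rewrite (fg q (KN q Kq)) subrr mul0r.
  by change ((f q - g q) * chi q = 0); rewrite cq mulr0.
have := tangentM u (f - g) chi; rewrite E tangent0 chi1 mul1r.
rewrite (_ : (f - g) p = 0) ?mul0r ?add0r; last first.
  by change (f p - g p = 0); rewrite (fg p Np) subrr.
by rewrite tangentB => /eqP; rewrite eq_sym subr_eq0 => /eqP.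
Qed.

Definition cinf_cst (a : R) : cinf M := a *: (1 : cinf M).

Lemma cinf_cstE a p : cinf_cst a p = a.
Proof. by change (a * 1 = a); rewrite mulr1. Qed.

Lemma tangent_cst p (u : tangent p) f (a : R) : (\forall q \near p, f q = a) -> u f = 0.
Proof.
move=> fa; rewrite (@tangent_local p u f (cinf_cst a)); last first.
  by apply: filterS fa => q ->; rewrite cinf_cstE.
rewrite tangentZ; apply/eqP; rewrite mulf_eq0; apply/orP; right; apply/eqP.
apply: (addrI (u 1)); rewrite addr0 -[X in _ = u X](mulr1 (1 : cinf M)) tangentM.
by change (u 1 + u 1 = 1 * u 1 + 1 * u 1); rewrite mul1r.
Qed.

Definition coords m (y : 'I_m -> cinf M) p : 'rV[R]_m := \row_j y j p.

Lemma smooth_comp_coords m (y : 'I_m -> cinf M) (N : set M) (V : set 'rV[R]_m) F :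
  open N -> open V -> (forall q, N q -> V (coords y q)) -> smooth_on V F ->
  smooth_fun_on N (F \o coords y).
Proof.
move=> oN oV NV; apply: smooth_fun_on_comp => // j.
apply: (smooth_fun_on_ext oN _ (@cinf_smooth_fun_on _ _ _ N (y j))) => q _.
by rewrite mxE.
Qed.

Lemma coords_continuous m (y : 'I_m -> cinf M) : continuous (coords y).
Proof.
move=> p; apply/(@cvgrPdist_le R 'rV[R]_m _ (nbhs p) _ (coords y) (coords y p)) => e e0.
have H : \forall q \near p, forall j : 'I_m, `|y j p - y j q| <= e.
  apply: near_forall_ord => j.
  by have /cvgrPdist_le/(_ _ e0) := @cinf_continuous _ _ _ (y j) p.
apply: filterS H => q Hq; apply: norm_row_le; first exact: ltW.
by move=> j; rewrite !mxE.
Qed.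

(* By Hadamard's lemma a derivation obeys the chain rule for smooth functions *)
(* of several variables, although only the product rule is assumed.           *)
Lemma tangent_chain p (u : tangent p) m (y : 'I_m -> cinf M) (V : set 'rV[R]_m) F f :
  open V -> V (coords y p) -> smooth_on V F ->
  (\forall q \near p, f q = F (coords y q)) ->
  u f = \sum_j 'D_(delta_mx 0 j) F (coords y p) * u (y j).
Proof.
move=> oV Vy sF fF.
have [G [sG G0 FG]] := hadamard_local oV Vy sF.
have sGy j : smooth_fun (G j \o coords y).
  by apply: (@smooth_comp_coords _ _ setT setT) => //; exact: openT.
pose Gy j : cinf M := CInf (introT (smooth_predP _) (sGy j)).
(* The Hadamard expansion, written inside the algebra [cinf M]. Each factor y j - y j p vanishes at
   [p], so the product rule keeps only the value of the coefficient there, a partial derivative of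
   [F]. *)
pose f' : cinf M := cinf_cst (F (coords y p)) + \sum_j (y j - cinf_cst (y j p)) * Gy j.
have f'E q : f' q = F (coords y p) + \sum_j (y j q - y j p) * Gy j q.
  change (cinf_cst (F (coords y p)) q + (\sum_j (y j - cinf_cst (y j p)) * Gy j : cinf M) q =
    F (coords y p) + \sum_j (y j q - y j p) * Gy j q).
  rewrite cinf_cstE; congr (_ + _).
  elim/big_ind2 : _ => //= [f1 a1 f2 a2 <- <- //|j _].
  change ((y j q - cinf_cst (y j p) q) * Gy j q = (y j q - y j p) * Gy j q).
  by rewrite cinf_cstE.
have ff' : \forall q \near p, f q = f' q.
  have FGp := @coords_continuous m y p _ FG.
  near=> q; rewrite f'E.
  have -> : f q = F (coords y q) by near: q.
  have -> : F (coords y q) = F (coords y p) + \sum_i (coords y q - coords y p) 0 i * G i (coords y q).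
    by near: q; exact: FGp.
  by congr (_ + _); apply: eq_bigr => j _; rewrite !mxE.
have u1 (a : R) : u (cinf_cst a) = 0.
  by apply: (@tangent_cst _ _ _ a); apply: nearW => q; rewrite cinf_cstE.
rewrite (tangent_local u ff') /f' tangentD u1 add0r tangent_sum; apply: eq_bigr => j _.
rewrite tangentM tangentB u1 subr0 (_ : (y j - cinf_cst (y j p)) p = 0); last first.
  by change (y j p - cinf_cst (y j p) p = 0); rewrite cinf_cstE subrr.
by rewrite mul0r add0r -G0.
Unshelve. all: by end_near.
Qed.

(** * Tangent vectors of a manifold that is locally a smooth retract of some R^m *)

Section retract.
Variables (m : nat) (p0 : M) (y : 'I_m -> cinf M) (V : set 'rV[R]_m) (N : set M).
Variable Psi : 'rV[R]_m -> M.
Hypotheses (oV : open V) (oN : open N) (Np0 : N p0).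
Hypothesis yV : forall q, N q -> V (coords y q).
Hypothesis yK : forall q, N q -> Psi (coords y q) = q.
Hypothesis sPsi : forall f, smooth_on V (f \o Psi).

Lemma retract_tangent q (u : tangent q) f : N q ->
  u f = \sum_j 'D_(delta_mx 0 j) (f \o Psi) (coords y q) * u (y j).
Proof.
move=> Nq; apply: (tangent_chain u oV (yV Nq) (sPsi f)).
have : \forall q' \near q, N q' by exact: open_nbhs_nbhs.
by apply: filterS => q' Nq' /=; rewrite yK.
Qed.

(** [W j] is the image of the j-th coordinate vector under the differential of [Psi], cut off to be
    global. The number m may exceed the dimension: these fields span the tangent spaces near [p0]
    but need not be independent. The product rule uses that [Psi] inverts the coordinates on [N]. *)
Lemma retract_frame : exists W : 'I_m -> vfield M,
  (\forall q \near p0, forall j f, W j q f = 'D_(delta_mx 0 j) (f \o Psi) (coords y q)) /\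
  (\forall q \near p0, forall u : tangent q, u = \sum_j u (y j) *: W j q).
Proof.
have [chi [K [cK KN chi0 chi1]]] := exists_bump oN Np0.
pose w j q f : R := chi q * 'D_(delta_mx 0 j) (f \o Psi) (coords y q).
have dPsi f j x : V x -> derivable (f \o Psi) x (delta_mx 0 j).
  by move=> Vx; have [_ /(_ j)[H _]] := sPsi f 1%N; exact: H.
have wder j q : is_derivation q (w j q).
  have [Kq|nKq] := pselect (K q); last first.
    by rewrite /w (chi0 _ nKq); split=> [a f g|f g]; rewrite !mul0r ?mulr0 addr0.
  have Nq := KN _ Kq; split=> [a f g|f g]; rewrite /w.
    have -> : (a *: f + g : cinf M) \o Psi = (a \*: (f \o Psi)) + (g \o Psi) by [].
    rewrite deriveD; [|by apply: derivableZ; apply: dPsi; exact: yV|by apply: dPsi; exact: yV].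
    rewrite deriveZ; last by apply: dPsi; exact: yV.
    by rewrite mulrDr mulrCA.
  have -> : (f * g : cinf M) \o Psi = (f \o Psi) * (g \o Psi) by [].
  rewrite deriveM; [|by apply: dPsi; exact: yV|by apply: dPsi; exact: yV].
  by rewrite /= yK // mulrDr !(mulrCA (chi q)).
have wsm j f : (fun q => mk_tangent (wder j q) f) \in smooth_pred M.
  apply/smooth_predP; apply: (smooth_zero_ext cK oN KN chi0).
  apply: (@smooth_comp_coords _ _ _ V ('D_(delta_mx 0 j) (f \o Psi))) => //.
  by move=> k; have [_ /(_ j)[]] := sPsi f k.+1.
pose W j := VField (wsm j).
have WE : \forall q \near p0, forall j f, W j q f = 'D_(delta_mx 0 j) (f \o Psi) (coords y q).
  by apply: filterS chi1 => q chiq j f; rewrite /= /w chiq mul1r.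
exists W; split=> //.
have nN : \forall q \near p0, N q by exact: open_nbhs_nbhs.
near=> q; move=> u; apply: tangent_ext => f.
rewrite retract_tangent; last by near: q.
have Wq : forall j f, W j q f = 'D_(delta_mx 0 j) (f \o Psi) (coords y q) by near: q; exact: WE.
transitivity (\sum_j u (y j) * W j q f); first by apply: eq_bigr => j _; rewrite Wq mulrC.
by elim/big_ind2 : _ => // a1 b1 a2 b2 -> ->.
Unshelve. all: by end_near.
Qed.

End retract.

Lemma chart_coords c (p0 : M) : @atlas R n M c -> cdom c p0 ->
  exists x : 'I_n -> cinf M, \forall q \near p0, cdom c q /\ coords x q = cmap c q.
Proof.
move=> ac cp0.
have /choice[x xE] : forall i, exists xi : cinf M, \forall q \near p0, xi q = cmap c q 0 i.
  by move=> i; apply: (smooth_extend (@cdom_open _ _ _ c)) => //; exact: smooth_coord.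
exists x; have nx := near_forall_ord xE.
have nc : \forall q \near p0, cdom c q by apply: open_nbhs_nbhs; split=> //; exact: cdom_open.
near=> q; split; first by near: q.
have H : forall j, x j q = cmap c q 0 j by near: q; exact: nx.
by apply/rowP => j; rewrite mxE.
Unshelve. all: by end_near.
Qed.

Lemma chart_comp_smooth c f : @atlas R n M c -> smooth_on (cmap c @` cdom c) (f \o cinv c).
Proof. by move=> ac k; have := @cinf_smooth_fun _ _ _ f c ac k; rewrite setIT. Qed.

Lemma local_frame (p0 : M) : exists (x : 'I_n -> cinf M) (E : 'I_n -> vfield M),
  \forall q \near p0, forall u : tangent q, u = \sum_i u (x i) *: E i q.
Proof.
have [c ac cp0] := atlas_cover p0; have [x] := chart_coords ac cp0.
rewrite -nbhs_nearE nbhsE => -[N [oN Np0] Nx].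
have xV q : N q -> (cmap c @` cdom c) (coords x q).
  by move=> /Nx[cq ->]; exists q.
have xK q : N q -> cinv c (coords x q) = q by move=> /Nx[cq ->]; rewrite cmapK.
have [E [_ H]] := retract_frame (@cimg_open _ _ _ c) oN Np0 xV xK
  (fun f => chart_comp_smooth f ac).
by exists x, E.
Qed.

Lemma tangent_vfield p (u : tangent p) : exists X : vfield M, X p = u.
Proof.
have [x [E /nbhs_singleton EH]] := local_frame p.
exists (\sum_i cinf_cst (u (x i)) *: E i); rewrite [RHS]EH.
elim/big_ind2 : _ => // [a1 b1 a2 b2 <- <- //|i _].
by change (cinf_cst (u (x i)) p *: E i p = u (x i) *: E i p); rewrite cinf_cstE.
Qed.

(** After multiplication by a bump function, [X] is a global combination of frame fields whose
    coefficients vanish at [p] together with [X]. *)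
Lemma tensorial p (W : lmodType R) (T : vfield M -> W) :
  (forall (f : cinf M) (X X' : vfield M), T (f *: X + X') = f p *: T X + T X') ->
  forall X : vfield M, X p = 0 -> T X = 0.
Proof.
move=> TL X Xp0.
have TZ f Y : T (f *: Y) = f p *: T Y.
  have T0 : T 0 = 0.
    have := TL 1 0 0; rewrite scaler0 addr0 (_ : (1 : cinf M) p = 1) // scale1r => H.
    by apply: (addrI (T 0)); rewrite addr0 -H.
  by have := TL f Y 0; rewrite T0 !addr0.
have [x [E]] := local_frame p.
rewrite -nbhs_nearE nbhsE => -[N [oN Np] NE].
have [chi [K [cK KN chi0 /nbhs_singleton chi1]]] := exists_bump oN Np.
have XE : chi *: X = \sum_i (chi * vapp X (x i)) *: E i.
  apply: vfield_ext => q.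
  transitivity (\sum_i (chi q * X q (x i)) *: E i q); last first.
    by elim/big_ind2 : _ => // a1 b1 a2 b2 -> ->.
  change (chi q *: X q = \sum_i (chi q * X q (x i)) *: E i q).
  have [Kq|/chi0 ->] := pselect (K q).
    rewrite {1}(NE q (KN q Kq) (X q)) scaler_sumr; apply: eq_bigr => i _.
    by rewrite scalerA.
  by rewrite scale0r big1 // => i _; rewrite mul0r scale0r.
have : T (chi *: X) = T X by rewrite TZ chi1 scale1r.
rewrite XE => <-.
have TS (r : seq 'I_n) : T (\sum_(i <- r) (chi * vapp X (x i)) *: E i) = 0.
  elim: r => [|i r IH].
    by rewrite big_nil -(scale0r (0 : vfield M)) TZ scale0r.
  rewrite big_cons TL IH addr0.
  by change ((chi p * X p (x i)) *: T (E i) = 0); rewrite Xp0 mulr0 scale0r.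
exact: TS.
Qed.

End derivations.

(** * Circle bundles *)

Section circle.
Context {R : realType}.

Lemma on_circleP (z : R[i]) :
  on_circle z <-> complex.Re z ^+ 2 + complex.Im z ^+ 2 = 1.
Proof.
case: z => a b; rewrite /on_circle /Num.norm /=; split.
  move=> [] H; have := congr1 (fun x => x ^+ 2) H.
  by rewrite sqr_sqrtr ?expr1n // addr_ge0 // sqr_ge0.
by move=> ->; rewrite sqrtr1.
Qed.

Lemma on_circle1 : on_circle (1 : R[i]).
Proof. by apply/on_circleP; rewrite /= expr1n expr0n addr0. Qed.

Lemma on_circleM (z w : R[i]) : on_circle z -> on_circle w -> on_circle (z * w).
Proof. by rewrite /on_circle normrM => -> ->; rewrite mulr1. Qed.

Lemma on_circleV (z : R[i]) : on_circle z -> on_circle z^-1.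
Proof. by rewrite /on_circle normfV => ->; rewrite invr1. Qed.

Lemma on_circle_neq0 (z : R[i]) : on_circle z -> z != 0.
Proof. by rewrite /on_circle -normr_eq0 => ->; exact: oner_neq0. Qed.

Lemma on_circle_cis (t : R) : on_circle (cis t).
Proof. by apply/on_circleP; rewrite /= cos2Dsin2. Qed.

Lemma cisD (s t : R) : cis (s + t) = cis s * cis t.
Proof. by rewrite /cis sinD cosD [sin s * _ + _]addrC. Qed.

Lemma cis0 : cis 0 = 1 :> R[i].
Proof. by rewrite /cis cos0 sin0. Qed.

Lemma on_circle_is_cis (z : R[i]) : on_circle z -> exists t, z = cis t.
Proof.
case: z => a b /on_circleP /= ab1.
have a1 : -1 <= a <= 1.
  rewrite -ler_norml -(@ler_pXn2r _ 2) ?nnegrE // real_normK ?num_real //.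
  by rewrite expr1n -ab1 lerDl sqr_ge0.
have sE : sin (acos a) = `|b|.
  by rewrite sin_acos // -ab1 [_ + b ^+ 2]addrC addrK sqrtr_sqr.
have cE : cos (acos a) = a by apply: acosK; rewrite in_itv.
have [b0|b0] := leP 0 b.
  by exists (acos a); rewrite /cis cE sE ger0_norm.
by exists (- acos a); rewrite /cis cosN sinN cE sE ltr0_norm // opprK.
Qed.

(** On the right half circle the angle is a smooth function of cosine and sine, which makes the
    local retraction of the total space smooth. *)
Lemma cis_atan (a b : R) : 0 < a -> a ^+ 2 + b ^+ 2 = 1 -> cis (atan (b / a)) = (a +i* b)%C.
Proof.
move=> a0 ab1; have an0 : a != 0 by rewrite gt_eqF.
have c0 : 0 < cos (atan (b / a)) by apply: cos_gt0_pihalf; rewrite atan_gtNpi2 atan_ltpi2.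
have cn0 : cos (atan (b / a)) != 0 by rewrite gt_eqF.
have cE : cos (atan (b / a)) = a.
  apply: (@pexpIrn _ 2); rewrite ?nnegrE ?ltW //.
  apply: invr_inj; rewrite cos2_tan2 // atanK.
  have -> : (a ^+ 2)^-1 = (a ^+ 2 + b ^+ 2) / a ^+ 2 by rewrite ab1 mul1r.
  by field.
rewrite /cis cE; congr (_ +i* _)%C.
have := atanK (b / a); rewrite /tan cE => /(congr1 (fun x => x * a)).
by rewrite !divfK.
Qed.

End circle.

Lemma open_lsubmx (R : realType) m1 m2 (V : set 'rV[R]_m1) :
  open V -> open [set y : 'rV[R]_(m1 + m2) | V (lsubmx y)].
Proof.
move=> oV; apply: (@open_comp _ _ (fun y : 'rV[R]_(m1 + m2) => lsubmx y) V) => // y _.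
exact/differentiable_continuous/differentiable_lsubmx.
Qed.

(** * Local trivialisations normalised at a point *)

Section bundle_charts.
Context {R : realType} {n : nat} {P : manifold R n.+1} {B : manifold R n}.
Variable pb : principal_circle_bundle P B.
Local Notation proj := (pb_proj pb).
Local Notation act := (pb_act pb).

(** Invariance of the projection comes from the equivariance of a local trivialisation. *)
Lemma proj_act p z : on_circle z -> proj (act p z) = proj p.
Proof.
move=> hz; have [U [oU Up [Phi [psi [PhiK psiK PhiM _ _]]]]] := pb_trivial pb (proj p).
have [hpsi {1}<-] := psiK p Up.
by rewrite -PhiM //; apply: (proj1 (PhiK _ _ _ _)) => //; exact: on_circleM.
Qed.

Lemma proj_surj b : exists p, proj p = b.
Proof.
have [U [oU Ub [Phi [psi [PhiK _ _ _ _]]]]] := pb_trivial pb b.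
by exists (Phi b 1); have [] := PhiK b 1 Ub on_circle1.
Qed.

Lemma bundle_proj_continuous : continuous proj.
Proof.
move=> p; apply: continuous_into_manifold => f.
exact: (@cinf_continuous _ _ _ (pullback proj f) p).
Qed.

(** Rotating a trivialisation by the value of [psi] at [p0] puts that point at angle 0, where the
    cosine is 1 and the arctangent recovers nearby angles. *)
Lemma trivial_at p0 : exists U : set B, [/\ open U, U (proj p0) &
    exists (Phi : B -> R[i] -> P) (psi : P -> R[i]),
    [/\ psi p0 = 1,
        forall x z, U x -> on_circle z -> proj (Phi x z) = x,
        forall p, U (proj p) -> on_circle (psi p) /\ Phi (proj p) (psi p) = p,
        forall p z, U (proj p) -> on_circle z -> psi (act p z) = psi p * z &
        (forall f : cinf P, smooth_fun_on_circle U (fun x z => f (Phi x z))) /\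
        smooth_fun_on (proj @^-1` U) (fun p => complex.Re (psi p)) /\
        smooth_fun_on (proj @^-1` U) (fun p => complex.Im (psi p))]].
Proof.
have [U [oU Up [Phi [psi [PhiK psiK PhiM sPhi [sRe sIm]]]]]] := pb_trivial pb (proj p0).
exists U; split=> //; set w := psi p0.
have [hw Phiw] := psiK p0 Up.
have wn0 := on_circle_neq0 hw.
have oPU : open (proj @^-1` U).
  by apply: open_comp => // p _; exact: bundle_proj_continuous.
have psiM p z : U (proj p) -> on_circle z -> psi (act p z) = psi p * z.
  move=> Upp hz; have [hp {1}<-] := psiK p Upp.
  by rewrite -PhiM //; apply: (proj2 (PhiK _ _ _ _)) => //; exact: on_circleM.
exists (fun x z => Phi x (z * w)), (fun p => psi p / w); split.
- exact: divff.
- by move=> x z Ux hz; apply: (proj1 (PhiK _ _ _ _)) => //; exact: on_circleM.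
- move=> p Upp; have [hp Phip] := psiK p Upp; split; last by rewrite divfK.
  by apply: on_circleM => //; exact: on_circleV.
- by move=> p z Upp hz; rewrite psiM // mulrAC.
split.
  move=> f c ac k.
  (* By equivariance, the rotated trivialisation tested on [f] is the old one tested on the right
     translate of [f] by [w]. *)
  have := sPhi (CInf (pb_act_smooth1 pb hw f)) c ac k.
  apply: Ck_eq.
    by apply: open_lsubmx; exact: open_chart_img.
  move=> y [b [cb Ub] yE] /=; rewrite -PhiM //; last exact: on_circle_cis.
  by rewrite -yE cmapK.
have ReM (a : R[i]) : smooth_fun_on (proj @^-1` U) (fun p => complex.Re (psi p * a)).
  have H1 := smooth_fun_onM oPU sRe (smooth_fun_on_cst _ (complex.Re a)).
  have H2 := smooth_fun_onM oPU sIm (smooth_fun_on_cst _ (- complex.Im a)).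
  apply: (smooth_fun_on_ext oPU _ (smooth_fun_onD oPU H1 H2)) => p _.
  by case: (psi p) a {H1 H2} => [a1 a2] [b1 b2] /=; rewrite mulrN.
have ImM (a : R[i]) : smooth_fun_on (proj @^-1` U) (fun p => complex.Im (psi p * a)).
  have H1 := smooth_fun_onM oPU sRe (smooth_fun_on_cst _ (complex.Im a)).
  have H2 := smooth_fun_onM oPU sIm (smooth_fun_on_cst _ (complex.Re a)).
  apply: (smooth_fun_on_ext oPU _ (smooth_fun_onD oPU H1 H2)) => p _.
  by case: (psi p) a {H1 H2} => [a1 a2] [b1 b2] /=.
by split; [exact: ReM|exact: ImM].
Qed.

End bundle_charts.

Section bundle_retract.
Context {R : realType} {n : nat} {P : manifold R n.+1} {B : manifold R n}.
Variable pb : principal_circle_bundle P B.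
Local Notation proj := (pb_proj pb).
Local Notation act := (pb_act pb).

Lemma derive_lsubmx m1 m2 (f : 'rV[R]_m1 -> R) (y : 'rV[R]_(m1 + m2)) i :
  'D_(delta_mx 0 (lshift m2 i)) (fun y => f (lsubmx y)) y = 'D_(delta_mx 0 i) f (lsubmx y).
Proof.
have E : (fun h : R => h^-1 *: (((fun y => f (lsubmx y)) \o shift y)
    (h *: delta_mx 0 (lshift m2 i)) - f (lsubmx y))) =
  (fun h : R => h^-1 *: ((f \o shift (lsubmx y)) (h *: delta_mx 0 i) - f (lsubmx y))).
  apply/funext => h /=; congr (_ *: (f _ - _)).
  apply/rowP => j; rewrite !mxE; congr (_ * _%:R + _).
by rewrite /derive E.
Qed.

(* Near p0 the total space is a smooth retract of R^n x R^2, the last two    *)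
(* coordinates being the sine and the cosine of the fibre angle.             *)
Lemma local_angle p0 : exists s c : cinf P, [/\ s p0 = 0, c p0 = 1,
  forall q t, s (act q (cis t)) = s q * cos t + c q * sin t,
  forall u : tangent p0, dproj pb u = 0 -> u s = 0 -> u = 0 &
  forall X : vfield B, exists W : vfield P,
    \forall q \near p0, dproj pb (W q) = X (proj q)].
Proof.
have [U [oU Up [Phi [psi [psi1 PhiK psiK psiM [sPhi [sRe sIm]]]]]]] := trivial_at pb p0.
have oPU : open (proj @^-1` U).
  by apply: open_comp => // p _; exact: (@bundle_proj_continuous _ _ _ _ pb _).
have [c0 ac0 cp0] := atlas_cover (proj p0); have [x xE] := chart_coords ac0 cp0.
have [chi [K [cK KU chi0 chi1]]] := exists_bump oU Up.
have cPK : closed (proj @^-1` K).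
  by apply: closed_comp => // p _; exact: (@bundle_proj_continuous _ _ _ _ pb _).
have KPU : proj @^-1` K `<=` proj @^-1` U by move=> p /KU.
have chi0' q : ~ (proj @^-1` K) q -> pullback proj chi q = 0 by move=> /chi0.
pose s : cinf P := CInf (introT (smooth_predP _) (smooth_zero_ext cPK oPU KPU chi0' sIm)).
pose c : cinf P := CInf (introT (smooth_predP _) (smooth_zero_ext cPK oPU KPU chi0' sRe)).
have sE q : s q = chi (proj q) * complex.Im (psi q) by [].
have cE q : c q = chi (proj q) * complex.Re (psi q) by [].
have s0 : s p0 = 0 by rewrite sE psi1 /= mulr0.
have c1 : c p0 = 1 by rewrite cE psi1 /= mulr1 (nbhs_singleton chi1).
have : \forall b \near proj p0, [/\ cdom c0 b, coords x b = cmap c0 b, U b & chi b = 1].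
  have nU : \forall b \near proj p0, U b by exact: open_nbhs_nbhs.
  near=> b; suff [? ?] : cdom c0 b /\ coords x b = cmap c0 b by split=> //; near: b.
  by near: b.
rewrite -nbhs_nearE nbhsE => -[NB [oNB NBp] NBE].
pose N := (proj @^-1` NB) `&` [set q | 0 < c q].
have oN : open N.
  apply: openI; first by apply: open_comp => // p _; exact: (@bundle_proj_continuous _ _ _ _ pb _).
  apply: (@open_comp _ _ c [set r | 0 < r]); last exact: open_gt.
  by move=> q _; exact: cinf_continuous.
have Np0 : N p0 by split=> //; change (0 < c p0); rewrite c1 ltr01.
(* Base coordinates, then the sine, then the cosine. *)
pose y (j : 'I_(n + 2)) : cinf P := match fintype.split j with
  | inl i => pullback proj (x i) | inr k => if k == 0 then s else c end.
have yl q : lsubmx (coords y q) = coords x (proj q).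
  by apply/rowP => j; rewrite !mxE /y (unsplitK (inl j)).
have ys q : rsubmx (coords y q) 0 0 = s q by rewrite !mxE /y (unsplitK (inr 0)).
have yc q : rsubmx (coords y q) 0 1 = c q by rewrite !mxE /y (unsplitK (inr 1)).
pose VB : set 'rV[R]_n := cmap c0 @` (cdom c0 `&` U).
have oVB : open VB by exact: open_chart_img.
pose V : set 'rV[R]_(n + 2) := [set y | VB (lsubmx y)] `&` [set y | 0 < rsubmx y 0 1].
have oV : open V.
  apply: openI; first exact: open_lsubmx.
  apply: (@open_comp _ _ (fun y : 'rV[R]_(n + 2) => rsubmx y 0 1) [set r | 0 < r]); last exact: open_gt.
  move=> z _; apply: (@continuous_comp _ _ _ (fun y : 'rV[R]_(n + 2) => rsubmx y)
    (fun y : 'rV[R]_2 => y 0 1)); last exact: coord_continuous.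
  exact/differentiable_continuous/differentiable_rsubmx.
(* The angle depends only on the ratio of the last two coordinates, so [Psi] is defined on all of
   [V], including points off the unit circle. *)
pose Psi (z : 'rV[R]_(n + 2)) := Phi (cinv c0 (lsubmx z)) (cis (atan (rsubmx z 0 0 / rsubmx z 0 1))).
have yV q : N q -> V (coords y q).
  move=> [/NBE[cq xq Uq _] /= cq0]; split; last by rewrite /= yc.
  by rewrite /= yl xq; exists (proj q).
have yK q : N q -> Psi (coords y q) = q.
  move=> [/NBE[cq xq Uq chiq] /= cq0]; have [hq {2}<-] := psiK q Uq.
  rewrite /Psi yl xq cmapK // ys yc; congr Phi.
  move: cq0; rewrite sE cE chiq !mul1r => cq0; rewrite cis_atan //.
    by case: (psi q).
  exact/on_circleP.
have sPsi (f : cinf P) : smooth_on V (f \o Psi).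
  (* [Psi] factors through base coordinates and angle, the variables in which the smoothness of
     [Phi] is stated. *)
  move=> k; pose kap (z : 'rV[R]_(n + 2)) : 'rV[R]_(n + 1) :=
    row_mx (lsubmx z) (const_mx (atan (rsubmx z 0 0 / rsubmx z 0 1))).
  have := @Ck_comp _ _ _ k V [set z | VB (lsubmx z)]
    (fun z => f (Phi (cinv c0 (lsubmx z)) (cis (rsubmx z 0 0)))) kap oV (open_lsubmx oVB).
  move=> /(_ _ _ (sPhi f c0 ac0 k)) H.
  apply: (Ck_eq oV _ (H _ _)).
  - by move=> z _ /=; rewrite /kap row_mxKl row_mxKr mxE.
  - by move=> z [Vz _]; rewrite /= /kap row_mxKl.
  move=> j; rewrite -(splitK j); case: (fintype.split j) => i /=.
    apply: (Ck_eq oV _ (Ck_coord k V (lshift 2 i))) => z _.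
    by rewrite /kap row_mxEl mxE.
  have Ckr j' : Ck k V (fun z => rsubmx z 0 j').
    by apply: (Ck_eq oV _ (Ck_coord k V (rshift n j'))) => z _; rewrite mxE.
  have : Ck k V (@atan R \o (fun z => rsubmx z 0 0 / rsubmx z 0 1)).
    apply: Ck_atan => //; apply: (Ck_M oV (Ckr 0)); apply: Ck_V => // z [_ z1].
    by rewrite gt_eqF.
  by apply: (Ck_eq oV) => z _; rewrite /kap row_mxEr mxE.
exists s, c; split=> //.
(* Valid on all of [P] and not only near [p0]: the cutoff is pulled back from the base, hence
   constant on fibres, and outside its support both sides vanish. *)
- move=> q t; have hc := on_circle_cis t.
  rewrite !sE !cE proj_act //; have [Uq|nUq] := pselect (U (proj q)); last first.
    by rewrite chi0 ?mul0r ?addr0 // => /KU.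
  rewrite psiM //; case: (psi q) => a b /=.
  by rewrite mulrDr !mulrA [_ * b * _ + _]addrC.
- move=> u up us; apply: tangent_ext => f.
  rewrite (@retract_tangent _ _ _ _ y V N Psi oV oN yV yK sPsi p0 u f Np0).
  (* Differentiate c^2 + s^2 = 1 at [p0], where c = 1, s = 0 and u s = 0. *)
  have uc : u c = 0.
    have : u (c * c + s * s) = 0.
      apply: (@tangent_cst _ _ _ _ _ _ 1).
      have nN : \forall q \near p0, N q by exact: open_nbhs_nbhs.
      apply: filterS nN => q [/NBE[_ _ Uq chiq] _].
      change (c q * c q + s q * s q = 1).
      have [/on_circleP] := psiK q Uq.
      by rewrite sE cE chiq !mul1r !expr2.
    rewrite tangentD !tangentM c1 s0 us !mul1r mulr0 !addr0 -mulr2n => /eqP.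
    by rewrite mulrn_eq0 => /eqP.
  rewrite big1 // => j _; rewrite -(splitK j) /y unsplitK.
  case: (fintype.split j) => [i|k] /=.
    have -> : u (pullback proj (x i)) = dproj pb u (x i) by [].
    by rewrite up; exact: mulr0.
  by case: ifP => _; rewrite ?us ?uc mulr0.
move=> X; have [W [WE _]] := retract_frame oV oN Np0 yV yK sPsi.
(* [Psi] covers the inverse chart of the base, so the first n frame fields project to the coordinate
   fields there, and the coefficients of [X] can be pulled back. *)
pose XW : vfield P := \sum_i pullback proj (vapp X (x i)) *: W (lshift 2 i).
have XWE q f : XW q f = \sum_i X (proj q) (x i) * W (lshift 2 i) q f.
  by rewrite /XW; elim/big_ind2 : _ => // a1 b1 a2 b2 <- <-.
exists XW.
have nN : \forall q \near p0, N q by exact: open_nbhs_nbhs.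
near=> q; apply: tangent_ext => k.
change (XW q (pullback proj k) = X (proj q) k); rewrite XWE.
have Nq : N q by near: q.
have [/NBE[cq xq Uq _] cq0] := Nq.
have xV b : NB b -> (cmap c0 @` cdom c0) (coords x b).
  by move=> /NBE[cb xb _ _]; rewrite xb; exists b.
have xK b : NB b -> cinv c0 (coords x b) = b.
  by move=> /NBE[cb xb _ _]; rewrite xb cmapK.
rewrite (@retract_tangent _ _ _ _ x _ NB (cinv c0) (@cimg_open _ _ _ c0) oNB xV xK
  (fun f => chart_comp_smooth f ac0) _ (X (proj q)) k); last by case: Nq.
have WEq : forall j f, W j q f = 'D_(delta_mx 0 j) (f \o Psi) (coords y q) by near: q.
apply: eq_bigr => i _; rewrite mulrC; congr (_ * _); rewrite WEq.
rewrite -[in RHS]yl -derive_lsubmx; apply: near_eq_derive.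
have : \forall z \near coords y q, V z by apply: open_nbhs_nbhs; split=> //; exact: yV.
apply: filterS => z [[b [cb Ub] bz] _] /=; rewrite /Psi -bz cmapK // PhiK //.
exact: on_circle_cis.
Unshelve. all: by end_near.
Qed.

End bundle_retract.

(** * The fundamental field and horizontal lifts *)

Section fundamental_field.
Context {R : realType} {n : nat} {P : manifold R n.+1} {B : manifold R n}.
Variable pb : principal_circle_bundle P B.
Local Notation proj := (pb_proj pb).
Local Notation act := (pb_act pb).

Let orbit (f : cinf P) p (t : R) := f (act p (cis t)).

Let local_act (f : cinf P) c (y : 'rV[R]_(n.+1 + 1)) :=
  f (act (cinv c (lsubmx y)) (cis (rsubmx y 0 0))).

Let last_dir : 'rV[R]_(n.+1 + 1) := delta_mx 0 (rshift n.+1 0).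

Lemma orbit_line f c p : cdom c p ->
  orbit f p = (fun t : R => local_act f c (row_mx (cmap c p) 0 + t *: last_dir)).
Proof.
move=> cp; apply/funext => t; rewrite /orbit /local_act.
have -> : row_mx (cmap c p) 0 + t *: last_dir = row_mx (cmap c p) (const_mx t).
  apply/rowP => j; rewrite -(splitK j) !mxE unsplitK.
  case: (fintype.split j) => i /=; rewrite ?mxE ?eqxx /=.
    by rewrite eq_lrshift mulr0 addr0.
  by rewrite (ord1 i) eqxx add0r; exact: mulr1.
by rewrite row_mxKl row_mxKr mxE cmapK.
Qed.

Lemma local_act_smooth f c : @atlas R n.+1 P c ->
  smooth_on [set y : 'rV[R]_(n.+1 + 1) | (cmap c @` (cdom c `&` setT)) (lsubmx y)]
    (local_act f c).
Proof. by move=> ac; exact: pb_act_smooth. Qed.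

Lemma orbit_is_derive f c p : @atlas R n.+1 P c -> cdom c p -> forall t,
  is_derive t (1 : R) (orbit f p) ('D_last_dir (local_act f c) (row_mx (cmap c p) 0 + t *: last_dir)).
Proof.
move=> ac cp t; rewrite (orbit_line f cp).
apply/is_derive_line/derivableP.
have [_ /(_ (rshift n.+1 0))[H _]] := local_act_smooth f ac 1%N; apply: H.
rewrite /= (_ : lsubmx _ = cmap c p); first by exists p.
rewrite linearD linearZ /= row_mxKl (_ : lsubmx last_dir = 0) ?scaler0 ?addr0 //.
by apply/rowP => j; rewrite !mxE eq_lrshift.
Qed.

Lemma orbit_derivable f p t : derivable (orbit f p) t 1.
Proof. by have [c ac cp] := atlas_cover p; have [] := orbit_is_derive f ac cp t. Qed.

Lemma orbit0 f p : orbit f p 0 = f p.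
Proof. by rewrite /orbit cis0 pb_act1. Qed.

Lemma fundamental_derivation p : is_derivation p (fun f => 'D_1 (orbit f p) 0).
Proof.
split=> [a f g|f g].
  have -> : orbit (a *: f + g) p = (a \*: orbit f p) + orbit g p by [].
  rewrite deriveD; [|by apply: derivableZ; exact: orbit_derivable|exact: orbit_derivable].
  by rewrite deriveZ //; exact: orbit_derivable.
have -> : orbit (f * g) p = orbit f p * orbit g p by [].
by rewrite deriveM; [rewrite !orbit0|exact: orbit_derivable|exact: orbit_derivable].
Qed.

(** In a chart this is the last partial derivative of the local expression of the action, restricted
    to the slice of angle 0. *)
Lemma fundamental_smooth f :
  (fun p => mk_tangent (fundamental_derivation p) f) \in smooth_pred P.
Proof.
apply/smooth_predP => c ac k.
have oU : open (cmap c @` (cdom c `&` setT)) by apply: open_chart_img; exact: openT.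
have Cd : Ck k [set y : 'rV[R]_(n.+1 + 1) | (cmap c @` (cdom c `&` setT)) (lsubmx y)]
    ('D_last_dir (local_act f c)).
  by have [_ /(_ (rshift n.+1 0))[_]] := local_act_smooth f ac k.+1.
have := @Ck_comp _ _ _ k _ _ _ (fun y : 'rV[R]_n.+1 => row_mx y (0 : 'rV[R]_1)) oU (open_lsubmx oU).
move=> /(_ _ _ _ Cd) H; apply: (Ck_eq oU _ (H _ _)).
- move=> _ [p [cp _] <-] /=; rewrite cmapK //.
  by have [_ ->] := orbit_is_derive f ac cp 0; rewrite scale0r addr0.
- by move=> y Uy; rewrite /= row_mxKl.
move=> j; rewrite -(splitK j); case: (fintype.split j) => i /=.
  by apply: (Ck_eq oU _ (Ck_coord k _ i)) => y _; rewrite row_mxEl.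
by apply: (Ck_eq oU _ (Ck_cst k _ 0)) => y _; rewrite row_mxEr mxE.
Qed.

Definition fundamental_field : vfield P := VField fundamental_smooth.
Local Notation V := fundamental_field.

Lemma fundamental_fieldP p : is_fundamental_vector pb (V p).
Proof. by move=> f; apply: derivableP; exact: orbit_derivable. Qed.

Lemma fundamental_fieldE p (f : cinf P) (d : R) :
  is_derive (0 : R) (1 : R) (fun t : R => f (act p (cis t))) d -> V p f = d.
Proof. by case. Qed.

Lemma fundamental_vector_unique p (u : tangent p) : is_fundamental_vector pb u -> u = V p.
Proof. by move=> Fu; apply: tangent_ext => f; have [_ <-] := Fu f. Qed.

Lemma dproj_fundamental p : dproj pb (V p) = 0.
Proof.
apply: tangent_ext => k; apply: (fundamental_fieldE (f := pullback proj k)).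
have -> : (fun t : R => pullback proj k (act p (cis t))) = cst (k (proj p)).
  by apply/funext => t /=; rewrite proj_act //; exact: on_circle_cis.
exact: is_derive_cst.
Qed.

Lemma derive_rotation (a b : R) :
  is_derive (0 : R) (1 : R) (fun t : R => a * cos t + b * sin t) b.
Proof.
have -> : (fun t : R => a * cos t + b * sin t) = (a \*: (cos : R -> R)) + (b \*: (sin : R -> R)) by [].
apply: is_derive_eq; rewrite sin0 cos0 oppr0 scaler0 add0r; exact: mulr1.
Qed.

(** For the sine [s] and cosine [c] based at [p], V s = c p = 1. So u - (u s) V is vertical and
    kills [s], hence is zero. *)
Lemma vertical_tangent p (u : tangent p) : dproj pb u = 0 -> exists a, u = a *: V p.
Proof.
move=> up; have [s [c [s0 c1 sact inj _]]] := local_angle pb p; exists (u s).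
have Vs : V p s = 1.
  rewrite -c1; apply: fundamental_fieldE; under eq_fun do rewrite sact.
  exact: derive_rotation.
apply/eqP; rewrite -subr_eq0; apply/eqP; apply: inj.
  apply: tangent_ext => k.
  change (dproj pb u k - u s * dproj pb (V p) k = 0).
  by rewrite up dproj_fundamental; change (0 - u s * 0 = 0 :> R); rewrite mulr0 subr0.
by change (u s - u s * V p s = 0); rewrite Vs mulr1 subrr.
Qed.

Lemma dproj_linear p (a : R) (u w : tangent p) :
  dproj pb (a *: u + w) = a *: dproj pb u + dproj pb w.
Proof. exact: tangent_ext. Qed.

Lemma dprojZ p (a : R) (u : tangent p) : dproj pb (a *: u) = a *: dproj pb u.
Proof. exact: tangent_ext. Qed.

Section connection.
Variable A : forall p : P, tangent p -> R[i].
Hypothesis hA : is_connection_form pb A.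

Lemma connection_linear p (c : R) (u w : tangent p) :
  complex.Im (A (c *: u + w)) = c * complex.Im (A u) + complex.Im (A w).
Proof. by have [[_ [H _]] _ _] := hA; exact: H. Qed.

Lemma connection_im p (u : tangent p) : A u = (0 +i* complex.Im (A u))%C.
Proof. by have [[/(_ p u) + _] _ _] := hA; case: (A u) => x y /= ->. Qed.

Lemma connection_fundamental p : A (V p) = imag_unit.
Proof. by have [_ H _] := hA; apply: H; exact: fundamental_fieldP. Qed.

Lemma connectionZ p (c : R) (u : tangent p) :
  complex.Im (A (c *: u)) = c * complex.Im (A u).
Proof.
have A0 : complex.Im (A (0 : tangent p)) = 0.
  have := connection_linear 1 (0 : tangent p) (0 : tangent p).
  rewrite scaler0 addr0 mul1r => H.
  by apply: (addrI (complex.Im (A (0 : tangent p)))); rewrite addr0 -H.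
by have := connection_linear c u 0; rewrite A0 !addr0.
Qed.

Lemma connection_inj p (u : tangent p) : dproj pb u = 0 -> A u = 0 -> u = 0.
Proof.
move=> /vertical_tangent[c ->] AcV; have := connectionZ c (V p).
by rewrite AcV connection_fundamental /= mulr1 => <-; rewrite scale0r.
Qed.

(** The uniqueness behind horizontal lifts: equalities of tangent vectors of [P] are checked on the
    projection and on the connection form. *)
Lemma connection_inj2 p (u w : tangent p) : dproj pb u = dproj pb w -> A u = A w -> u = w.
Proof.
move=> uw Auw; apply/eqP; rewrite -subr_eq0 addrC -scaleN1r; apply/eqP.
apply: connection_inj; first by rewrite dproj_linear uw scaleN1r addNr.
by rewrite connection_im connection_linear Auw mulN1r addNr.
Qed.

Lemma unit_vertical_unique v : is_unit_vertical pb A v -> v = V.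
Proof.
move=> hv; apply: vfield_ext => p; have [vp Av] := hv p.
by apply: connection_inj2; rewrite ?dproj_fundamental ?connection_fundamental.
Qed.

Lemma unit_vertical_fundamental : is_unit_vertical pb A V.
Proof. by move=> p; rewrite dproj_fundamental connection_fundamental. Qed.

Lemma connection_form_smooth (X : vfield P) :
  (fun p => complex.Im (A (X p))) \in smooth_pred P.
Proof. by apply/smooth_predP; have [[_ [_ H]] _ _] := hA; exact: H. Qed.

Definition connection_value (X : vfield P) : cinf P := CInf (connection_form_smooth X).

(** Near each point some field projects to [X], and subtracting its vertical part makes it
    horizontal. Horizontal lifts of a vector being unique, the local choices agree where they
    overlap, and the field taking at p the value of the p-th choice is smooth without a partition of
    unity. *)
Lemma horizontal_lift_exists (X : vfield B) : exists Xs, is_horizontal_lift pb A X Xs.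
Proof.
have /(_ _)/cid-/all_sig[W WE] : forall p0 : P, exists W : vfield P,
    \forall q \near p0, dproj pb (W q) = X (proj q).
  by move=> p0; have [s [c [_ _ _ _ H]]] := local_angle pb p0; exact: H.
pose H p0 : vfield P := - connection_value (W p0) *: V + W p0.
have HE p0 : \forall q \near p0, A (H p0 q) = 0 /\ dproj pb (H p0 q) = X (proj q).
  apply: filterS (WE p0) => q Wq.
  change (A (- complex.Im (A (W p0 q)) *: V q + W p0 q) = 0 /\
    dproj pb (- complex.Im (A (W p0 q)) *: V q + W p0 q) = X (proj q)).
  rewrite connection_im connection_linear connection_fundamental /= mulr1 addNr.
  by rewrite dproj_linear dproj_fundamental scaler0 add0r.
have Hsm f : (fun p => H p p f) \in smooth_pred P.
  apply/smooth_predP; apply: smooth_locally_cinf => p0; exists (vapp (H p0) f).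
  apply: filterS (HE p0) => q [AH dH].
  have [AHq dHq] := nbhs_singleton (HE q).
  change (H q q f = H p0 q f); congr (tangent_val _ f).
  by apply: connection_inj2; rewrite ?AH ?dH.
by exists (VField Hsm) => p; exact: (nbhs_singleton (HE p)).
Qed.

Lemma vapp_pullback X Xs k : is_horizontal_lift pb A X Xs ->
  vapp Xs (pullback proj k) = pullback proj (vapp X k).
Proof.
move=> hX; apply: cinf_ext => p; have [_ dX] := hX p.
by change (dproj pb (Xs p) k = X (proj p) k); rewrite dX.
Qed.

Lemma vapp_fundamental_pullback k : vapp V (pullback proj k) = 0.
Proof.
apply: cinf_ext => p; change (dproj pb (V p) k = 0).
by rewrite dproj_fundamental.
Qed.

(** The right translate of a horizontal lift is horizontal with the same projection, hence is the
    lift at the translated point. The translated function is a parameter [f'], so that it can be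
    given in closed form, as a combination of [s] and [c] for instance. *)
Lemma horizontal_lift_invariant X Xs p t (f f' : cinf P) : is_horizontal_lift pb A X Xs ->
  (forall q, f' q = f (act q (cis t))) -> Xs (act p (cis t)) f = Xs p f'.
Proof.
move=> hX ff'; have ht := on_circle_cis t.
pose Rt := right_translation pb ht.
have [AX dX] := hX p; have [AXt dXt] := hX (act p (cis t)).
have : differential Rt (Xs p) = Xs (Rt p) :> tangent (Rt p).
  apply: connection_inj2; last first.
    by have [_ _ HA] := hA; rewrite AXt HA AX.
  rewrite dXt; apply: tangent_ext => k.
  transitivity (dproj pb (Xs p) k).
    change (Xs p (pullback Rt (pullback proj k)) = Xs p (pullback proj k)).
    congr (Xs p _); apply: cinf_ext => q.
    by change (k (proj (act q (cis t))) = k (proj q)); rewrite proj_act.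
  rewrite dX; change (vapp X k (proj p) = vapp X k (proj (act p (cis t)))).
  by rewrite proj_act.
move=> <-; change (Xs p (pullback Rt f) = Xs p f'); congr (Xs p _).
by apply: cinf_ext => q; rewrite ff'.
Qed.

(* On a fibre the invariant field Xs acts on the angle functions s and c with   *)
(* rotating coefficients, so that V (Xs s) = Xs c = Xs (V s).                  *)
Lemma lie_fundamental_horizontal X Xs : is_horizontal_lift pb A X Xs -> lie V Xs = 0.
Proof.
move=> hX; apply: vfield_ext => p.
have [s [c [s0 c1 sact inj _]]] := local_angle pb p.
have Vs : vapp V s = c.
  apply: cinf_ext => q; apply: fundamental_fieldE.
  under eq_fun do rewrite sact; exact: derive_rotation.
apply: inj.
  apply: tangent_ext => k.
  change (V p (vapp Xs (pullback proj k)) - Xs p (vapp V (pullback proj k)) = 0).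
  rewrite (vapp_pullback _ hX) vapp_fundamental_pullback tangent0 subr0.
  by change (vapp V (pullback proj (vapp X k)) p = 0); rewrite vapp_fundamental_pullback.
change (V p (vapp Xs s) - Xs p (vapp V s) = 0); rewrite Vs.
suff -> : V p (vapp Xs s) = Xs p c by rewrite subrr.
apply: fundamental_fieldE.
have -> : (fun t : R => vapp Xs s (act p (cis t))) = (fun t => Xs p s * cos t + Xs p c * sin t).
  apply/funext => t; rewrite /= (@horizontal_lift_invariant X Xs p t s (cos t *: s + sin t *: c)) //.
    by rewrite tangentD !tangentZ ![_ * Xs p _]mulrC.
  by move=> q; rewrite sact; change (cos t * s q + sin t * c q = s q * cos t + c q * sin t); ring.
exact: derive_rotation.
Qed.

End connection.
End fundamental_field.

(** * Brackets and Koszul's formula *)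

Section lie_and_metric.
Context {R : realType} {n : nat} {M : manifold R n}.
Implicit Types (X Y Z : vfield M) (f F : cinf M).

Lemma lieC X Y : lie X Y = - lie Y X.
Proof.
apply: vfield_ext => p; apply: tangent_ext => f.
change (X p (vapp Y f) - Y p (vapp X f) = - (Y p (vapp X f) - X p (vapp Y f))).
by rewrite opprB.
Qed.

Lemma lie_self X : lie X X = 0.
Proof.
apply: vfield_ext => p; apply: tangent_ext => f.
by change (X p (vapp X f) - X p (vapp X f) = 0); rewrite subrr.
Qed.

Lemma vappDl X Y f : vapp (X + Y) f = vapp X f + vapp Y f.
Proof. exact: cinf_ext. Qed.

Lemma vappZl f X k : vapp (f *: X) k = f * vapp X k.
Proof. exact: cinf_ext. Qed.

Lemma lieDr X Y Z : lie X (Y + Z) = lie X Y + lie X Z.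
Proof.
apply: vfield_ext => p; apply: tangent_ext => f.
change (X p (vapp (Y + Z) f) - (Y p (vapp X f) + Z p (vapp X f)) =
  X p (vapp Y f) - Y p (vapp X f) + (X p (vapp Z f) - Z p (vapp X f))).
rewrite vappDl tangentD; ring.
Qed.

Lemma lieZr X f Y : lie X (f *: Y) = vapp X f *: Y + f *: lie X Y.
Proof.
apply: vfield_ext => p; apply: tangent_ext => k.
change (X p (vapp (f *: Y) k) - f p * Y p (vapp X k) =
  X p f * Y p k + f p * (X p (vapp Y k) - Y p (vapp X k))).
rewrite vappZl tangentM /=; ring.
Qed.

Lemma lieDl X Y Z : lie (X + Y) Z = lie X Z + lie Y Z.
Proof. by rewrite lieC lieDr opprD -!lieC. Qed.

Lemma to_cinfE (F : cinf M) (f : M -> R) : (forall q, f q = F q) -> to_cinf f = F.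
Proof.
move=> fF; have -> : f = cinf_val F by apply/funext => q; exact: fF.
exact: (valKd (0 : cinf M) F).
Qed.

Section metric.
Variable g : forall p : M, tangent p -> tangent p -> R.
Hypothesis gsym : forall p (u w : tangent p), g u w = g w u.
Hypothesis glin : forall p (c : R) (u u' w : tangent p), g (c *: u + u') w = c * g u w + g u' w.

Lemma metricZDr p (c : R) (u w w' : tangent p) : g u (c *: w + w') = c * g u w + g u w'.
Proof. by rewrite !(gsym u) glin. Qed.

Lemma metricDl p (u u' w : tangent p) : g (u + u') w = g u w + g u' w.
Proof. by have := glin 1 u u' w; rewrite scale1r mul1r. Qed.

Lemma metric0l p (w : tangent p) : g 0 w = 0.
Proof. by apply: (addrI (g 0 w)); rewrite -metricDl !addr0. Qed.

Lemma metricZl p (c : R) (u w : tangent p) : g (c *: u) w = c * g u w.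
Proof. by have := glin c u 0 w; rewrite metric0l !addr0. Qed.

Lemma metricNl p (u w : tangent p) : g (- u) w = - g u w.
Proof. by rewrite -scaleN1r metricZl mulN1r. Qed.

Lemma metricBl p (u u' w : tangent p) : g (u - u') w = g u w - g u' w.
Proof. by rewrite metricDl metricNl. Qed.

Lemma metricZr p (c : R) (u w : tangent p) : g u (c *: w) = c * g u w.
Proof. by rewrite !(gsym u) metricZl. Qed.

Lemma metric0r p (u : tangent p) : g u 0 = 0.
Proof. by rewrite gsym metric0l. Qed.

(** Based on symmetry and bilinearity, so that it serves both [g] and the Kaluza-Klein metric. The
    products of fields are supplied as elements of [cinf M], since [to_cinf] is meaningful only on
    functions known to be smooth. *)
Lemma koszul D X Y Z (FYZ FXZ FXY : cinf M) p : is_levi_civita g D ->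
  (forall q, g (Y q) (Z q) = FYZ q) -> (forall q, g (X q) (Z q) = FXZ q) ->
  (forall q, g (X q) (Y q) = FXY q) ->
  2 * g (D X Y p) (Z p) = X p FYZ + Y p FXZ - Z p FXY
    + g (lie X Y p) (Z p) - g (lie Y Z p) (X p) - g (lie X Z p) (Y p).
Proof.
move=> [_ Dtor Dg] /to_cinfE EYZ /to_cinfE EXZ /to_cinfE EXY.
have liE (X' Y' : vfield M) : lie X' Y' p = D X' Y' p - D Y' X' p by rewrite -Dtor.
rewrite -EYZ -EXZ -EXY !Dg !liE !metricBl.
rewrite (gsym (Y p) (D X Z p)) (gsym (X p) (D Y Z p)) (gsym (X p) (D Z Y p)); ring.
Qed.

End metric.

Lemma levi_civita_tensorial (g : forall p : M, tangent p -> tangent p -> R) D X X' Y p :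
  is_levi_civita g D -> X p = X' p -> D X Y p = D X' Y p.
Proof.
move=> [[DL _ _] _ _] XX'.
have TL (f : cinf M) (X1 X2 : vfield M) : D (f *: X1 + X2) Y p = f p *: D X1 Y p + D X2 Y p.
  by rewrite DL.
have := @tensorial R n M p _ (fun X => D X Y p) TL (X - X').
have -> : (X - X') p = 0 by change (X p - X' p = 0); rewrite XX' subrr.
move=> /(_ erefl); have := TL (-1) X' X; rewrite scaleN1r addrC => -> .
rewrite (_ : (-1 : cinf M) p = -1) // scaleN1r addrC => /eqP.
by rewrite subr_eq0 => /eqP.
Qed.

Lemma pseudo_riemannian_form1 (g : forall p : M, tangent p -> tangent p -> R) X :
  is_pseudo_riemannian g -> is_form1 (fun p u => g p (X p) u).
Proof.
move=> [gl gs _ gsm]; split=> [p c u w|Y]; last exact: gsm.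
by rewrite metricZDr.
Qed.

End lie_and_metric.

(** * Adding a multiple of a form of the base to a connection form *)

Section twisting.
Context {R : realType} {n : nat} {P : manifold R n.+1} {B : manifold R n}.
Variable pb : principal_circle_bundle P B.
Local Notation proj := (pb_proj pb).
Local Notation act := (pb_act pb).
Local Notation V := (fundamental_field pb).

Lemma lie_pullback (X Y : vfield B) (Xs Ys : vfield P) p : (forall q, dproj pb (Xs q) = X (proj q)) ->
  (forall q, dproj pb (Ys q) = Y (proj q)) ->
  dproj pb (lie Xs Ys p) = lie X Y (proj p).
Proof.
have vE (Z : vfield B) (Zs : vfield P) k : (forall q, dproj pb (Zs q) = Z (proj q)) ->
    vapp Zs (pullback proj k) = pullback proj (vapp Z k).
  move=> ZE; apply: cinf_ext => q.
  by change (dproj pb (Zs q) k = Z (proj q) k); rewrite ZE.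
move=> XE YE; apply: tangent_ext => k.
change (Xs p (vapp Ys (pullback proj k)) - Ys p (vapp Xs (pullback proj k)) =
  X (proj p) (vapp Y k) - Y (proj p) (vapp X k)).
rewrite (vE Y) // (vE X) //.
change (dproj pb (Xs p) (vapp Y k) - dproj pb (Ys p) (vapp X k) =
  X (proj p) (vapp Y k) - Y (proj p) (vapp X k)).
by rewrite XE YE.
Qed.

(** Smoothness must hold on every field of [P], projectable or not; the projected vector is expanded
    in a local frame of the base, with coefficients X(x_i o proj). *)
Lemma pullback_form1 (eta : forall b : B, tangent b -> R) : is_form1 eta ->
  is_form1 (fun p u => eta (proj p) (dproj pb u)).
Proof.
move=> [etaL etaS]; split=> [p c u w|X]; first by rewrite dproj_linear etaL.
have eta0 b : eta b 0 = 0.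
  have := etaL b 1 0 0; rewrite scaler0 addr0 mul1r => H.
  by apply: (addrI (eta b 0)); rewrite addr0 -H.
apply: smooth_locally_cinf => p0.
have [x [E xE]] := local_frame (proj p0).
pose etaE i : cinf B := CInf (introT (smooth_predP _) (etaS (E i))).
exists (\sum_i vapp X (pullback proj (x i)) * pullback proj (etaE i)).
have xE' : \forall q \near p0, forall u : tangent (proj q),
    u = \sum_i u (x i) *: E i (proj q).
  exact: (@bundle_proj_continuous _ _ _ _ pb p0 _ xE).
apply: filterS xE' => q Hq; rewrite (Hq (dproj pb (X q))).
have etaS' (r : seq 'I_n) (c : 'I_n -> R) : eta (proj q) (\sum_(i <- r) c i *: E i (proj q)) =
    \sum_(i <- r) c i * eta (proj q) (E i (proj q)).
  elim: r => [|i r IH]; first by rewrite !big_nil.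
  by rewrite !big_cons etaL IH.
by rewrite etaS'; elim/big_ind2 : _ => // a1 b1 a2 b2 -> ->.
Qed.

(** Tangent spaces at provably equal points, such as the projections of [p] and of its translate,
    are distinct types; vectors in them are compared through their action on functions. *)
Lemma form_transport (eta : forall b : B, tangent b -> R) b b' (u : tangent b) (u' : tangent b') :
  b = b' -> (forall k, u k = u' k) -> eta b u = eta b' u'.
Proof. by move=> bb'; case: _ / bb' u' => u' /tangent_ext ->. Qed.

Section twist.
Variables (A A' : forall p : P, tangent p -> R[i]).
Variables (eta : forall b : B, tangent b -> R) (e : cinf P).
Hypothesis hA : is_connection_form pb A.
Hypothesis heta : is_form1 eta.
Hypothesis e_act : forall p z, on_circle z -> e (act p z) = e p.
Hypothesis A'E : forall p (u : tangent p),
  A' u = A u + (0 +i* (e p * eta (dproj pb u)))%C.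

(** The pulled-back form vanishes on vertical vectors and, like [e], is invariant under the action,
    so normalisation and invariance of [A] survive. *)
Lemma twist_connection_form : is_connection_form pb A'.
Proof.
have [etaPL etaPS] := pullback_form1 heta.
have A'im p (u : tangent p) : complex.Im (A' u) = complex.Im (A u) + e p * eta (dproj pb u).
  by rewrite A'E; case: (A u).
split.
- split=> [p u|]; first by rewrite A'E (connection_im hA) /= addr0.
  split=> [p c u w|X].
    rewrite !A'im (connection_linear hA) etaPL; ring.
  pose etaX : cinf P := CInf (introT (smooth_predP _) (etaPS X)).
  have := @cinf_smooth_fun _ _ _ (connection_value hA X + e * etaX).
  by congr smooth_fun; apply/funext => p; rewrite A'im.
- move=> p u /fundamental_vector_unique ->; rewrite A'E (connection_fundamental hA) dproj_fundamental.
  have [etaL _] := heta.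
  have -> : eta (0 : tangent (proj p)) = 0.
    have := etaL _ 1 (0 : tangent (proj p)) 0; rewrite scaler0 addr0 mul1r => H.
    by apply: (addrI (eta (0 : tangent (proj p)))); rewrite addr0 -H.
  by rewrite mulr0 addr0.
move=> z hz p u; rewrite !A'E; have [_ _ ->] := hA; congr (_ + (0 +i* _)%C).
rewrite [e _](e_act p hz); congr (_ * _); apply: form_transport; first exact: proj_act.
move=> k; change (u (pullback (right_translation pb hz) (pullback proj k)) = u (pullback proj k)).
congr (u _); apply: cinf_ext => q.
by change (k (proj (act q z)) = k (proj q)); rewrite proj_act.
Qed.

Hypothesis e_cst : forall p (u : tangent p), u e = 0.

(** The new lift of Z is Zs + al Z V with al Z = - e eta(Z). Since V commutes with the old lifts and
    kills every al Z, the bracket gains only the vertical term (Xs(al Y) - Ys(al X)) V. Together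
    with the contribution e eta([X, Y]) of [A'] on the old bracket, this is - e d eta(X, Y). *)
Lemma twist_lie X Y Xs Ys Xs' Ys' p :
  is_horizontal_lift pb A X Xs -> is_horizontal_lift pb A Y Ys ->
  is_horizontal_lift pb A' X Xs' -> is_horizontal_lift pb A' Y Ys' ->
  complex.Im (A' (lie Xs' Ys' p)) =
  complex.Im (A (lie Xs Ys p)) - e p * ext_deriv eta X Y (proj p).
Proof.
have [etaL etaS] := heta.
pose etaf Z : cinf B := CInf (introT (smooth_predP _) (etaS Z)).
pose al Z : cinf P := - (e * pullback proj (etaf Z)).
have lift Z Zs Zs' : is_horizontal_lift pb A Z Zs -> is_horizontal_lift pb A' Z Zs' ->
    Zs' = Zs + al Z *: V.
  move=> hZ hZ'; apply: vfield_ext => q; have [AZ dZ] := hZ q; have [AZ' dZ'] := hZ' q.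
  have E : (Zs + al Z *: V) q = - (e q * eta (Z (proj q))) *: V q + Zs q.
    exact: addrC.
  apply: (connection_inj2 twist_connection_form).
    by rewrite E dproj_linear dproj_fundamental scaler0 add0r dZ.
  rewrite AZ' E A'E (connection_im hA) (connection_linear hA) AZ (connection_fundamental hA).
  rewrite dproj_linear dproj_fundamental scaler0 add0r dZ /= addr0 mulr1.
  by apply/eqP; rewrite eq_complex /= addr0 addNr !eqxx.
move=> hX hY hX' hY'.
have val Z Zs k : is_horizontal_lift pb A Z Zs -> vapp Zs (al k) = - (e * pullback proj (vapp Z (etaf k))).
  move=> hZ; apply: cinf_ext => q; rewrite /al.
  change (Zs q (- (e * pullback proj (etaf k))) = - (e q * (Z (proj q) (etaf k)))).
  rewrite tangentN tangentM e_cst mulr0 addr0; congr (- (_ * _)).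
  by have [_ <-] := hZ q.
have vaV k : vapp V (al k) = 0.
  apply: cinf_ext => q; rewrite /al.
  change (V q (- (e * pullback proj (etaf k))) = 0).
  rewrite tangentN tangentM e_cst mulr0 addr0.
  have -> : V q (pullback proj (etaf k)) = dproj pb (V q) (etaf k) by [].
  by rewrite dproj_fundamental; change (- (e q * 0) = 0 :> R); rewrite mulr0 oppr0.
rewrite (lift _ _ _ hX hX') (lift _ _ _ hY hY').
have -> : lie (Xs + al X *: V) (Ys + al Y *: V) =
    (vapp Xs (al Y) - vapp Ys (al X)) *: V + lie Xs Ys.
  have VX : lie Xs V = 0 by rewrite lieC (lie_fundamental_horizontal hA hX) oppr0.
  have VY : lie Ys V = 0 by rewrite lieC (lie_fundamental_horizontal hA hY) oppr0.
  have E1 : lie Xs (al Y *: V) = vapp Xs (al Y) *: V.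
    by rewrite lieZr VX scaler0 addr0.
  have E2 : lie (al X *: V) Ys = - (vapp Ys (al X) *: V).
    by rewrite lieC lieZr VY scaler0 addr0.
  have E3 : lie (al X *: V) (al Y *: V) = 0.
    rewrite lieZr lieC lieZr lie_self scaler0 addr0 vaV scale0r oppr0 scaler0 addr0.
    by rewrite vappZl vaV mulr0 scale0r.
  by rewrite lieDl !lieDr E1 E2 E3 addr0 scalerBl [RHS]addrC addrA.
rewrite [X in complex.Im (A' X)](_ : _ = (vapp Xs (al Y) p - vapp Ys (al X) p) *: V p + lie Xs Ys p) //.
rewrite (connection_linear twist_connection_form) (connection_fundamental twist_connection_form).
have -> : vapp Xs (al Y) p = - (e p * X (proj p) (etaf Y)) by rewrite (val _ _ _ hX).
have -> : vapp Ys (al X) p = - (e p * Y (proj p) (etaf X)) by rewrite (val _ _ _ hY).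
rewrite A'E.
have -> : dproj pb (lie Xs Ys p) = lie X Y (proj p).
  by apply: lie_pullback => q; [have [] := hX q|have [] := hY q].
have etaE (Z : vfield B) : to_cinf (fun q => eta (Z q)) = etaf Z by exact: to_cinfE.
rewrite /ext_deriv !etaE.
case: (A (lie Xs Ys p)) => a1 a2 /=.
ring.
Qed.

End twist.
End twisting.

(** * The Kaluza-Klein metric *)

Section kaluza_klein_geometry.
Context {R : realType} {n : nat} {P : manifold R n.+1} {B : manifold R n}.
Variable pb : principal_circle_bundle P B.
Local Notation proj := (pb_proj pb).
Local Notation act := (pb_act pb).
Local Notation V := (fundamental_field pb).
Variable g : forall b : B, tangent b -> tangent b -> R.
Hypothesis hg : is_pseudo_riemannian g.
Implicit Types (X Y Z : vfield B) (Xs Ys Zs : vfield P) (k : cinf B) (b : B) (p : P).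

Definition metric_value (X Y : vfield B) : cinf B :=
  CInf (introT (smooth_predP _) (let: And4 _ _ _ H := hg in H X Y)).

Let gsym b (u w : tangent b) : g u w = g w u.
Proof. by case: hg. Qed.

Let glin b (c : R) (u u' w : tangent b) : g (c *: u + u') w = c * g u w + g u' w.
Proof. by case: hg. Qed.

Lemma metric_nondegenerate b (u : tangent b) :
  (forall Z : vfield B, g u (Z b) = 0) -> u = 0.
Proof.
move=> uZ; have [_ _ H _] := hg; apply: H => w.
by have [Z <-] := tangent_vfield w.
Qed.

Section levi_civita.
Variable xi : vfield B.

(** The Lie derivative (L_xi g)(Y, Z) at b. *)
Definition killing_defect (Y Z : vfield B) b : R :=
  xi b (metric_value Y Z) - g (lie xi Y b) (Z b) - g (Y b) (lie xi Z b).

Let eta b (u : tangent b) := g (xi b) u.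

Lemma killing_defectP : is_killing g xi <-> forall Y Z b, killing_defect Y Z b = 0.
Proof.
rewrite /killing_defect; have E (Y Z : vfield B) : to_cinf (fun q => g (Y q) (Z q)) = metric_value Y Z by exact: to_cinfE.
split=> H Y Z b; first by rewrite -E H; ring.
by rewrite E; apply/eqP; rewrite -subr_eq0 opprD addrA H.
Qed.

Lemma killing_defectC Y Z b : killing_defect Y Z b = killing_defect Z Y b.
Proof.
rewrite /killing_defect (_ : metric_value Y Z = metric_value Z Y); last first.
  by apply: cinf_ext => q /=; exact: gsym.
rewrite (gsym (lie xi Y b)) (gsym (Y b)); ring.
Qed.

Lemma ext_derivE Y Z b : ext_deriv eta Y Z b =
  Y b (metric_value xi Z) - Z b (metric_value xi Y) - g (xi b) (lie Y Z b).
Proof.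
rewrite /ext_deriv.
have E (T : vfield B) : to_cinf (fun q => eta (T q)) = metric_value xi T by exact: to_cinfE.
by rewrite !E.
Qed.

Lemma ext_derivC Y Z b : ext_deriv eta Y Z b = - ext_deriv eta Z Y b.
Proof.
rewrite !ext_derivE (lieC Z Y).
rewrite [X in _ = - (_ - g _ X)](_ : _ = - lie Y Z b) // (gsym _ (- _)) (metricNl glin) (gsym (xi b)); ring.
Qed.

(** Koszul's formula splits the covariant derivative of xi into its antisymmetric and symmetric
    parts. For a Killing field it turns the claim on [phi] into one on d eta. *)
Lemma levi_civita_covariant nabla Y Z b : is_levi_civita g nabla ->
  2 * g (nabla Y xi b) (Z b) = ext_deriv eta Y Z b + killing_defect Y Z b.
Proof.
move=> hn; rewrite (@koszul _ _ _ g gsym glin nabla Y xi Z (metric_value xi Z)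
  (metric_value Y Z) (metric_value Y xi) b hn) //.
rewrite ext_derivE /killing_defect (_ : metric_value Y xi = metric_value xi Y); last first.
  by apply: cinf_ext => q /=; exact: gsym.
rewrite (lieC Y xi) [X in g X (Z b)](_ : _ = - lie xi Y b) // (metricNl glin).
rewrite (gsym (lie Y Z b)) (gsym (lie xi Z b)); ring.
Qed.

Hypothesis sigma_const : exists sigma, forall b, g (xi b) (xi b) = sigma.

(** As g(xi, xi) is constant and [xi, xi] = 0, d eta(xi, Z) equals (L_xi g)(xi, Z). *)
Lemma killing_ext_deriv Z b : (forall Y Z b, killing_defect Y Z b = 0) ->
  ext_deriv eta xi Z b = 0.
Proof.
move=> K; have := K xi Z b; rewrite /killing_defect lie_self.
rewrite [X in _ - X - _](_ : _ = 0); last exact: (metric0l glin).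
have [sigma xiE] := sigma_const; rewrite subr0 ext_derivE => H.
have -> : Z b (metric_value xi xi) = 0.
  by apply: (@tangent_cst _ _ _ _ _ _ sigma); apply: nearW => q; exact: xiE.
by rewrite subr0.
Qed.

End levi_civita.

Section connection_metric.
Variables (sigma : R) (A : forall p : P, tangent p -> R[i]).
Hypothesis hsigma : sigma = 1 \/ sigma = -1.
Hypothesis hA : is_connection_form pb A.

Local Notation kk := (kaluza_klein pb sigma g A).
Local Notation a u := (complex.Im (A u)).

(** The minus sign is the square of i: [V] has square - sigma, opposite to that of xi, which is why
    their sums can be light-like. *)
Lemma kaluza_kleinE p (u w : tangent p) :
  kk u w = g (dproj pb u) (dproj pb w) - sigma * (a u * a w).
Proof.
rewrite /kaluza_klein (connection_im hA u) (connection_im hA w) /=.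
by rewrite mul0r sub0r mulrN.
Qed.

Lemma kaluza_klein_sym p (u w : tangent p) : kk u w = kk w u.
Proof. by rewrite !kaluza_kleinE gsym [a u * _]mulrC. Qed.

Lemma kaluza_klein_lin p (c : R) (u u' w : tangent p) : kk (c *: u + u') w = c * kk u w + kk u' w.
Proof. rewrite !kaluza_kleinE dproj_linear glin (connection_linear hA); ring. Qed.

Lemma sigma2 : sigma * sigma = 1.
Proof. by case: hsigma => ->; rewrite ?mulr1 // mulrNN mulr1. Qed.

Lemma fundamental_im p : a (V p) = 1.
Proof. by rewrite (connection_fundamental hA). Qed.

Lemma kaluza_klein_fundamental p (u : tangent p) : kk u (V p) = - (sigma * a u).
Proof.
by rewrite kaluza_kleinE dproj_fundamental (metric0r gsym glin) fundamental_im mulr1 sub0r.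
Qed.

Lemma kaluza_klein_horizontal Z Zs p (u : tangent p) : is_horizontal_lift pb A Z Zs ->
  kk u (Zs p) = g (dproj pb u) (Z (proj p)).
Proof. by move=> hZ; have [AZ dZ] := hZ p; rewrite kaluza_kleinE AZ dZ /= !mulr0 subr0. Qed.

Lemma kaluza_klein_nondegenerate p (u : tangent p) :
  (forall Z Zs, is_horizontal_lift pb A Z Zs -> kk u (Zs p) = 0) -> kk u (V p) = 0 -> u = 0.
Proof.
move=> uZ uV; apply: (connection_inj hA).
  apply: metric_nondegenerate => Z.
  have [Zs hZ] := horizontal_lift_exists hA Z.
  by rewrite -(kaluza_klein_horizontal u hZ) (uZ _ _ hZ).
have s0 : sigma != 0 by apply/eqP => s0; have := sigma2; rewrite s0 mul0r => /eqP; rewrite eq_sym oner_eq0.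
move: uV; rewrite kaluza_klein_fundamental => /eqP.
by rewrite oppr_eq0 mulf_eq0 (negbTE s0) /= (connection_im hA) => /eqP ->.
Qed.

Lemma tangent_split p (u : tangent p) : exists Y Ys c,
  is_horizontal_lift pb A Y Ys /\ u = c *: V p + Ys p.
Proof.
have [Y Yp] := tangent_vfield (dproj pb u).
have [Ys hY] := horizontal_lift_exists hA Y.
exists Y, Ys, (a u); split=> //; have [AY dY] := hY p.
apply: (connection_inj2 hA).
  by rewrite dproj_linear dproj_fundamental scaler0 add0r dY Yp.
rewrite [in RHS](connection_im hA) (connection_linear hA) fundamental_im AY.
by rewrite mulr1 addr0 -(connection_im hA).
Qed.

(** * Koszul's formula for [xis + eps *: V], with [eps] annihilated by all tangent vectors *)

Section special_field.
Variables (xi : vfield B) (xis : vfield P) (D : vfield P -> vfield P -> vfield P) (eps : cinf P).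
Hypothesis hxi : forall b, g (xi b) (xi b) = sigma.
Hypothesis hxis : is_horizontal_lift pb A xi xis.
Hypothesis hD : is_levi_civita kk D.
Hypothesis eps_cst : forall p (u : tangent p), u eps = 0.
Hypothesis eps2 : forall p, eps p * eps p = 1.

Local Notation W := (xis + eps *: V).
Local Notation eta := (fun b u => g (xi b) u).

Lemma dproj_special_field p : dproj pb (W p) = xi (proj p).
Proof.
have -> : W p = eps p *: V p + xis p by exact: addrC.
by rewrite dproj_linear dproj_fundamental scaler0 add0r; case: (hxis p).
Qed.

Lemma special_field_im p : a (W p) = eps p.
Proof.
have -> : W p = eps p *: V p + xis p by exact: addrC.
by rewrite (connection_linear hA) fundamental_im mulr1; have [-> _] := hxis p; rewrite addr0.
Qed.

Lemma special_lightlike : is_lightlike kk W.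
Proof. by move=> p; rewrite kaluza_kleinE dproj_special_field special_field_im eps2 hxi mulr1 subrr. Qed.

Let lieW Y Ys : is_horizontal_lift pb A Y Ys -> lie Ys W = lie Ys xis.
Proof.
move=> hY; rewrite lieDr lieZr (lieC Ys V) (lie_fundamental_horizontal hA hY) oppr0 scaler0 addr0.
have -> : vapp Ys eps = 0 by apply: cinf_ext => q; exact: eps_cst.
by rewrite scale0r addr0.
Qed.

Let lieVW : lie V W = 0.
Proof.
rewrite lieDr lieZr (lie_fundamental_horizontal hA hxis) lie_self scaler0 addr0 add0r.
have -> : vapp V eps = 0 by apply: cinf_ext => q; exact: eps_cst.
by rewrite scale0r.
Qed.

Let lieWV : lie W V = 0.
Proof. by rewrite lieC lieVW oppr0. Qed.

Let lieYV Y Ys : is_horizontal_lift pb A Y Ys -> lie Ys V = 0.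
Proof. by move=> hY; rewrite lieC (lie_fundamental_horizontal hA hY) oppr0. Qed.

Let dlie Y Ys Z Zs p : is_horizontal_lift pb A Y Ys -> is_horizontal_lift pb A Z Zs ->
  dproj pb (lie Ys Zs p) = lie Y Z (proj p).
Proof. by move=> hY hZ; apply: lie_pullback => q; [have [] := hY q|have [] := hZ q]. Qed.

Let pull Y Ys k p : is_horizontal_lift pb A Y Ys -> Ys p (pullback proj k) = Y (proj p) k.
Proof. by move=> hY; have [_ <-] := hY p. Qed.

Let pullV k p : V p (pullback proj k) = 0.
Proof. by have -> : V p (pullback proj k) = dproj pb (V p) k by []; rewrite dproj_fundamental. Qed.

Let pullW k p : W p (pullback proj k) = xi (proj p) k.
Proof. by have -> : W p (pullback proj k) = dproj pb (W p) k by []; rewrite dproj_special_field. Qed.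

Let FWV : cinf P := (- sigma) *: eps.

Let FWVE q : kk (W q) (V q) = FWV q.
Proof. by rewrite kaluza_klein_fundamental special_field_im -mulNr. Qed.

Let dFWV p (u : tangent p) : u FWV = 0.
Proof. by rewrite tangentZ eps_cst mulr0. Qed.

Let kWZ Z Zs q : is_horizontal_lift pb A Z Zs -> kk (W q) (Zs q) = pullback proj (metric_value xi Z) q.
Proof. by move=> hZ; rewrite (kaluza_klein_horizontal _ hZ) dproj_special_field. Qed.

Let kYZ Y Ys Z Zs q : is_horizontal_lift pb A Y Ys -> is_horizontal_lift pb A Z Zs ->
  kk (Ys q) (Zs q) = pullback proj (metric_value Y Z) q.
Proof. by move=> hY hZ; rewrite (kaluza_klein_horizontal _ hZ); have [_ ->] := hY q. Qed.

Let kVZ Z Zs q : is_horizontal_lift pb A Z Zs -> kk (V q) (Zs q) = (0 : cinf P) q.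
Proof. by move=> hZ; rewrite (kaluza_klein_horizontal _ hZ) dproj_fundamental (metric0l glin). Qed.

Let kks := kaluza_klein_sym.
Let kkl := kaluza_klein_lin.

Let kk0 p (u : tangent p) : kk ((0 : vfield P) p) u = 0.
Proof. exact: (metric0l kkl). Qed.

(** Brackets of lifts with [W] are brackets with [xis], because V commutes with lifts and [eps] has
    zero derivative. The vertical part of [W] enters only through the product of [Ys, Zs] with
    [W]. *)
Lemma covariant_horizontal_horizontal Y Ys Z Zs p :
  is_horizontal_lift pb A Y Ys -> is_horizontal_lift pb A Z Zs ->
  2 * kk (D Ys W p) (Zs p) = ext_deriv eta Y Z (proj p)
    + killing_defect xi Y Z (proj p) + sigma * (eps p * a (lie Ys Zs p)).
Proof.
move=> hY hZ.
rewrite (@koszul _ _ _ _ kks kkl D Ys W Zs (pullback proj (metric_value xi Z))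
  (pullback proj (metric_value Y Z)) (pullback proj (metric_value xi Y)) p hD); last 3 first.
- by move=> q; exact: kWZ.
- by move=> q; exact: kYZ.
- by move=> q; rewrite kks; exact: kWZ.
rewrite (pull _ _ hY) pullW (pull _ _ hZ) (lieW hY).
rewrite (kaluza_klein_horizontal _ hZ) (dlie _ hY hxis).
rewrite (lieC W Zs) (lieW hZ) -(lieC xis Zs) (kaluza_klein_horizontal _ hY) (dlie _ hxis hZ).
rewrite kaluza_kleinE (dlie _ hY hZ) dproj_special_field special_field_im ext_derivE /killing_defect.
rewrite (lieC Y xi) [X in g X (Z (proj p))](_ : _ = - lie xi Y (proj p)) // (metricNl glin).
rewrite (gsym (lie Y Z (proj p))) (gsym (lie xi Z (proj p))); ring.
Qed.

(** The derivative terms vanish: the product of [W] and V has zero derivative, lifts are orthogonal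
    to V, and the product of [W] and [Ys] comes from the base. Only the bracket of [Ys] and [W]
    remains. *)
Lemma covariant_horizontal_vertical Y Ys p : is_horizontal_lift pb A Y Ys ->
  2 * kk (D Ys W p) (V p) = - (sigma * a (lie Ys xis p)).
Proof.
move=> hY.
rewrite (@koszul _ _ _ _ kks kkl D Ys W V FWV 0
  (pullback proj (metric_value xi Y)) p hD); last 3 first.
- by move=> q; exact: FWVE.
- by move=> q; rewrite kks; exact: kVZ hY.
- by move=> q; rewrite kks; exact: kWZ.
rewrite dFWV tangent0 pullV (lieW hY) kaluza_klein_fundamental.
by rewrite lieWV kk0 (lieYV hY) kk0 !subr0 !add0r.
Qed.

Lemma covariant_vertical_horizontal Z Zs p : is_horizontal_lift pb A Z Zs ->
  2 * kk (D V W p) (Zs p) = sigma * a (lie xis Zs p).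
Proof.
move=> hZ.
rewrite (@koszul _ _ _ _ kks kkl D V W Zs (pullback proj (metric_value xi Z)) 0
  FWV p hD); last 3 first.
- by move=> q; exact: kWZ.
- by move=> q; exact: kVZ hZ.
- by move=> q; rewrite kks FWVE.
rewrite dFWV tangent0 pullV lieVW kk0 (lie_fundamental_horizontal hA hZ).
rewrite kk0 (lieC W Zs) (lieW hZ) -(lieC xis Zs) kaluza_klein_fundamental.
by rewrite !subr0 !add0r opprK.
Qed.

Lemma covariant_vertical_vertical p : 2 * kk (D V W p) (V p) = 0.
Proof.
rewrite (@koszul _ _ _ _ kks kkl D V W V FWV (cinf_cst P (- sigma)) FWV p hD); last 3 first.
- by move=> q; exact: FWVE.
- by move=> q; rewrite kaluza_klein_fundamental fundamental_im mulr1 cinf_cstE.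
- by move=> q; rewrite kks FWVE.
rewrite !dFWV (@tangent_cst _ _ _ _ _ _ (- sigma)); last by apply: nearW => q; rewrite cinf_cstE.
rewrite lieVW lieWV lie_self !kk0; ring.
Qed.

Lemma parallel_of_split : (forall Y Ys p, is_horizontal_lift pb A Y Ys -> D Ys W p = 0) ->
  (forall p, D V W p = 0) -> is_parallel D W.
Proof.
move=> DY DV X; apply: vfield_ext => p.
have [Y [Ys [c [hY Xp]]]] := tangent_split (X p).
have Xp' : X p = (cinf_cst P c *: V + Ys) p.
  by rewrite Xp; change (c *: V p + Ys p = cinf_cst P c p *: V p + Ys p); rewrite cinf_cstE.
rewrite (levi_civita_tensorial W hD Xp').
have [[DL _ _] _ _] := hD; rewrite DL.
by change (cinf_cst P c p *: D V W p + D Ys W p = 0); rewrite DV (DY _ _ _ hY) scaler0 addr0.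
Qed.

End special_field.
End connection_metric.
End kaluza_klein_geometry.

Section vertically_constant.
Context {R : realType} {n : nat} {P : manifold R n.+1} {B : manifold R n}.
Variable pb : principal_circle_bundle P B.
Local Notation act := (pb_act pb).

(** By the group law, the derivative of [e] along an orbit at parameter s is V e at the point
    reached, hence 0; every point of the circle is some [cis t]. *)
Lemma vertically_constant (e : cinf P) : (forall p (u : tangent p), u e = 0) ->
  forall p z, on_circle z -> e (act p z) = e p.
Proof.
move=> e0 p z /on_circle_is_cis[t ->].
pose h (s : R) := e (act p (cis s)).
have dh (s : R) : is_derive s (1 : R) h 0.
  have [H1 H2] := @fundamental_fieldP _ _ _ _ pb (act p (cis s)) e.
  rewrite e0 in H2.
  have dk : is_derive (s - s) (1 : R) (fun r : R => e (act (act p (cis s)) (cis r))) 0.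
    by rewrite subrr; split.
  have ds : is_derive s (1 : R) (fun r : R => r - s) 1.
    by apply: is_derive_eq; rewrite subr0.
  have := @is_derive1_comp R _ (fun r : R => r - s) s _ _ dk ds.
  rewrite mul0r (_ : _ \o _ = h) //; apply/funext => r /=.
  rewrite /h -pb_actM; [|exact: on_circle_cis|exact: on_circle_cis].
  by rewrite -cisD addrC subrK.
have : h t = h 0 by exact: is_derive_0_is_cst.
by rewrite /h cis0 pb_act1.
Qed.

Lemma locally_constant_tangent (M : manifold R n.+1) (e : cinf M) :
  (forall p, \forall q \near p, e q = e p) -> forall p (u : tangent p), u e = 0.
Proof. by move=> el p u; apply: (tangent_cst u (el p)). Qed.

End vertically_constant.

Lemma imag_scaleE (R : realType) (s e y : R) :
  imag_unit * s%:C%C * e%:C%C * y%:C%C = (0 +i* (s * e * y))%C.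
Proof. by rewrite /imag_unit; apply/eqP; rewrite eq_complex /=; apply/andP; split; apply/eqP; ring. Qed.

Lemma imag_half (R : realType) : imag_unit / 2%:R = (0 +i* 2^-1)%C :> R[i].
Proof.
apply: (mulIf (x := 2%:R)); first by rewrite pnatr_eq0.
rewrite divfK ?pnatr_eq0 // -(rmorph_nat (real_complex R)).
by apply/eqP; rewrite eq_complex /= !mul0r !mulr0 subr0 add0r mulVf ?pnatr_eq0 // !eqxx.
Qed.

Lemma sign_cinf (R : realType) (n : nat) (M : manifold R n) (k : cinf M) :
  (forall p, k p != 0) -> exists2 e : cinf M,
    forall p, e p = Num.sg (k p) & forall p, \forall q \near p, e q = e p.
Proof.
move=> k0.
have kl (p : M) : \forall q \near p, Num.sg (k q) = Num.sg (k p).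
  have ck := @cinf_continuous _ _ _ k p.
  have [kp|kp|kp] := ltgtP (k p) 0; last by move: (k0 p); rewrite kp eqxx.
    have : \forall q \near p, k q < 0 by exact: (cvgr_lt _ ck).
    by apply: filterS => q kq; rewrite !ltr0_sg.
  have : \forall q \near p, 0 < k q by exact: (cvgr_gt _ ck).
  by apply: filterS => q kq; rewrite !gtr0_sg.
have sk : smooth_fun (fun p => Num.sg (k p)).
  apply: smooth_locally_cinf => p; exists (cinf_cst M (Num.sg (k p))).
  by apply: filterS (kl p) => q ->; rewrite cinf_cstE.
by exists (CInf (introT (smooth_predP _) sk)).
Qed.

Lemma flat_connection (R : realType) (n : nat) (P : manifold R n.+1) (B : manifold R n)
    (pb : principal_circle_bundle P B) A : is_connection_form pb A ->
  (forall X Y Xs Ys p, is_horizontal_lift pb A X Xs -> is_horizontal_lift pb A Y Ys ->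
    complex.Im (A p (lie Xs Ys p)) = 0) -> is_flat pb A.
Proof.
move=> hA A0; split.
  split=> [//|//|b c u u' w|b c u w w'|X Y]; rewrite ?mulr0 ?addr0 //.
  exact: smooth_fun_on_cst.
move=> X Y Xs Ys hX hY p; rewrite (connection_im hA) (A0 X Y) //.
by apply/eqP; rewrite eq_complex /= oppr0 !eqxx.
Qed.

(* The sign in Omega = i sigma eps d eta, and the matching signs relating A   *)
(* and A_0, are the ones forced by A(v) = i, Omega(X, Y) = - A([X^*, Y^*]),   *)
(* g(phi X, Y) = sigma (i / 2) Omega(X, Y) and phi = - eps nabla xi.          *)
Theorem proposition7 (R : realType) (n : nat) (B : manifold R n)
    (g : forall b : B, tangent b -> tangent b -> R)
    (hg : is_pseudo_riemannian g)
    (nabla : vfield B -> vfield B -> vfield B)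
    (hnabla : is_levi_civita g nabla)
    (sigma : R) (hsigma : sigma = 1 \/ sigma = -1)
    (P : manifold R n.+1) (pb : principal_circle_bundle P B) :
  (forall (A : forall p : P, tangent p -> R[i])
      (D : vfield P -> vfield P -> vfield P)
      (Om : forall b : B, tangent b -> tangent b -> R[i])
      (v : vfield P)
      (phi : forall b : B, tangent b -> tangent b)
      (xi : vfield B) (xis : vfield P) (f h : cinf P),
    is_connection_form pb A ->
    is_levi_civita (kaluza_klein pb sigma g A) D ->
    is_curvature_form pb A Om ->
    is_unit_vertical pb A v ->
    is_endomorphism_field phi ->
    (forall (b : B) (u w : tangent b),
       (g b (phi b u) w)%:C%C
       = sigma%:C%C * (imag_unit / 2%:R) * Om b u w) ->
    (forall b : B, g b (xi b) (xi b) = sigma) ->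
    is_horizontal_lift pb A xi xis ->
    is_lightlike (kaluza_klein pb sigma g A) (f *: xis + h *: v) ->
    is_recurrent D (f *: xis + h *: v) ->
    exists eps : cinf P,
      (forall p : P, eps p = Num.sg (f p * h p)) /\
      (forall p : P, eps p = 1 \/ eps p = -1) /\
      (forall p : P, \forall q \near p, eps q = eps p) /\
      is_killing g xi /\
      is_parallel D (xis + eps *: v) /\
      (forall b : B, phi b (xi b) = 0) /\
      (forall (b : B) (u : tangent b), Om b (xi b) u = 0) /\
      (forall (p : P) (X : vfield B),
         phi (pb_proj pb p) (X (pb_proj pb p))
         = - eps p *: nabla X xi (pb_proj pb p)) /\
      (forall (p : P) (X Y : vfield B),
         Om (pb_proj pb p) (X (pb_proj pb p)) (Y (pb_proj pb p))
         = imag_unit * sigma%:C%C * (eps p)%:C%C *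
           (ext_deriv (fun b u => g b (xi b) u) X Y (pb_proj pb p))%:C%C) /\
      is_connection_form pb
        (fun p u => A p u - imag_unit * sigma%:C%C * (eps p)%:C%C *
           (g (pb_proj pb p) (xi (pb_proj pb p)) (dproj pb u))%:C%C) /\
      is_flat pb
        (fun p u => A p u - imag_unit * sigma%:C%C * (eps p)%:C%C *
           (g (pb_proj pb p) (xi (pb_proj pb p)) (dproj pb u))%:C%C))
  /\
  (forall (xi : vfield B) (A0 A : forall p : P, tangent p -> R[i]) (eps : R),
    is_killing g xi ->
    (forall b : B, g b (xi b) (xi b) = sigma) ->
    is_connection_form pb A0 ->
    is_flat pb A0 ->
    eps = 1 \/ eps = -1 ->
    (forall (p : P) (u : tangent p),
       A p u = A0 p u + imag_unit * sigma%:C%C * eps%:C%C *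
         (g (pb_proj pb p) (xi (pb_proj pb p)) (dproj pb u))%:C%C) ->
    is_connection_form pb A /\
    exists (v xis : vfield P),
      is_unit_vertical pb A v /\
      is_horizontal_lift pb A xi xis /\
      is_lightlike (kaluza_klein pb sigma g A) (xis + (eps *: (1 : cinf P)) *: v) /\
      (forall D : vfield P -> vfield P -> vfield P,
         is_levi_civita (kaluza_klein pb sigma g A) D ->
         is_parallel D (xis + (eps *: (1 : cinf P)) *: v))).
Proof.
have s2 : sigma * sigma = 1 by case: hsigma => ->; rewrite ?mulr1 // mulrNN mulr1.
have s0 : sigma != 0 by case: hsigma => ->; rewrite ?oppr_eq0 oner_neq0.
have etaF (xi : vfield B) : is_form1 (fun b u => g b (xi b) u).
  exact: pseudo_riemannian_form1.
split.
  move=> A D Om v phi xi xis f h hA hD [_ OmE] /(unit_vertical_unique hA) -> _ phiE hxi hxis.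
  move=> hlight [R0 [om omL omE]].
  set V := fundamental_field pb in hlight R0 omE *.
  (* The square of the given field is sigma (f^2 - h^2). *)
  have fh2 q : f q ^+ 2 = h q ^+ 2.
    have := hlight q; rewrite (kaluza_kleinE _ _ hA).
    have -> : (f *: xis + h *: V) q = h q *: V q + f q *: xis q by exact: addrC.
    have [Ax dx] := hxis q.
    rewrite dproj_linear dproj_fundamental scaler0 add0r dprojZ dx.
    rewrite (connection_linear hA) (connectionZ hA) Ax (fundamental_im hA).
    have [gl gs _ _] := hg.
    rewrite (metricZl gl) (metricZr gs gl) hxi /= mulr0 addr0 mulr1 => H.
    apply/(mulfI s0)/eqP; rewrite -subr_eq0 -[X in _ == X]H; apply/eqP; ring.
  have f0 q : f q != 0.
    apply/eqP => fq; apply: (R0 q).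
    have hq : h q = 0 by apply/eqP; rewrite -sqrf_eq0 -fh2 fq expr0n eqxx.
    by change (f q *: xis q + h q *: V q = 0); rewrite fq hq !scale0r addr0.
  have h0 q : h q != 0 by rewrite -sqrf_eq0 -fh2 sqrf_eq0.
  have fh0 q : (f * h) q != 0 by exact: (mulf_neq0 (f0 q) (h0 q)).
  have [eps epsE epsL] := sign_cinf fh0.
  have eps1 q : eps q = 1 \/ eps q = -1.
    rewrite epsE; have := fh0 q; rewrite -sgr_eq0.
    by case: sgrP => _ //; [rewrite eqxx|left|right].
  have eps2 q : eps q * eps q = 1.
    by case: (eps1 q) => ->; rewrite ?mulr1 // mulrNN mulr1.
  have hE : h = eps * f.
    apply: cinf_ext => q; change (h q = eps q * f q); rewrite epsE.
    change (h q = Num.sg (f q * h q) * f q).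
    have /eqP := fh2 q; rewrite eqf_sqr => /orP[]/eqP ->.
      by rewrite gtr0_sg ?mul1r // -expr2 exprn_even_gt0 // h0.
    by rewrite ltr0_sg ?mulrNN ?mul1r // mulNr oppr_lt0 -expr2 exprn_even_gt0 // h0.
  have epsC := locally_constant_tangent epsL.
  set W := xis + eps *: V.
  have RE : f *: xis + h *: V = f *: W by rewrite scalerDr scalerA hE mulrC.
  rewrite RE in R0 omE.
  (* Since the recurrent field is f W, the relation X(f) W + f D_X W = omega(X) f W can be divided
     by f, which has no zero. *)
  have DW (X : vfield P) p : exists l, D X W p = l *: W p.
    have [[_ _ DZ] _ _] := hD.
    have := omE X p; rewrite DZ.
    change (X p f *: W p + f p *: D X W p = om p (X p) *: (f p *: W p) ->
      exists l, D X W p = l *: W p).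
    move=> H; exists ((f p)^-1 * (om p (X p) * f p - X p f)).
    by rewrite -scalerA scalerBl -scalerA -H addrC addKr scalerA mulVf // scale1r.
  have DW0 (X : vfield P) p : kaluza_klein pb sigma g A (D X W p) (V p) = 0 -> D X W p = 0.
    have [l ->] := DW X p; rewrite (metricZl (kaluza_klein_lin hg sigma hA)).
    rewrite (kaluza_klein_fundamental hg sigma hA) (special_field_im hA eps hxis) => /eqP.
    rewrite mulf_eq0 oppr_eq0 !mulf_eq0 (negbTE s0) /=.
    have -> : (eps p == 0) = false.
      by apply/eqP => e0; have := eps2 p; rewrite e0 mul0r => /eqP; rewrite eq_sym oner_eq0.
    by rewrite orbF => /eqP ->; rewrite scale0r.
  have two0 (x : R) : 2 * x = 0 -> x = 0.
    by move=> /eqP; rewrite mulf_eq0 pnatr_eq0 /= => /eqP.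
  have DVW p : D V W p = 0.
    by apply/DW0/two0; exact: (covariant_vertical_vertical hg hA hxis hD epsC).
  have Omxi Z Zs p : is_horizontal_lift pb A Z Zs -> complex.Im (A p (lie xis Zs p)) = 0.
    move=> hZ; have := covariant_vertical_horizontal hg hA hxis hD epsC p hZ.
    rewrite DVW (metric0l (kaluza_klein_lin hg sigma hA)) mulr0 => /eqP.
    by rewrite eq_sym mulf_eq0 (negbTE s0) => /eqP.
  have DYW Y Ys p : is_horizontal_lift pb A Y Ys -> D Ys W p = 0.
    move=> hY; apply/DW0/two0.
    rewrite (covariant_horizontal_vertical hg hA hxis hD epsC p hY).
    have -> : lie Ys xis p = (-1) *: lie xis Ys p by rewrite scaleN1r lieC.
    by rewrite (connectionZ hA) (Omxi _ _ _ hY) !mulr0 oppr0.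
  pose deta Y Z b := ext_deriv (fun b u => g b (xi b) u) Y Z b.
  have K1 Y Ys Z Zs p : is_horizontal_lift pb A Y Ys -> is_horizontal_lift pb A Z Zs ->
      deta Y Z (pb_proj pb p) + killing_defect hg xi Y Z (pb_proj pb p)
      + sigma * (eps p * complex.Im (A p (lie Ys Zs p))) = 0.
    move=> hY hZ; rewrite -(covariant_horizontal_horizontal hg hA hxis hD epsC p hY hZ).
    by rewrite (DYW _ _ _ hY) (metric0l (kaluza_klein_lin hg sigma hA)) mulr0.
  have Kill : forall Y Z b, killing_defect hg xi Y Z b = 0.
    move=> Y Z b; have [p <-] := proj_surj pb b.
    have [Ys hY] := horizontal_lift_exists hA Y.
    have [Zs hZ] := horizontal_lift_exists hA Z.
    have a_anti : complex.Im (A p (lie Zs Ys p)) = - complex.Im (A p (lie Ys Zs p)).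
      have -> : lie Zs Ys p = (-1) *: lie Ys Zs p by rewrite scaleN1r lieC.
      by rewrite (connectionZ hA) mulN1r.
    have := K1 _ _ _ _ p hY hZ; have := K1 _ _ _ _ p hZ hY.
    rewrite /deta (ext_derivC hg xi Z Y) (killing_defectC hg xi Z Y) a_anti => H1 H2.
    apply: two0; lra.
  have detaE Y Ys Z Zs p : is_horizontal_lift pb A Y Ys -> is_horizontal_lift pb A Z Zs ->
      complex.Im (A p (lie Ys Zs p)) = - (sigma * eps p * deta Y Z (pb_proj pb p)).
    move=> hY hZ; have := K1 _ _ _ _ p hY hZ; rewrite Kill addr0 => H.
    have E : sigma * (eps p * complex.Im (A p (lie Ys Zs p))) = - deta Y Z (pb_proj pb p).
      by apply/eqP; rewrite -addr_eq0 addrC H.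
    (* Multiplication by sigma eps, whose square is 1, isolates the vertical part of the bracket. *)
    transitivity (sigma * eps p * (sigma * (eps p * complex.Im (A p (lie Ys Zs p))))).
      rewrite (_ : _ * _ = (sigma * sigma) * (eps p * eps p) * complex.Im (A p (lie Ys Zs p))); last by ring.
      by rewrite s2 eps2 !mul1r.
    by rewrite E mulrN.
  have Om_lift Y Ys Z Zs p : is_horizontal_lift pb A Y Ys -> is_horizontal_lift pb A Z Zs ->
      Om _ (Y (pb_proj pb p)) (Z (pb_proj pb p)) = (0 +i* (sigma * eps p * deta Y Z (pb_proj pb p)))%C.
    move=> hY hZ; rewrite (OmE _ _ _ _ hY hZ) (connection_im hA) (detaE _ _ _ _ _ hY hZ).
    by apply/eqP; rewrite eq_complex /= opprK oppr0 !eqxx.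
  have OmY (p : P) (Y Z : vfield B) : Om _ (Y (pb_proj pb p)) (Z (pb_proj pb p)) =
      (0 +i* (sigma * eps p * deta Y Z (pb_proj pb p)))%C.
    have [Ys hY] := horizontal_lift_exists hA Y.
    have [Zs hZ] := horizontal_lift_exists hA Z.
    exact: Om_lift hY hZ.
  have Omxi0 (b : B) (u : tangent b) : Om b (xi b) u = 0.
    have [Z <-] := tangent_vfield u; have [p <-] := proj_surj pb b.
    rewrite OmY /deta (killing_ext_deriv (ex_intro _ sigma hxi) _ _ Kill) mulr0.
    by [].
  have [gl gs _ _] := hg.
  have phig (b : B) (u w : tangent b) : g b (phi b u) w = - (sigma / 2 * complex.Im (Om b u w)).
    have := congr1 (@complex.Re R) (phiE b u w); rewrite imag_half /= => ->.
    case: (Om b u w) => x y /=; ring.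
  (* With this [e], the form [A0] is the twist of [A] by i e times the pullback of eta. *)
  pose e : cinf P := (- sigma) *: eps.
  have e0 (p : P) (u : tangent p) : u e = 0 by rewrite tangentZ epsC mulr0.
  pose A0 (p : P) (u : tangent p) := A p u - imag_unit * sigma%:C%C * (eps p)%:C%C *
    (g (pb_proj pb p) (xi (pb_proj pb p)) (dproj pb u))%:C%C.
  have A0E (p : P) (u : tangent p) : A0 p u =
      A p u + (0 +i* (e p * g (pb_proj pb p) (xi (pb_proj pb p)) (dproj pb u)))%C.
    rewrite /A0 imag_scaleE; congr (_ + _).
    by apply/eqP; rewrite eq_complex /= oppr0 eqxx -!mulNr eqxx.
  have hA0 : is_connection_form pb A0.
    exact: (twist_connection_form hA (etaF xi) (vertically_constant pb e0) A0E).
  exists eps; split; first exact: epsE.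
  split; first exact: eps1.
  split; first exact: epsL.
  split; first exact: (proj2 (killing_defectP hg xi) Kill).
  split; first exact: (parallel_of_split hA hD DYW DVW).
  split.
    move=> b; apply: (metric_nondegenerate hg) => Z.
    by rewrite phig Omxi0 /= mulr0 oppr0.
  split; first exact: Omxi0.
  split.
    move=> p X; apply/eqP; rewrite -subr_eq0 scaleNr opprK; apply/eqP.
    apply: (metric_nondegenerate hg) => Z.
    rewrite (metricDl gl) (metricZl gl) phig OmY /=; apply: two0.
    have := levi_civita_covariant hg xi X Z (pb_proj pb p) hnabla.
    rewrite Kill addr0 -/(deta X Z _) => H.
    set G := g _ _ _ in H *.
    (* The curvature formula contributes sigma^2 eps d eta = eps d eta, and 2 G = d eta because xi
       is Killing. *)
    transitivity (eps p * (2 * G) - (sigma * sigma) * (eps p * deta X Z (pb_proj pb p))).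
      by field.
    by rewrite H s2 mul1r subrr.
  split; first by move=> p X Y; rewrite OmY imag_scaleE.
  split=> //; apply: (flat_connection hA0) => X Y Xs' Ys' p hX' hY'.
  have [Xs hX] := horizontal_lift_exists hA X.
  have [Ys hY] := horizontal_lift_exists hA Y.
  rewrite (twist_lie hA (etaF xi) (vertically_constant pb e0) A0E e0 p hX hY hX' hY').
  rewrite (detaE _ _ _ _ _ hX hY); have -> : e p = - (sigma * eps p) by exact: mulNr.
  by rewrite mulNr opprK addNr.
move=> xi A0 A eps hxiK hxi hA0 hflat eps1 AE.
have eps2 : eps * eps = 1 by case: eps1 => ->; rewrite ?mulr1 // mulrNN mulr1.
have cst0 (a : R) (p : P) (u : tangent p) : u (cinf_cst P a) = 0.
  by apply: (@tangent_cst _ _ _ _ _ _ a); apply: nearW => q; rewrite cinf_cstE.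
have AE' (p : P) (u : tangent p) : A p u = A0 p u +
    (0 +i* (cinf_cst P (sigma * eps) p * g (pb_proj pb p) (xi (pb_proj pb p)) (dproj pb u)))%C.
  by rewrite AE imag_scaleE cinf_cstE.
(* The twist is used in both directions: from [A0] to [A] to see that [A] is a connection form, from
   [A] back to [A0] to compute brackets of [A]-horizontal lifts. *)
have A0E (p : P) (u : tangent p) : A0 p u = A p u +
    (0 +i* (cinf_cst P (- (sigma * eps)) p * g (pb_proj pb p) (xi (pb_proj pb p)) (dproj pb u)))%C.
  rewrite AE' !cinf_cstE -addrA -[LHS]addr0; congr (_ + _).
  by apply/eqP; rewrite eq_complex /= addr0 mulNr addrN !eqxx.
have hA : is_connection_form pb A.
  exact: (twist_connection_form hA0 (etaF xi) (vertically_constant pb (cst0 _)) AE').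
split=> //.
have [xis hxis] := horizontal_lift_exists hA xi.
exists (fundamental_field pb), xis.
split; first exact: unit_vertical_fundamental.
split=> //.
have epsE (p : P) : cinf_cst P eps p * cinf_cst P eps p = 1 by rewrite !cinf_cstE.
split; first exact: (special_lightlike hA hxi hxis epsE).
move=> D hD.
pose deta Y Z b := ext_deriv (fun b u => g b (xi b) u) Y Z b.
have Kill := proj1 (killing_defectP hg xi) hxiK.
(* Flatness of [A0] reads 0 = a([Ys, Zs]) - e d eta(Y, Z), with a the imaginary part of [A] and e =
   - sigma eps. *)
have lieE Y Ys Z Zs p : is_horizontal_lift pb A Y Ys -> is_horizontal_lift pb A Z Zs ->
    complex.Im (A p (lie Ys Zs p)) = - (sigma * eps * deta Y Z (pb_proj pb p)).
  move=> hY hZ; have [_ flat] := hflat.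
  have [Ys' hY'] := horizontal_lift_exists hA0 Y.
  have [Zs' hZ'] := horizontal_lift_exists hA0 Z.
  have := twist_lie hA (etaF xi) (vertically_constant pb (cst0 _)) A0E (cst0 _) p hY hZ hY' hZ'.
  have := congr1 (@complex.Im R) (flat _ _ _ _ hY' hZ' p); rewrite -/(deta Y Z _) cinf_cstE.
  case: (A0 p (lie Ys' Zs' p)) => x y /= /eqP; rewrite eq_sym oppr_eq0 => /eqP -> /eqP.
  by rewrite mulNr opprK eq_sym addr_eq0 => /eqP.
have two0 (x : R) : 2 * x = 0 -> x = 0.
  by move=> /eqP; rewrite mulf_eq0 pnatr_eq0 /= => /eqP.
have xi0 Z Zs p : is_horizontal_lift pb A Z Zs -> complex.Im (A p (lie xis Zs p)) = 0.
  move=> hZ; rewrite (lieE _ _ _ _ _ hxis hZ) /deta.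
  by rewrite (killing_ext_deriv (ex_intro _ sigma hxi) _ _ Kill) mulr0 oppr0.
apply: (parallel_of_split hA hD).
  move=> Y Ys p hY; apply: (kaluza_klein_nondegenerate hg hsigma hA).
    move=> Z Zs hZ; apply: two0.
    rewrite (covariant_horizontal_horizontal hg hA hxis hD (cst0 _) p hY hZ).
    rewrite Kill addr0 (lieE _ _ _ _ _ hY hZ) cinf_cstE -/(deta Y Z _).
    rewrite (_ : sigma * _ = - ((sigma * sigma) * (eps * eps) * deta Y Z (pb_proj pb p))); last by ring.
    by rewrite s2 eps2 !mul1r addrN.
  apply: two0; rewrite (covariant_horizontal_vertical hg hA hxis hD (cst0 _) p hY).
  have -> : lie Ys xis p = (-1) *: lie xis Ys p by rewrite scaleN1r lieC.
  by rewrite (connectionZ hA) (xi0 _ _ _ hY) !mulr0 oppr0.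
move=> p; apply: (kaluza_klein_nondegenerate hg hsigma hA).
  move=> Z Zs hZ; apply: two0.
  by rewrite (covariant_vertical_horizontal hg hA hxis hD (cst0 _) p hZ) (xi0 _ _ _ hZ) mulr0.
by apply: two0; exact: (covariant_vertical_vertical hg hA hxis hD (cst0 _)).
Qed.
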